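(* Let $K$ be a field of characteristic $0$, let $A,A'$ be commutative unital $K$-algebras, let $C$ be a cocommutative $K$-coalgebra and let $\Phi:C\to \mathrm{Hom}_K(A,A')$ be a measuring of algebras. Then: (a) The maps $HC'^\Phi_\bullet(x):HC'_\bullet(A)=HC_{\bullet-1}(A)\xrightarrow{HC^\Phi_{\bullet-1}(x)}HC_{\bullet-1}(A')=HC'_\bullet(A')$, $x\in C$, determine a coalgebra measuring of (non-unital) algebras from $(HC'_\bullet(A),\ast)$ to $(HC'_\bullet(A'),\ast)$. (b) The maps $HH^\Phi_\bullet(x):HH_\bullet(A)\to HH_\bullet(A')$, $x\in C$, determine a comodule measuring (with respect to the measuring in (a)) from the $(HC'_\bullet(A),\ast)$-module $HH_\bullet(A)$ to the $(HC'_\bullet(A'),\ast)$-module $HH_\bullet(A')$, where $C$ is treated as a $C$-comodule.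
   Context: Write $\Delta_C(x)=x_{(1)}\otimes x_{(2)}$ (Sweedler notation, sums suppressed; likewise for iterated coproducts). A measuring of unital algebras $\Phi:C\to \mathrm{Hom}_K(A,A')$ is a $K$-linear map with $\Phi(x)(ab)=\Phi(x_{(1)})(a)\Phi(x_{(2)})(b)$ and $\Phi(x)(1_A)=\epsilon_C(x)1_{A'}$; a measuring of non-unital algebras satisfies only the first condition. Write $x(a)=\Phi(x)(a)$. Given a measuring $\Phi:C\to\mathrm{Hom}_K(R,R')$, modules $M$ over $R$ and $M'$ over $R'$, and a $C$-comodule $D$ with coaction $d\mapsto d_{(1)}\otimes d_{(2)}\in C\otimes D$, a comodule measuring is a linear map $\Psi:D\to \mathrm{Hom}_K(M,M')$ with $\Psi(d)(am)=\Phi(d_{(1)})(a)\Psi(d_{(2)})(m)$ for $d\in D,a\in R,m\in M$. Let $\bar A=A/K$, $\bar C_n(A)=A\otimes\bar A^{\otimes n}$, with induced Hochschild differential $b$ and Connes operator $B:\bar C_n(A)\to\bar C_{n+1}(A)$. $HH_\bullet(A)$ is the homology of $(\bar C_\bullet(A),b)$, and $HC_\bullet(A)$ is the homology of the total complex of the normalized mixed complex $\overline{\mathscr{BC}}_{\bullet\bullet}(A)=(\bar C_\bullet(A),b,B)$, whose degree $p$ term is $\bar C_p(A)\oplus\bar C_{p-2}(A)\oplus\cdots$. The maps $HH^\Phi_\bullet(x)$ and $HC^\Phi_\bullet(x)$ are induced by $(a_0,\dots,a_n)\mapsto(x_{(1)}(a_0),\dots,x_{(n+1)}(a_n))$. The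 shuffle product on Hochschild chains is $(a_0,\dots,a_p)\times(b_0,\dots,b_q)=\sum_{\sigma}\mathrm{sgn}(\sigma)\,\sigma\cdot(a_0b_0,a_1,\dots,a_p,b_1,\dots,b_q)$, the sum over $(p,q)$-shuffles $\sigma\in S_{p+q}$ (those with $\sigma(1)<\cdots<\sigma(p)$ and $\sigma(p+1)<\cdots<\sigma(p+q)$), where $\sigma\cdot(c_0,c_1,\dots,c_n)=(c_0,c_{\sigma^{-1}(1)},\dots,c_{\sigma^{-1}(n)})$. The product $\ast:HC_p(A)\otimes HC_q(A)\to HC_{p+q+1}(A)$ is induced by $$(\tilde a_p,\tilde a_{p-2},\dots)\otimes(\tilde b_q,\tilde b_{q-2},\dots)\mapsto(B\tilde a_p\times\tilde b_q,\,B\tilde a_p\times\tilde b_{q-2},\dots).$$ With $HC'_\bullet(A):=HC_{\bullet-1}(A)$, it makes $(HC'_\bullet(A),\ast)$ an associative graded (non-unital) algebra. $HH_\bullet(A)$ is a module over $(HC'_\bullet(A),\ast)$ via $HC'_p(A)\otimes HH_q(A)\to HH_{p+q}(A)$ induced by $(\tilde a_{p-1},\tilde a_{p-3},\dots)\otimes\tilde b_q\mapsto B\tilde a_{p-1}\times\tilde b_q$. *)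

(* Defs.v *)
From HB Require Import structures.
From mathcomp Require Import all_boot all_order all_algebra perm.
From mathcomp Require Import zify.
From mathcomp Require Import boolp.
From mathcomp Require Import freeg.
Set Implicit Arguments.
Unset Strict Implicit.
Unset Printing Implicit Defensive.
Import GRing.Theory.
Local Open Scope ring_scope.
Local Open Scope quotient_scope.

(* The library's [comAlgType] requires 1 != 0; here the zero algebra is        *)
(* allowed, as among arbitrary commutative unital K-algebras.                  *)
Record comPzAlgType (K : pzRingType) := ComPzAlg {
  cpa_ring : comPzRingType;
  cpa_scale : K -> cpa_ring -> cpa_ring;
  cpa_scalerA : forall a b x, cpa_scale a (cpa_scale b x) = cpa_scale (a * b) x;
  cpa_scale1r : left_id 1 cpa_scale;
  cpa_scalerDr : right_distributive cpa_scale +%R;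
  cpa_scalerDl : forall x, {morph cpa_scale^~ x : a b / a + b};
  cpa_scalerAl : forall k x y, cpa_scale k (x * y) = cpa_scale k x * y
}.
Definition cpa_sort (K : pzRingType) (A : comPzAlgType K) : Type := cpa_ring A.
Coercion cpa_sort : comPzAlgType >-> Sortclass.
HB.instance Definition _ (K : pzRingType) (A : comPzAlgType K) :=
  GRing.ComPzRing.on (cpa_sort A).
HB.instance Definition _ (K : pzRingType) (A : comPzAlgType K) :=
  GRing.Zmodule_isLmodule.Build K (cpa_sort A)
    (@cpa_scalerA K A) (@cpa_scale1r K A) (@cpa_scalerDr K A) (@cpa_scalerDl K A).
Lemma pz_scalerAl (K : pzRingType) (A : comPzAlgType K) (k : K) (x y : A) :
  k *: (x * y) = (k *: x) * y.
Proof. exact: cpa_scalerAl. Qed.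
Lemma pz_scalerAr (K : pzRingType) (A : comPzAlgType K) (k : K) (x y : A) :
  k *: (x * y) = x * (k *: y).
Proof. by rewrite mulrC pz_scalerAl mulrC. Qed.
Definition cpa_of_comAlg (K : pzRingType) (A : comAlgType K) : comPzAlgType K :=
  @ComPzAlg K A *:%R (@scalerA K A) (@scale1r K A) (@scalerDr K A) 
  (@scalerDl K A) (@scalerAl K A).

Section Quotient.
Variables (K : fieldType) (V : lmodType K) (S : V -> Prop).

Inductive span : V -> Prop :=
| span0 : span 0
| spanD k u v : S u -> span v -> span (k *: u + v).

Lemma spanP k u v : span u -> span v -> span (k *: u + v).
Proof.
move=> su sv; elim: su => [|l w z Sw _ IH]; first by rewrite scaler0 add0r.
by rewrite scalerDr scalerA -addrA; apply: spanD.
Qed.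

Lemma spanS u : S u -> span u.
Proof. by move=> Su; rewrite -[u]scale1r -[_ *: _]addr0; apply: spanD span0. Qed.

Definition quot_rel (u v : V) : bool := `[< span (u - v) >].

Lemma quot_rel_refl : reflexive quot_rel.
Proof. by move=> u; apply/asboolP; rewrite subrr; apply: span0. Qed.

Lemma quot_relP u v : span (u - v) -> span (v - u).
Proof. by move=> h; have := spanP (-1) h span0; rewrite addr0 scaleN1r opprB. Qed.

Lemma quot_rel_sym : symmetric quot_rel.
Proof. by move=> u v; apply/asboolP/asboolP; apply: quot_relP. Qed.

Lemma quot_rel_trans : transitive quot_rel.
Proof.
move=> v u w /asboolP h1 /asboolP h2; apply/asboolP.
by have := spanP 1 h1 h2; rewrite scale1r addrA subrK.
Qed.

Canonical quot_rel_equiv := EquivRel quot_rel quot_rel_refl quot_rel_sym quot_rel_trans.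

(* V modulo the subspace spanned by S *)
Definition quot := {eq_quot quot_rel}.
HB.instance Definition _ := Choice.on quot.
HB.instance Definition _ := EqQuotient.on quot.

Definition proj (v : V) : quot := \pi_quot v.

Lemma proj_eqP u v : proj u = proj v <-> span (u - v).
Proof.
rewrite /proj; split=> [/eqP|h]; last by apply/eqP; rewrite eqmodE; apply/asboolP.
by rewrite eqmodE => /asboolP.
Qed.

Lemma projK (x : quot) : proj (repr x) = x.
Proof. exact: reprK. Qed.

Lemma repr_proj v : span (repr (proj v) - v).
Proof. by apply/proj_eqP; rewrite projK. Qed.

Definition quot_zero : quot := proj 0.
Definition quot_add (x y : quot) := proj (repr x + repr y).
Definition quot_opp (x : quot) := proj (- repr x).
Definition quot_scale (k : K) (x : quot) := proj (k *: repr x).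

Lemma quot_addE u v : quot_add (proj u) (proj v) = proj (u + v).
Proof.
apply/proj_eqP; rewrite opprD addrACA -[X in span (X + _)]scale1r.
by apply: spanP; apply: repr_proj.
Qed.

Lemma quot_oppE u : quot_opp (proj u) = proj (- u).
Proof. by apply/proj_eqP; rewrite opprK addrC; apply/quot_relP/repr_proj. Qed.

Lemma quot_scaleE k u : quot_scale k (proj u) = proj (k *: u).
Proof.
apply/proj_eqP; rewrite -scalerBr -[_ *: _]addr0.
by apply: spanP (repr_proj _) span0.
Qed.

Lemma quot_ind (P : quot -> Prop) : (forall v, P (proj v)) -> forall x, P x.
Proof. by move=> h x; rewrite -(projK x). Qed.

Lemma quot_addA : associative quot_add.
Proof.
by elim/quot_ind=> u; elim/quot_ind=> v; elim/quot_ind=> w; rewrite !quot_addE addrA.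
Qed.
Lemma quot_addC : commutative quot_add.
Proof. by elim/quot_ind=> u; elim/quot_ind=> v; rewrite !quot_addE addrC. Qed.
Lemma quot_add0 : left_id quot_zero quot_add.
Proof. by elim/quot_ind=> u; rewrite quot_addE add0r. Qed.
Lemma quot_addN : left_inverse quot_zero quot_opp quot_add.
Proof. by elim/quot_ind=> u; rewrite quot_oppE quot_addE addNr. Qed.

HB.instance Definition _ :=
  GRing.isZmodule.Build quot quot_addA quot_addC quot_add0 quot_addN.

Lemma quot_scaleA a b x : quot_scale a (quot_scale b x) = quot_scale (a * b) x.
Proof. by elim/quot_ind: x => u; rewrite !quot_scaleE scalerA. Qed.
Lemma quot_scale1 : left_id 1 quot_scale.
Proof. by elim/quot_ind=> u; rewrite quot_scaleE scale1r. Qed.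
Lemma quot_scaleDr : right_distributive quot_scale +%R.
Proof.
move=> k; elim/quot_ind=> u; elim/quot_ind=> v.
by rewrite /+%R /= quot_addE !quot_scaleE quot_addE scalerDr.
Qed.
Lemma quot_scaleDl x : {morph quot_scale^~ x : a b / a + b}.
Proof.
move=> a b; elim/quot_ind: x => u.
by rewrite !quot_scaleE [RHS]quot_addE scalerDl.
Qed.

HB.instance Definition _ := GRing.Zmodule_isLmodule.Build K quot
  quot_scaleA quot_scale1 quot_scaleDr quot_scaleDl.

Lemma proj_linear : linear proj.
Proof. by move=> k u v; rewrite -quot_addE -quot_scaleE. Qed.

HB.instance Definition _ := GRing.isLinear.Build K V quot *:%R proj proj_linear.

End Quotient.

Lemma quot_map_linear (K : fieldType) (V W : lmodType K) (S : V -> Prop)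
    (f : V -> W) : linear f -> (forall u, S u -> f u = 0) ->
  linear (fun x : quot S => f (repr x)) /\
  (forall v, f (repr (proj S v)) = f v).
Proof.
move=> flin fS.
have f0 : f 0 = 0 by have := flin (-1) 0 0; rewrite scaler0 addr0 scaleN1r addNr.
have fspan u : span S u -> f u = 0.
  by elim=> [//|k v w Sv _ IH]; rewrite flin fS // IH scaler0 addr0.
have fE v : f (repr (proj S v)) = f v.
  have := fspan _ (repr_proj S v); rewrite addrC -scaleN1r flin => /eqP.
  by rewrite scaleN1r addrC subr_eq0 => /eqP.
split=> [k|//]; elim/quot_ind=> u; elim/quot_ind=> v.
by rewrite -proj_linear !fE flin.
Qed.

Section Presentation.
Variables (K : fieldType) (T : choiceType) (S : {freeg T / K} -> Prop).

(* The K-module with generators T and relations S *)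
Definition pres : lmodType K := quot S.

Definition pgen (t : T) : pres := proj S << t >>.

(* The linear extension of a function on the generators, evaluated on some     *)
(* representative; it does not depend on the latter when the function respects *)
(* the relations, see [plift_linear] and [plift_gen].                          *)
Definition plift (W : lmodType K) (f : T -> W) (x : pres) : W := fglift f (repr x).

Lemma fglift_linear (W : lmodType K) (f : T -> W) :
  linear (fglift f : {freeg T / K} -> W).
Proof.
move=> k; have fgD := (lift_is_additive f).
have fgadd u v : fglift f (u + v) = fglift f u + fglift f v.
  have fgN w : fglift f (- w) = - fglift f w.
    have := fgD 0 w; rewrite sub0r => ->.
    by have := fgD 0 0; rewrite !subrr => ->; rewrite sub0r.
  by rewrite -[v in LHS]opprK fgD fgN opprK.
have fg0 : fglift f (0 : {freeg T / K}) = 0.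
  by have := fgD 0 0; rewrite !subrr.
have fgsum (r : seq T) (F : T -> {freeg T / K}) :
    fglift f (\sum_(x <- r) F x) = \sum_(x <- r) fglift f (F x).
  by elim: r => [|x r IH]; rewrite ?big_nil // !big_cons fgadd IH.
move=> u v; rewrite fgadd; congr (_ + _).
rewrite -[u]freeg_sumE scaler_sumr !fgsum scaler_sumr; apply: eq_bigr => x _.
have -> (a : K) : k *: << a *g x >> = << (k * a) *g x >>.
  by apply/eqP/freeg_eqP => y; rewrite coeffZ !coeffU mulrA.
by rewrite !liftU scalerA.
Qed.

Definition respects (W : lmodType K) (f : T -> W) :=
  forall r, S r -> fglift f r = 0.

Lemma plift_linear (W : lmodType K) (f : T -> W) : respects f -> linear (plift f).
Proof. by move=> h; case: (quot_map_linear (fglift_linear f) h). Qed.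

Lemma plift_gen (W : lmodType K) (f : T -> W) t :
  respects f -> plift f (pgen t) = f t.
Proof.
move=> h; case: (quot_map_linear (fglift_linear f) h) => _ E.
by rewrite /plift E liftU scale1r.
Qed.

Lemma pgen_ind (P : pres -> Prop) :
  P 0 -> (forall k t x, P x -> P (k *: pgen t + x)) -> forall x, P x.
Proof.
move=> P0 PD; elim/quot_ind=> v; rewrite -[v]freeg_sumE.
elim: (dom v) => [|t s IH]; first by rewrite big_nil linear0.
rewrite big_cons linearD /=.
have -> (a : K) : << a *g t >> = a *: << t >>.
  by apply/eqP/freeg_eqP => y; rewrite coeffZ !coeffU mul1r.
by rewrite linearZ; apply: PD.
Qed.

End Presentation.

Section Tensor.
Variables (K : fieldType) (V W : lmodType K).

Inductive tens_rel : {freeg (V * W) / K} -> Prop :=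
| tens_rel_l k v v' w :
    tens_rel (<< (k *: v + v', w) >> - (k *: << (v, w) >> + << (v', w) >>))
| tens_rel_r k v w w' :
    tens_rel (<< (v, k *: w + w') >> - (k *: << (v, w) >> + << (v, w') >>)).

Definition tens : lmodType K := pres tens_rel.
Definition tgen (v : V) (w : W) : tens := pgen tens_rel (v, w).

(* For bilinear f and z = \sum_i v_i ⊗ w_i, [tlift f z] is \sum_i f v_i w_i;  *)
(* so [tlift f (comul x)] is the sum written f(x_(1), x_(2)).                  *)
Definition tlift (U : lmodType K) (f : V -> W -> U) (z : tens) : U :=
  plift (fun p => f p.1 p.2) z.

Lemma tlift_respects (U : lmodType K) (f : V -> W -> U) :
  (forall v, linear (f v)) -> (forall w, linear (f^~ w)) ->
  respects tens_rel (fun p => f p.1 p.2).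
Proof.
move=> h1 h2 r [k v v' w|k v w w'];
  have fl := fglift_linear (fun p => f p.1 p.2);
  rewrite addrC -scaleN1r !fl !liftU !scale1r /= ?h1 ?(h2 w) scaleN1r addNr //.
Qed.

End Tensor.

Notation "v ⊗ w" := (tgen v w) (at level 40, left associativity) : ring_scope.

Section DirectSum.
Variables (K : fieldType) (V : nat -> lmodType K).

Definition hgen (n : nat) (v : V n) : {n : nat & V n} := Tagged V v.

Inductive dsum_rel : {freeg {n : nat & V n} / K} -> Prop :=
| dsum_rel_lin n k (u v : V n) :
    dsum_rel (<< hgen (k *: u + v) >> - (k *: << hgen u >> + << hgen v >>)).

(* The direct sum of the V n, presented by homogeneous elements *)
Definition dsum : lmodType K := pres dsum_rel.
Definition dinj (n : nat) (v : V n) : dsum := pgen dsum_rel (hgen v).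

Definition dlift (W : lmodType K) (f : forall n, V n -> W) (x : dsum) : W :=
  plift (fun h : {n : nat & V n} => f (tag h) (tagged h)) x.

Lemma dlift_respects (W : lmodType K) (f : forall n, V n -> W) :
  (forall n, linear (f n)) -> respects dsum_rel (fun h : {n : nat & V n} => f (tag h) (tagged h)).
Proof.
move=> h r [n k u v]; have fl := fglift_linear (fun h : {n : nat & V n} => f (tag h) (tagged h)).
by rewrite addrC -scaleN1r !fl !liftU !scale1r /= h scaleN1r addNr.
Qed.

End DirectSum.

Section Coalgebra.
Variable K : fieldType.

Record coalgebra := Coalgebra {
  coalg_sort :> lmodType K;
  comul : {linear coalg_sort -> tens coalg_sort coalg_sort};
  counit : {linear coalg_sort -> K^o};
  comulA : forall x,
    tlift (fun y z => tlift (fun y1 y2 => y1 ⊗ (y2 ⊗ z)) (comul y)) (comul x) =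
    tlift (fun y z => y ⊗ comul z) (comul x);
  counitl : forall x, tlift (fun y z => counit y *: z) (comul x) = x;
  counitr : forall x, tlift (fun y z => counit z *: y) (comul x) = x
}.

Arguments comul {_}.
Arguments counit {_}.

Definition cocommutative (C : coalgebra) :=
  forall x : C, tlift (fun y z => z ⊗ y) (comul x) = comul x.

Record comodule (C : coalgebra) := Comodule {
  comod_sort :> lmodType K;
  coact : {linear comod_sort -> tens C comod_sort};
  coactA : forall d,
    tlift (fun y e => tlift (fun y1 y2 => y1 ⊗ (y2 ⊗ e)) (comul y)) (coact d) =
    tlift (fun y e => y ⊗ coact e) (coact d);
  coact1 : forall d, tlift (fun y e => counit y *: e) (coact d) = d
}.

Arguments coact {_ _}.

Definition regular_comodule (C : coalgebra) : comodule C :=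
  @Comodule C C comul (@comulA C) (@counitl C).

(* [sweedler n f x] is f [:: x_(1); ...; x_(n+1)], for f multilinear in the    *)
(* entries of sequences of size n+1.                                           *)
Fixpoint sweedler (C : coalgebra) (W : lmodType K) (n : nat)
    (f : seq C -> W) (x : C) : W :=
  if n is m.+1 then
    tlift (fun y z => sweedler m (fun s => f (y :: s)) z) (comul x)
  else f [:: x].

Record nonunital_measuring (C : coalgebra) (R R' : lmodType K)
    (mulR : R -> R -> R) (mulR' : R' -> R' -> R') (Phi : C -> R -> R') : Prop := {
  meas_linear : forall x, linear (Phi x);
  meas_linearl : forall a, linear (Phi^~ a);
  measM : forall x a b,
    Phi x (mulR a b) = tlift (fun y z => mulR' (Phi y a) (Phi z b)) (comul x)
}.

Record measuring (C : coalgebra) (A A' : comPzAlgType K) (Phi : C -> A -> A') : Prop := {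
  meas_nonunital : @nonunital_measuring C A A' *%R *%R Phi;
  meas1 : forall x, Phi x 1 = counit x *: (1 : A')
}.

Record comodule_measuring (C : coalgebra) (D : comodule C) (R R' M M' : lmodType K)
    (actM : R -> M -> M) (actM' : R' -> M' -> M')
    (Phi : C -> R -> R') (Psi : D -> M -> M') : Prop := {
  cmeas_linear : forall d, linear (Psi d);
  cmeas_linearl : forall m, linear (Psi^~ m);
  cmeas_act : forall d a m,
    Psi d (actM a m) = tlift (fun y e => actM' (Phi y a) (Psi e m)) (coact d)
}.

End Coalgebra.

Section Homology.
Variables (K : fieldType) (X : nat -> lmodType K).
Variable d : forall n, {linear X n.+1 -> X n}.

Definition is_cycle (n : nat) : {pred X n} :=
  match n return {pred X n} with
  | 0 => predT
  | m.+1 => fun z => d m z == 0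
  end.

Lemma is_cycle_submod n : submod_closed (is_cycle (n := n)).
Proof.
case: n => [|n]; split=> //=; rewrite ?inE /is_cycle /=.
  by rewrite unfold_in linear0.
by move=> k u v; rewrite !unfold_in linearP => /eqP-> /eqP->; rewrite scaler0 addr0.
Qed.

HB.instance Definition _ n :=
  GRing.isSubmodClosed.Build K (X n) (is_cycle (n := n)) (is_cycle_submod n).

Definition cycles (n : nat) := {z : X n | z \in is_cycle (n := n)}.
HB.instance Definition _ n := SubChoice.on (cycles n).
HB.instance Definition _ n := [SubChoice_isSubLmodule of cycles n by <:].

Definition is_boundary n (z : cycles n) : Prop := exists w, val z = d n w.

Definition homology (n : nat) : lmodType K := quot (is_boundary (n := n)).

(* The class of a cycle, and 0 on other chains *)
Definition hclass n (z : X n) : homology n :=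
  if insub z is Some c then proj (is_boundary (n := n)) c else 0.

Definition hrepr n (h : homology n) : X n := val (repr h).

End Homology.

Section Induced.
Variable K : fieldType.
Variables (X Y Z : nat -> lmodType K).
Variable dX : forall n, {linear X n.+1 -> X n}.
Variable dY : forall n, {linear Y n.+1 -> Y n}.
Variable dZ : forall n, {linear Z n.+1 -> Z n}.

(* The maps on homology induced by (bi)linear maps on chains, computed on      *)
(* representatives; see [hmap_hclass] and [hmap2_hclass].                      *)
Definition hmap m n (f : X m -> Y n) (a : homology dX m) : homology dY n :=
  hclass dY (f (hrepr a)).

Definition hmap2 m n p (f : X m -> Y n -> Z p)
    (a : homology dX m) (b : homology dY n) : homology dZ p :=
  hclass dZ (f (hrepr a) (hrepr b)).

Lemma hclassP n (z : X n) : z \in is_cycle dX (n := n) ->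
  exists2 w, hrepr (hclass dX z) = z + dX n w &
             hrepr (hclass dX z) \in is_cycle dX (n := n).
Proof.
move=> zc; have cc := valP (repr (hclass dX z)).
have [w] : exists w, hrepr (hclass dX z) - z = dX n w; last first.
  by move=> E; exists w => //; rewrite -E addrC subrK.
suff H c : span (is_boundary (d := dX) (n := n)) c -> exists w, val c = dX n w.
  by apply: (H (repr (hclass dX z) - Sub z zc)); rewrite /hclass insubT; apply: repr_proj.
elim=> [|k u v [w uE] _ [w' vE]]; first by exists 0; rewrite linear0.
by exists (k *: w + w'); rewrite linearP /= -uE -vE.
Qed.

Lemma hclassD_boundary n (z : X n) w : z \in is_cycle dX (n := n) ->
  dX n w \in is_cycle dX (n := n) -> hclass dX (z + dX n w) = hclass dX z.
Proof.
move=> zc wc; have zwc : z + dX n w \in is_cycle dX (n := n) by apply: rpredD.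
rewrite /hclass !insubT; apply/proj_eqP/spanS; exists w.
by rewrite raddfB /= [z + _]addrC addrK.
Qed.

End Induced.

Lemma hmap_hclass (K : fieldType) (X Y : nat -> lmodType K)
    (dX : forall n, {linear X n.+1 -> X n}) (dY : forall n, {linear Y n.+1 -> Y n})
    m n (f : {linear X m -> Y n}) :
  (forall z, z \in is_cycle dX (n := m) -> f z \in is_cycle dY (n := n)) ->
  (forall w, exists w', f (dX m w) = dY n w') ->
  forall z, z \in is_cycle dX (n := m) -> hmap dY f (hclass dX z) = hclass dY (f z).
Proof.
move=> fc fb z zc; have [w rE rc] := hclassP zc.
rewrite /hmap rE linearD; have [w' E] := fb w; rewrite E.
apply: hclassD_boundary; first exact: fc.
have -> : dY n w' = f (hrepr (hclass dX z)) - f z.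
  by rewrite rE linearD E addrC addKr.
by apply: rpredB; apply: fc.
Qed.

Lemma hmap2_hclass (K : fieldType) (X Y Z : nat -> lmodType K)
    (dX : forall n, {linear X n.+1 -> X n}) (dY : forall n, {linear Y n.+1 -> Y n})
    (dZ : forall n, {linear Z n.+1 -> Z n}) m n p (f : X m -> Y n -> Z p) :
  (forall x, linear (f x)) -> (forall y, linear (f^~ y)) ->
  (forall x y, x \in is_cycle dX (n := m) -> y \in is_cycle dY (n := n) ->
     f x y \in is_cycle dZ (n := p)) ->
  (forall w y, y \in is_cycle dY (n := n) -> exists w', f (dX m w) y = dZ p w') ->
  (forall x w, x \in is_cycle dX (n := m) -> exists w', f x (dY n w) = dZ p w') ->
  forall x y, x \in is_cycle dX (n := m) -> y \in is_cycle dY (n := n) ->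
    hmap2 dZ f (hclass dX x) (hclass dY y) = hclass dZ (f x y).
Proof.
move=> fr fl fc fX fY x y xc yc.
have [u uE uc] := hclassP xc; have [v vE vc] := hclassP yc.
have frD a b b' : f a (b + b') = f a b + f a b'.
  by have := fr a 1 b b'; rewrite !scale1r.
have flD a a' b : f (a + a') b = f a b + f a' b.
  by have := fl b 1 a a'; rewrite !scale1r.
rewrite /hmap2 vE frD; have [w' E'] := fY _ v uc; rewrite E'.
rewrite uE flD; have [w E] := fX u y yc; rewrite E -addrA -linearD.
apply: hclassD_boundary; first exact: fc.
have -> : dZ p (w + w') = f (hrepr (hclass dX x)) (hrepr (hclass dY y)) - f x y.
  by rewrite vE frD E' uE flD E linearD -(addrA (f x y)) [X in _ = X - _]addrC addrK.
by apply: rpredB; apply: fc.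
Qed.

Section Chains.
Variables (K : fieldType) (A : comPzAlgType K).

(* The quotient A / K.1 *)
Definition Abar : lmodType K := quot (fun a : A => a = 1).

Definition fupd (n : nat) (u : {ffun 'I_n -> Abar}) (i : 'I_n) (x : Abar) :
  {ffun 'I_n -> Abar} := [ffun j => if j == i then x else u j].

Inductive chain_rel (n : nat) : {freeg (A * {ffun 'I_n -> Abar}) / K} -> Prop :=
| chain_rel_head k (a a' : A) u :
    chain_rel (<< (k *: a + a', u) >> - (k *: << (a, u) >> + << (a', u) >>))
| chain_rel_tail k a u i x x' :
    chain_rel (<< (a, fupd u i (k *: x + x')) >>
               - (k *: << (a, fupd u i x) >> + << (a, fupd u i x') >>)).

(* A ⊗ Abar^(⊗n): the multilinear relations among (n+1)-tuples of A * Abar^n   *)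
Definition chain (n : nat) : lmodType K := pres (@chain_rel n).

(* The class of (s 0, ..., s n) *)
Definition ch (n : nat) (s : nat -> A) : chain n :=
  pgen (@chain_rel n) (s 0%N, [ffun i : 'I_n => proj (fun a : A => a = 1) (s i.+1)]).

Definition crep (n : nat) (t : A * {ffun 'I_n -> Abar}) (j : nat) : A :=
  if j is i.+1 then (if insub i is Some i' then repr (t.2 i') else 0) else t.1.

(* The map on chains induced by a formula in the entries of (s 0, ..., s n)    *)
(* that is multilinear and vanishes when s i = 1 for some i > 0, see [cliftE]. *)
Definition clift (n : nat) (W : lmodType K) (F : (nat -> A) -> W) (z : chain n) : W :=
  plift (fun t => F (crep t)) z.

Definition supd (s : nat -> A) (i : nat) (a : A) (j : nat) : A :=
  if j == i then a else s j.

Record normalized_form (n : nat) (W : lmodType K) (F : (nat -> A) -> W) : Prop := {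
  nform_ext : forall s t, (forall j, (j <= n)%N -> s j = t j) -> F s = F t;
  nform_lin : forall i s k a a', (i <= n)%N ->
    F (supd s i (k *: a + a')) = k *: F (supd s i a) + F (supd s i a');
  nform1 : forall i s, (0 < i <= n)%N -> s i = 1 -> F s = 0
}.

Lemma span1P (a : A) : span (fun a : A => a = 1) a -> exists k : K, a = k *: (1 : A).
Proof.
elim=> [|k u v -> _ [l ->]]; first by exists 0; rewrite scale0r.
by exists (k + l); rewrite scalerDl.
Qed.

Lemma repr_projE (a : A) :
  exists k : K, repr (proj (fun a : A => a = 1) a) = k *: (1 : A) + a.
Proof.
by have [k /eqP] := span1P (repr_proj _ a); rewrite subr_eq => /eqP; exists k.
Qed.

Lemma nform_shift n (W : lmodType K) (F : (nat -> A) -> W) s i k a :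
  normalized_form n F -> (0 < i <= n)%N -> F (supd s i (k *: (1 : A) + a)) = F (supd s i a).
Proof.
move=> [_ Fl F1] i_n; rewrite Fl; last by case/andP: i_n.
by rewrite (F1 i (supd s i 1)) // ?scaler0 ?add0r // /supd eqxx.
Qed.

Lemma clift_respects n (W : lmodType K) (F : (nat -> A) -> W) :
  normalized_form n F -> respects (@chain_rel n) (fun t => F (crep t)).
Proof.
move=> nF; have [Fe Fl F1] := nF.
have fl := fglift_linear (fun t : A * {ffun 'I_n -> Abar} => F (crep t)).
move=> r [k a a' u|k a u i x x'];
  rewrite addrC -scaleN1r !fl !liftU !scale1r scaleN1r addrC; apply/eqP;
  rewrite subr_eq0; apply/eqP.
- have E c : F (crep (c, u)) = F (supd (crep (0, u)) 0 c).
    by apply: Fe => -[|j].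
  by rewrite !E Fl.
- have E y : F (crep (a, fupd u i y)) = F (supd (crep (a, u)) i.+1 (repr y)).
    apply: Fe => -[|j] //= jn; rewrite /supd eqSS insubT /= ffunE.
    by rewrite -val_eqE /=; case: eqP => // _; rewrite insubT.
  rewrite !E.
  have [c] : exists c, repr (k *: x + x') = c *: (1 : A) + (k *: repr x + repr x').
    rewrite -{1}(projK x) -{1}(projK x') -proj_linear; exact: repr_projE.
  by move=> ->; rewrite (nform_shift _ _ _ nF) ?Fl //=.
Qed.

Lemma clift_linear n (W : lmodType K) (F : (nat -> A) -> W) :
  normalized_form n F -> linear (clift F : chain n -> W).
Proof. by move=> nF; apply/plift_linear/clift_respects. Qed.

Lemma cliftE n (W : lmodType K) (F : (nat -> A) -> W) s :
  normalized_form n F -> clift F (ch n s) = F s.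
Proof.
move=> nF; rewrite [LHS]plift_gen; last exact: clift_respects.
set r := crep _.
have H m : (m <= n)%N -> F r = F (fun j => if (j <= m)%N then s j else r j).
  elim: m => [_|m IH mn]; first by apply: (nform_ext nF) => -[|j].
  rewrite IH; last exact: ltnW.
  set s1 := (X in F X = _); set s2 := (X in _ = F X).
  have [k rE] := repr_projE (s m.+1).
  transitivity (F (supd s1 m.+1 (k *: (1 : A) + s m.+1))).
    apply: (nform_ext nF) => j jn; rewrite /supd; case: eqP => // ->.
    by rewrite /s1 ltnn /r /= insubT /= ffunE rE.
  rewrite (nform_shift _ _ _ nF) //; apply: (nform_ext nF) => j jn.
  rewrite /supd /s1 /s2; case: eqP => [->|/eqP jm]; first by rewrite leqnn.
  by rewrite [in RHS]leq_eqVlt (negbTE jm) ltnS.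
by rewrite (H n) //; apply: (nform_ext nF) => j ->.
Qed.

Lemma ch_nform n : normalized_form n (ch n).
Proof.
have ext s t : (forall j, (j <= n)%N -> s j = t j) -> ch n s = ch n t.
  move=> st; rewrite /ch st //; congr (pgen _ (_, _)).
  by apply/ffunP=> i; rewrite !ffunE st.
have lin i s k a a' : (i <= n)%N ->
    ch n (supd s i (k *: a + a')) = k *: ch n (supd s i a) + ch n (supd s i a').
  have relE r : chain_rel r -> proj (@chain_rel n) r = 0.
    move=> h; rewrite -(linear0 (proj (@chain_rel n))); apply/proj_eqP.
    by rewrite subr0; apply: spanS.
  case: i => [_|i i_n]; rewrite /ch /supd /=.
    set u := [ffun _ => _].
    have := relE _ (chain_rel_head k a a' u); rewrite linearB linearP /=.
    by move/eqP; rewrite subr_eq0 => /eqP.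
  pose u := [ffun j : 'I_n => proj (fun a : A => a = 1) (s j.+1)].
  have E b : [ffun j : 'I_n => proj (fun a : A => a = 1)
      (if j.+1 == i.+1 then b else s j.+1)] =
      fupd u (Ordinal i_n) (proj (fun a : A => a = 1) b).
    by apply/ffunP=> j; rewrite !ffunE -val_eqE /= eqSS; case: eqP.
  rewrite !E proj_linear.
  have := relE _ (chain_rel_tail k (s 0%N) u (Ordinal i_n) (proj _ a) (proj _ a')).
  by rewrite linearB linearP /= => /eqP; rewrite subr_eq0 => /eqP.
split=> // -[//|i] s i_n si.
have ch0 t j : (j <= n)%N -> ch n (supd t j 0) = 0.
  by move=> jn; have := lin j t (-1) 0 0 jn; rewrite scaler0 addr0 scaleN1r addNr.
rewrite -[RHS](ch0 s i.+1) // /ch /supd /=; congr (pgen _ (_, _)).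
apply/ffunP=> j; rewrite !ffunE; case: eqP => // ->.
by apply/proj_eqP; rewrite si subr0; apply: spanS.
Qed.

Definition face (i : nat) (s : nat -> A) (j : nat) : A :=
  if (j < i)%N then s j else if j == i then s i * s i.+1 else s j.+1.

Definition last_face (n : nat) (s : nat -> A) (j : nat) : A :=
  if j is _.+1 then s j else s n.+1 * s 0%N.

Definition hoch_form (n : nat) (s : nat -> A) : chain n :=
  \sum_(i < n.+1) (-1) ^+ i *: ch n (face i s) + (-1) ^+ n.+1 *: ch n (last_face n s).

Definition rotated (n i : nat) (s : nat -> A) (j : nat) : A :=
  if j is k.+1 then s ((i + k) %% n.+1)%N else 1.

Definition connes_form (n : nat) (s : nat -> A) : chain n.+1 :=
  \sum_(i < n.+1) (-1) ^+ (n * i) *: ch n.+1 (rotated n i s).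

Lemma ch_lin_subst n (f : (nat -> A) -> nat -> A) s i l (g : A -> A) :
  (l <= n)%N -> linear g ->
  (forall a j, (j <= n)%N -> f (supd s i a) j = supd (f s) l (g a) j) ->
  forall k a a', ch n (f (supd s i (k *: a + a'))) =
    k *: ch n (f (supd s i a)) + ch n (f (supd s i a')).
Proof.
move=> ln gl fE k a a'; have [ce cl _] := ch_nform n.
by rewrite !(ce _ _ (fE _)) gl cl.
Qed.

Lemma mulr_lin (b : A) : linear (fun a : A => a * b).
Proof. by move=> k u v; rewrite mulrDl pz_scalerAl. Qed.
Lemma mull_lin (b : A) : linear (fun a : A => b * a).
Proof. by move=> k u v; rewrite mulrDr pz_scalerAr. Qed.
Lemma idA_lin : linear (fun a : A => a). Proof. by []. Qed.

Lemma face_lin n i s j k (a a' : A) : (i <= n)%N -> (j <= n.+1)%N ->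
  ch n (face i (supd s j (k *: a + a'))) =
    k *: ch n (face i (supd s j a)) + ch n (face i (supd s j a')).
Proof.
move=> i_n jn; case: (ltngtP j i) => [ji|ij|ji].
- apply: (ch_lin_subst (l := j) _ idA_lin); first lia.
  by move=> c l ln; rewrite /face /supd; do !case: ifP => //=; lia.
- have [ji|ji] := eqVneq j i.+1.
    apply: (ch_lin_subst (l := i) _ (mull_lin (s i))) => // c l ln.
    rewrite /face /supd ji eqxx [i == i.+1]ltn_eqF //.
    by do !case: ifP => //=; lia.
  apply: (ch_lin_subst (l := j.-1) _ idA_lin); first lia.
  by move=> c l ln; rewrite /face /supd; do !case: ifP => //=; lia.
- apply: (ch_lin_subst (l := i) _ (mulr_lin (s i.+1))) => // c l ln.
  rewrite /face /supd ji eqxx [i.+1 == i]gtn_eqF //.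
  by do !case: ifP => //=; lia.
Qed.

Lemma last_face_lin n s j k (a a' : A) : (j <= n.+1)%N ->
  ch n (last_face n (supd s j (k *: a + a'))) =
    k *: ch n (last_face n (supd s j a)) + ch n (last_face n (supd s j a')).
Proof.
case: (posnP j) => [-> _|j0 jn].
  apply: (ch_lin_subst (l := 0%N) _ (mull_lin (s n.+1))) => // c [|l] ln;
    by rewrite /last_face /supd.
have [->|jn1] := eqVneq j n.+1.
  apply: (ch_lin_subst (l := 0%N) _ (mulr_lin (s 0%N))) => // c [|l] ln.
    by rewrite /last_face /supd /= eqxx.
  by rewrite /last_face /supd; case: ifP => //=; lia.
apply: (ch_lin_subst (l := j) _ idA_lin); first lia.
move=> c [|l] ln; rewrite /last_face /supd; do !case: ifP => //=; lia.
Qed.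

Lemma hoch_nform n : normalized_form n.+1 (hoch_form n).
Proof.
have [ce cl c1] := ch_nform n; split.
- move=> s t st; rewrite /hoch_form; congr (_ + _ *: _).
    apply: eq_bigr => i _; congr (_ *: _); apply: ce => j jn.
    have := ltn_ord i; rewrite ltnS => i_n.
    by rewrite /face; do !case: ifP => _; rewrite ?st //; lia.
  by apply: ce => -[|j] jn /=; rewrite !st //; lia.
- move=> j s k a a' jn; rewrite /hoch_form last_face_lin //.
  rewrite (eq_bigr (fun i : 'I_n.+1 =>
      k *: ((-1) ^+ i *: ch n (face i (supd s j a))) +
      (-1) ^+ i *: ch n (face i (supd s j a')))); last first.
    move=> i _; have i_n : (i <= n)%N by rewrite -ltnS.
    by rewrite face_lin // scalerDr !scalerA [k * _]mulrC.
  rewrite big_split /= -scaler_sumr 2!scalerDr addrACA.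
  by congr (_ + _ + _); rewrite !scalerA mulrC.
- move=> j s /andP[j0 jn] sj; rewrite /hoch_form.
  have jn' : (j.-1 < n.+1)%N by lia.
  have z (i : 'I_n.+1) : i != j.-1 :> nat -> i != j :> nat -> ch n (face i s) = 0.
    move=> ij ij'; have i_n := ltn_ord i; case: (ltnP i j) => h.
      apply: (c1 j.-1); first lia.
      by rewrite /face ifN ?ifN ?prednK //; lia.
    apply: (c1 j); first lia.
    by rewrite /face ltn_neqAle eq_sym ij' h.
  rewrite (bigD1 (Ordinal jn')) //=.
  have [jn1|jn1] := eqVneq j n.+1.
    rewrite big1 ?addr0 => [|i]; last first.
      rewrite -val_eqE /= => ij; rewrite z ?scaler0 // jn1 ltn_eqF //.
    rewrite jn1 /= exprS mulN1r scaleNr.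
    suff -> : ch n (face n s) = ch n (last_face n s) by rewrite subrr.
    apply: ce => l ln; rewrite /face /last_face -jn1 sj mul1r.
    case: (ltngtP l n) => [h|h|->]; [| lia |].
      by case: l {ln} h.
    by rewrite mulr1; case: (n).
  have jlt : (j < n.+1)%N by lia.
  rewrite (bigD1 (Ordinal jlt)) /=; last by rewrite -val_eqE /=; lia.
  rewrite big1 ?addr0 => [|i]; last first.
    by rewrite -!val_eqE /= => /andP[ij ij']; rewrite z ?scaler0.
  rewrite (c1 j (last_face n s)) ?scaler0 ?addr0; [| lia |]; last first.
    by case: (j) j0 sj.
  have -> : (-1) ^+ j = - (-1) ^+ j.-1 :> K.
    by rewrite -{1}(prednK j0) exprS mulN1r.
  rewrite scaleNr; suff -> : ch n (face j.-1 s) = ch n (face j s) by rewrite subrr.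
  apply: ce => l ln; rewrite /face prednK // sj mulr1 mul1r.
  case: (ltngtP l j) => h; [|by rewrite ifN ?ifN //; lia|].
    by case: (ltngtP l j.-1) => [//||->//]; lia.
  by rewrite h ifN ?ifN //; lia.
Qed.

Lemma connes_nform n : normalized_form n (connes_form n).
Proof.
have [ce cl c1] := ch_nform n.+1.
have pos i j : (i <= n)%N -> (j <= n)%N -> exists2 k, (k <= n)%N &
    forall l, (l <= n)%N -> ((i + l) %% n.+1 == j)%N = (l == k).
  move=> i_n jn; case: (leqP i j) => ij.
    exists (j - i)%N => [|l ln]; first lia.
    have [h|h] := ltnP (i + l) n.+1; first by rewrite modn_small //; lia.
    by rewrite -(subnK h) modnDr modn_small; lia.
  exists (j + n.+1 - i)%N => [|l ln]; first lia.
  have [h|h] := ltnP (i + l) n.+1; first by rewrite modn_small //; lia.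
  by rewrite -(subnK h) modnDr modn_small; lia.
split.
- move=> s t st; apply: eq_bigr => i _; congr (_ *: _); apply: ce => -[|j] // jn.
  by rewrite /rotated st // -ltnS ltn_mod.
- move=> j s k a a' jn; rewrite /connes_form scaler_sumr -big_split /=.
  apply: eq_bigr => i _; have i_n : (i <= n)%N by rewrite -ltnS.
  have [l ln lE] := pos i j i_n jn.
  rewrite (ch_lin_subst (l := l.+1) _ idA_lin) //.
    by rewrite scalerDr !scalerA mulrC.
  move=> c [|r] rn //; rewrite /rotated /supd lE // eqSS.
- move=> j s /andP[j0 jn] sj; apply: big1 => i _.
  have i_n : (i <= n)%N by rewrite -ltnS.
  have [l ln lE] := pos i j i_n jn.
  rewrite (c1 l.+1) ?scaler0 //; rewrite /rotated.
  by have := lE l ln; rewrite eqxx => /eqP->.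
Qed.

(* The Hochschild differential b and the Connes operator B, where              *)
(* B(a_0,...,a_n) = \sum_i (-1)^(ni) (1,a_i,...,a_n,a_0,...,a_(i-1)):          *)
(* the other terms of Connes' formula vanish in the normalized complex.        *)
Definition hoch (n : nat) (z : chain n.+1) : chain n := clift (hoch_form n) z.
Definition connes (n : nat) (z : chain n) : chain n.+1 := clift (connes_form n) z.

HB.instance Definition _ n := GRing.isLinear.Build K (chain n.+1) (chain n) *:%R
  (hoch (n := n)) (clift_linear (hoch_nform n)).
HB.instance Definition _ n := GRing.isLinear.Build K (chain n) (chain n.+1) *:%R
  (connes (n := n)) (clift_linear (connes_nform n)).

(* (p,q)-shuffles, as permutations of 'I_m with m = p + q *)
Definition is_shuffle (p m : nat) (sigma : 'S_m) : bool :=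
  [forall i : 'I_m, forall j : 'I_m,
     [&& (i < j)%N & (j < p)%N || (p <= i)%N] ==> (sigma i < sigma j)%N].

(* Entry number l.+1 of the sequence a_0 b_0, a_1, ..., a_p, b_1, ..., b_q *)
Definition juxtaposed (p : nat) (s t : nat -> A) (l : nat) : A :=
  if (l < p)%N then s l.+1 else t (l - p).+1.

Definition shuffled (p m : nat) (sigma : 'S_m) (s t : nat -> A) (j : nat) : A :=
  if j is k.+1 then
    (if insub k is Some i then juxtaposed p s t ((sigma^-1)%g i) else 0)
  else s 0%N * t 0%N.

(* The degree p + q is written q + p so that the totalization below, which is  *)
(* defined by recursion on q, needs no transport along equalities of degrees.  *)
Definition shuffle (p q : nat) (x : chain p) (y : chain q) : chain (q + p) :=
  clift (fun s => clift (fun t =>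
    \sum_(sigma : 'S_(q + p) | is_shuffle p sigma)
      (-1) ^+ (odd_perm sigma) *: ch (q + p) (shuffled p sigma s t)) y) x.

(* The total complex: tot n is chain n * (chain (n - 2) * ...)                 *)
Fixpoint tot (n : nat) : lmodType K :=
  match n with
  | 0 => chain 0
  | 1 => chain 1
  | m.+2 => (chain m.+2 * tot m)%type
  end.

Definition tot_head (n : nat) : tot n -> chain n :=
  match n return tot n -> chain n with
  | 0 | 1 => id
  | _.+2 => fst
  end.

Definition tot_in (n : nat) : chain n -> tot n :=
  match n return chain n -> tot n with
  | 0 | 1 => id
  | _.+2 => fun z => (z, 0)
  end.

(* (z_n, z_(n-2), ...) |-> (b z_n + B z_(n-2), b z_(n-2) + B z_(n-4), ...)     *)
Fixpoint tot_diff (n : nat) : tot n.+1 -> tot n :=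
  match n return tot n.+1 -> tot n with
  | 0 => fun z => hoch z
  | 1 => fun z => hoch z.1 + connes z.2
  | m.+2 => fun z => (hoch z.1 + connes (@tot_head m.+1 z.2), @tot_diff m z.2)
  end.

Lemma tot_head_linear n : linear (@tot_head n).
Proof. by case: n => [|[|n]]. Qed.

Lemma tot_diff_linear n : linear (@tot_diff n).
Proof.
suff: linear (@tot_diff n) /\ linear (@tot_diff n.+1) by case.
elim: n => [|n [IH1 IH2]].
  split=> k u v /=; first by rewrite linearP.
  by rewrite !linearP /= scalerDr addrACA.
split=> // k [u1 u2] [v1 v2]; apply: (congr2 pair); last exact: IH1.
transitivity (hoch (k *: u1 + v1) + connes (@tot_head n.+1 (k *: u2 + v2))) => //.
by rewrite tot_head_linear !linearP /= scalerDr addrACA.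
Qed.

HB.instance Definition _ n := GRing.isLinear.Build K (tot n.+1) (tot n) *:%R
  (@tot_diff n) (@tot_diff_linear n).

(* (y_q, y_(q-2), ...) |-> (x * y_q, x * y_(q-2), ...), with shuffle products  *)
Fixpoint tot_shuffle (p q : nat) (x : chain p) : tot q -> tot (q + p) :=
  match q return tot q -> tot (q + p) with
  | 0 => fun y => tot_in (shuffle x y)
  | 1 => fun y => tot_in (shuffle x y)
  | m.+2 => fun y => (shuffle x y.1, tot_shuffle x y.2)
  end.

Definition HH (n : nat) : lmodType K := homology (fun n => @hoch n) n.
Definition HC (n : nat) : lmodType K := homology (fun n => @tot_diff n) n.

Definition HC_mul (p q : nat) : HC p -> HC q -> HC (q + p.+1) :=
  hmap2 (fun n => @tot_diff n)
    (fun x y => tot_shuffle (connes (tot_head x)) y).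

Definition HC_act (p q : nat) : HC p -> HH q -> HH (q + p.+1) :=
  hmap2 (fun n => @hoch n)
    (fun x y => shuffle (connes (tot_head x)) y).

(* HC'_n = HC_(n-1), with HC_(-1) = 0 *)
Definition HCs (n : nat) : lmodType K := if n is m.+1 then HC m else 'rV[K]_0.

Definition HCs_mul (p q : nat) : HCs p -> HCs q -> HCs (q + p) :=
  match p, q return HCs p -> HCs q -> HCs (q + p) with
  | p'.+1, q'.+1 => fun x y => HC_mul x y
  | _, _ => fun _ _ => 0
  end.

Definition HCs_act (p q : nat) : HCs p -> HH q -> HH (q + p) :=
  match p return HCs p -> HH q -> HH (q + p) with
  | p'.+1 => fun x y => HC_act x y
  | 0 => fun _ _ => 0
  end.

Definition HHtot : lmodType K := dsum HH.
Definition HCstot : lmodType K := dsum HCs.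

Definition HCstot_mul (x y : HCstot) : HCstot :=
  dlift (fun p a => dlift (fun q b => dinj (HCs_mul a b)) y) x.

Definition HCstot_act (x : HCstot) (y : HHtot) : HHtot :=
  dlift (fun p a => dlift (fun q b => dinj (HCs_act a b)) y) x.

End Chains.

Section Action.
Variables (K : fieldType) (C : coalgebra K) (A A' : comPzAlgType K).
Variable Phi : C -> A -> A'.

(* (a_0, ..., a_n) |-> (x_(1)(a_0), ..., x_(n+1)(a_n)) *)
Definition chain_map (n : nat) (x : C) (z : chain A n) : chain A' n :=
  clift (fun a => sweedler n (fun c => ch n (fun j => Phi (nth 0 c j) (a j))) x) z.

Fixpoint tot_map (n : nat) (x : C) : tot A n -> tot A' n :=
  match n return tot A n -> tot A' n with
  | 0 => fun z => chain_map x z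
  | 1 => fun z => chain_map x z
  | m.+2 => fun z => (chain_map x z.1, tot_map x z.2)
  end.

Definition HH_map (n : nat) (x : C) : HH A n -> HH A' n :=
  hmap (fun n => @hoch K A' n) (chain_map x).

Definition HC_map (n : nat) (x : C) : HC A n -> HC A' n :=
  hmap (fun n => @tot_diff K A' n) (tot_map x).

Definition HCs_map (n : nat) (x : C) : HCs A n -> HCs A' n :=
  match n return HCs A n -> HCs A' n with
  | 0 => fun _ => 0
  | m.+1 => fun h => HC_map x h
  end.

Definition HHtot_map (x : C) (h : HHtot A) : HHtot A' :=
  dlift (fun n a => dinj (HH_map x a)) h.

Definition HCstot_map (x : C) (h : HCstot A) : HCstot A' :=
  dlift (fun n a => dinj (HCs_map x a)) h.

End Action.

(* Main.v *)
From HB Require Import structures.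
Require Import Defs.
From mathcomp Require Import all_boot all_order all_algebra perm.
From mathcomp Require Import boolp freeg zify ring.
Set Implicit Arguments.
Unset Strict Implicit.
Unset Printing Implicit Defensive.
Import GRing.Theory.
Local Open Scope ring_scope.

(** A measuring of A into A' is an algebra map from A to the convolution algebra
    Hom(C, A'), which is commutative when C is cocommutative. The operations b, B and
    the shuffle product are signed sums of three kinds of operations on words of
    letters of A: permuting the letters, merging two neighbours a, b into ab, and
    putting a letter 1 in front. The map (a_0,...,a_n) |-> (x_(1)(a_0),...,x_(n+1)(a_n))
    commutes with the first kind because C is cocommutative ([wmap_turn]), with the
    second because x(ab) = x_(1)(a) x_(2)(b) ([wmap_merge0]), and with the third
    because x(1) = epsilon(x) 1 ([wmap_cons1]). So it commutes with b ([wmap_hochw])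
    and B ([wmap_connesw]), and coassociativity gives
    x(u * v) = x_(1)(u) * x_(2)(v) for the shuffle product ([wmap_sprod]). These
    identities pass to normalized chains, to the total complex, and then to homology.

    The last step needs the products to be induced on homology: the class of
    B x_p * y must depend only on the classes of x and y. In the normalized complex,
    with x of degree p,
    - b(x * y) = b x * y + (-1)^p x * b y  ([hochw_sprod]),
    - b B = - B b and B B = 0  ([hochw_connesw], [connes_connes]),
    - B(B x * y) = (-1)^(p+1) B x * B y  ([connes_shuffle]).
    If D is the total differential and x_p the leading component of x, these give
    D(B x_p * y) = b B x_p * y + (-1)^(p+1) B x_p * D y, while b B x_p = 0 if x is a
    cycle, and B x_p = - b B w_(p+1) if x = D w; so cycles go to cycles, and boundaries
    in either variable go to boundaries ([HC_prod_classes], [HC_act_classes]).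

    The Leibniz rule for b is proved by induction on words: a shuffle of two words
    begins with the first letter of one of them, and the two ways of merging a letter
    of one word with a letter of the other cancel. For b B = - B b, let t be the signed
    rotation and N the sum of its powers; all faces are conjugates t^i d_0 t^(-i) of the
    first one, so that b followed by N, and N followed by b without its last face, are
    both N d_0 N. For the last identity, both sides run over the words in which the
    letters of x occur in their cyclic order and those of y in theirs; cutting such
    words open at the letter b_0 matches the two ([rots_shuf]).

    A formal sum s of words is tested against arbitrary functions F from words to
    modules: ev s F is the value at s of the linear extension of F. With F = chw n, the
    class of a word in degree n, an identity of formal sums becomes one of chains. *)

(** * Linear identities in a module *)

Section ModuleExpressions.
Variables (K : fieldType) (V : lmodType K).

(** Terms of a module over K; two of them agree in every module when the
    coefficients of every variable agree, which is left to the ring tactic of K. *)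
Inductive mexpr :=
  | Mvar of nat | Mzero | Madd of mexpr & mexpr | Mopp of mexpr | Mscale of K & mexpr.

Fixpoint meval (env : seq V) (e : mexpr) : V :=
  match e with
  | Mvar i => nth 0 env i
  | Mzero => 0
  | Madd e1 e2 => meval env e1 + meval env e2
  | Mopp e1 => - meval env e1
  | Mscale k e1 => k *: meval env e1
  end.

Fixpoint mcoef (i : nat) (e : mexpr) : K :=
  match e with
  | Mvar j => if PeanoNat.Nat.eqb j i then 1 else 0
  | Mzero => 0
  | Madd e1 e2 => mcoef i e1 + mcoef i e2
  | Mopp e1 => - mcoef i e1
  | Mscale k e1 => k * mcoef i e1
  end.

Fixpoint mcheck (n : nat) (e1 e2 : mexpr) : Prop :=
  if n is m.+1 then mcoef m e1 = mcoef m e2 /\ mcheck m e1 e2 else True.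

Lemma mevalE env e : meval env e = \sum_(i < size env) mcoef i e *: nth 0 env i.
Proof.
elim: e => [j||e1 IH1 e2 IH2|e1 IH|k e1 IH] /=.
- have eqbE i : PeanoNat.Nat.eqb j i = (j == i) by lia.
  have [jn|jn] := ltnP j (size env); last first.
    rewrite nth_default // big1 // => i _; rewrite eqbE gtn_eqF ?scale0r //.
    exact: leq_trans jn.
  rewrite (bigD1 (Ordinal jn)) //= eqbE eqxx scale1r big1 ?addr0 // => i.
  by rewrite eqbE -val_eqE /= eq_sym => /negPf->; rewrite scale0r.
- by rewrite big1 // => i _; rewrite scale0r.
- by rewrite IH1 IH2 -big_split; apply: eq_bigr => i _; rewrite scalerDl.
- by rewrite IH -sumrN; apply: eq_bigr => i _; rewrite scaleNr.
- by rewrite IH scaler_sumr; apply: eq_bigr => i _; rewrite scalerA.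
Qed.

Lemma meval_eq env e1 e2 : mcheck (size env) e1 e2 -> meval env e1 = meval env e2.
Proof.
rewrite !mevalE => H; apply: eq_bigr => i _; congr (_ *: _).
case: i; elim: (size env) H => // n IH [En En'] i /=.
by rewrite ltnS leq_eqVlt => /predU1P[->//|]; apply: IH.
Qed.

End ModuleExpressions.

Ltac mindex x l :=
  match l with
  | x :: _ => constr:(0%N)
  | _ :: ?t => let n := mindex x t in constr:(S n)
  end.
Ltac mvars V e l :=
  match e with
  | GRing.zero => l
  | GRing.add ?a ?b => let l1 := mvars V a l in mvars V b l1
  | GRing.opp ?a => mvars V a l
  | GRing.scale _ ?a => mvars V a l
  | _ => match l with
         | _ => let n := mindex e l in l
         | _ => constr:(cons (e : V) l)
         end
  end.
Ltac mreify K l e :=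
  match e with
  | GRing.zero => constr:(Mzero K)
  | GRing.add ?a ?b =>
      let a1 := mreify K l a in let b1 := mreify K l b in constr:(Madd a1 b1)
  | GRing.opp ?a => let a1 := mreify K l a in constr:(Mopp a1)
  | GRing.scale ?k ?a => let a1 := mreify K l a in constr:(Mscale (k : K) a1)
  | _ => let n := mindex e l in constr:(Mvar K n)
  end.
Ltac lmod_start K V :=
  lazymatch goal with
  | |- @eq _ ?a ?b =>
    let l := mvars V a (@nil V) in
    let l := mvars V b l in
    let a1 := mreify K l a in
    let b1 := mreify K l b in
    change (@meval K V l a1 = @meval K V l b1);
    apply: meval_eq; cbn [mcheck mcoef size PeanoNat.Nat.eqb]
  end.
(** One equation in K for each variable is left to [ring]; powers are unfolded first,
    because the sign (-1) ^+ n with n not a numeral is an atom for it. *)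
Ltac lmod K V := lmod_start K V; repeat split; rewrite ?(exprS, expr0); try ring.

(** * Linear and bilinear maps on presented modules *)

Section LinearFunctions.
Variables (K : fieldType) (V W : lmodType K) (f : V -> W).
Hypothesis f_lin : linear f.

Definition linear_of : {linear V -> W} :=
  HB.pack f (GRing.isLinear.Build K V W *:%R f f_lin).

Lemma lin0 : f 0 = 0. Proof. exact: (linear0 linear_of). Qed.
Lemma linD u v : f (u + v) = f u + f v. Proof. exact: (linearD linear_of). Qed.
Lemma linZ k u : f (k *: u) = k *: f u. Proof. exact: (linearZ_LR linear_of). Qed.
Lemma linN u : f (- u) = - f u. Proof. exact: (linearN linear_of). Qed.
Lemma lin_sum (I : Type) (r : seq I) (P : pred I) (F : I -> V) :
  f (\sum_(i <- r | P i) F i) = \sum_(i <- r | P i) f (F i).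
Proof. exact: (linear_sum linear_of). Qed.

End LinearFunctions.

Lemma linear_comp (K : fieldType) (U V W : lmodType K) (g : V -> W) (f : U -> V) :
  linear g -> linear f -> linear (fun u => g (f u)).
Proof. by move=> gl fl k u v; rewrite fl gl. Qed.

Lemma linear_opp (K : fieldType) (V : lmodType K) : linear (fun v : V => - v).
Proof. by move=> k u v; rewrite opprD scalerN. Qed.

Lemma linZ_fun (K : fieldType) (V : lmodType K) (k : K) : linear (fun v : V => k *: v).
Proof. by move=> l u v; rewrite scalerDr !scalerA mulrC. Qed.

Section PresentedLift.
Variables (K : fieldType) (T : choiceType) (S : {freeg T / K} -> Prop).
Implicit Types (W : lmodType K) (x : pres S).

Lemma fgliftE W (f : T -> W) (r : {freeg T / K}) :
  fglift f r = \sum_(t <- dom r) coeff t r *: f t.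
Proof.
rewrite -{1}[r]freeg_sumE (lin_sum (fglift_linear f)).
by apply: eq_bigr => t _; rewrite liftU.
Qed.

Lemma plift_lin_fun W (f g : T -> W) k x :
  plift (fun t => k *: f t + g t) x = k *: plift f x + plift g x.
Proof.
rewrite /plift !fgliftE scaler_sumr -big_split; apply: eq_bigr => t _ /=.
by rewrite scalerDr !scalerA mulrC.
Qed.

(** Holds for any f, even one that does not respect the relations, since a lift is
    a fixed linear combination of values of f at each x. *)
Lemma plift_comp W W' (G : W -> W') (f : T -> W) x :
  linear G -> G (plift f x) = plift (fun t => G (f t)) x.
Proof.
move=> Gl; rewrite /plift !fgliftE (lin_sum Gl).
by apply: eq_bigr => t _; rewrite (linZ Gl).
Qed.

Lemma eq_pres_linear W (f g : pres S -> W) : linear f -> linear g ->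
  (forall t, f (pgen S t) = g (pgen S t)) -> f =1 g.
Proof.
move=> fl gl fg; elim/pgen_ind=> [|k t x IH]; first by rewrite (lin0 fl) (lin0 gl).
by rewrite fl gl fg IH.
Qed.

End PresentedLift.

Section Bilinear.
Variable K : fieldType.
Implicit Types V W U : lmodType K.

Definition bilin V W U (f : V -> W -> U) : Prop :=
  (forall v, linear (f v)) /\ (forall w, linear (f^~ w)).

Lemma tlift_lin_fun V W U (f g : V -> W -> U) k z :
  tlift (fun v w => k *: f v w + g v w) z = k *: tlift f z + tlift g z.
Proof. exact: plift_lin_fun. Qed.

Lemma tlift_comp V W U U' (G : U -> U') (f : V -> W -> U) z :
  linear G -> G (tlift f z) = tlift (fun v w => G (f v w)) z.
Proof. exact: plift_comp. Qed.

Lemma tlift_linear V W U (f : V -> W -> U) : bilin f -> linear (tlift f).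
Proof. by move=> [f1 f2]; apply: plift_linear; apply: tlift_respects. Qed.

Lemma tlift_gen V W U (f : V -> W -> U) v w : bilin f -> tlift f (v ⊗ w) = f v w.
Proof. by move=> [f1 f2]; rewrite /tlift plift_gen //; apply: tlift_respects. Qed.

Lemma tlift0 V W U z : tlift (fun (_ : V) (_ : W) => 0 : U) z = 0.
Proof.
by have := tlift_lin_fun (fun _ _ => 0) (fun _ _ => 0 : U) (-1) z;
  rewrite scaler0 addr0 scaleN1r addNr.
Qed.

Lemma eq_tlift V W U (f g : V -> W -> U) z :
  (forall v w, f v w = g v w) -> tlift f z = tlift g z.
Proof. by move=> fg; congr tlift; apply/funext=> v; apply/funext=> w. Qed.

Lemma exchange_tlift V W V' W' U (f : V -> W -> V' -> W' -> U) z z' :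
  tlift (fun v w => tlift (fun v' w' => f v w v' w') z') z =
  tlift (fun v' w' => tlift (fun v w => f v w v' w') z) z'.
Proof.
rewrite {1 3}/tlift /plift !fgliftE.
rewrite (eq_bigr (fun t => \sum_(t' <- dom (repr z'))
  coeff t (repr z) *: (coeff t' (repr z') *: f t.1 t.2 t'.1 t'.2))); last first.
  by move=> t _; rewrite /tlift /plift fgliftE scaler_sumr.
rewrite exchange_big /=; apply: eq_bigr => t' _.
rewrite /tlift /plift fgliftE scaler_sumr; apply: eq_bigr => t _.
by rewrite !scalerA mulrC.
Qed.

Definition trilin V W U (X : lmodType K) (f : V -> W -> U -> X) : Prop :=
  [/\ forall v, bilin (f v), forall w, bilin (fun v => f v w)
    & forall u, bilin (fun v w => f v w u)].

End Bilinear.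

Lemma trilinP (K : fieldType) (U V W X : lmodType K) (f : U -> V -> W -> X) :
  (forall v w, linear (fun u => f u v w)) -> (forall u w, linear (fun v => f u v w)) ->
  (forall u v, linear (f u v)) -> trilin f.
Proof. by []. Qed.

Section BilinearCombinators.
Variables (K : fieldType) (U V W X : lmodType K).

Lemma bilin_comp (G : W -> X) (f : U -> V -> W) :
  linear G -> bilin f -> bilin (fun u v => G (f u v)).
Proof. by move=> Gl [fr fl]; split=> [u|v] k t t'; [rewrite fr Gl | rewrite fl Gl]. Qed.

Lemma bilin_precomp (U' V' : lmodType K) (f : U -> V -> W) (g : U' -> U) (h : V' -> V) :
  bilin f -> linear g -> linear h -> bilin (fun u v => f (g u) (h v)).
Proof.
by move=> [fr fl] gl hl; split=> [u|v] k t t'; [rewrite hl fr | rewrite gl fl].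
Qed.

Lemma bilinD (f g : U -> V -> W) : bilin f -> bilin g -> bilin (fun u v => f u v + g u v).
Proof.
move=> [fr fl] [gr gl]; split=> [u|v] k t t'; first by rewrite fr gr; lmod K W.
by rewrite fl gl; lmod K W.
Qed.

End BilinearCombinators.

Lemma bilin_tlift (K : fieldType) (U V U' V' W : lmodType K) (f : U' -> V' -> U -> V -> W) t :
  (forall y z, bilin (f y z)) -> bilin (fun u v => tlift (fun y z => f y z u v) t).
Proof.
move=> fb; split=> [u|v] k s s'; rewrite -tlift_lin_fun; apply: eq_tlift => y z;
  have [fr fl] := fb y z; [exact: fr | exact: fl].
Qed.

Lemma tlift_pair (K : fieldType) (U V W1 W2 : lmodType K) (f : U -> V -> W1) (g : U -> V -> W2) t :
  tlift (fun y z => (f y z, g y z) : (W1 * W2)%type) t = (tlift f t, tlift g t).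
Proof.
rewrite [LHS]surjective_pairing; congr (_, _).
  exact: (@tlift_comp _ _ _ _ _ fst).
exact: (@tlift_comp _ _ _ _ _ snd).
Qed.

(** * Iterated coproducts *)

Section CoalgebraCalculus.
Variables (K : fieldType) (C : coalgebra K).
Implicit Types (W : lmodType K) (x : C).

(** The two ways of iterating the coproduct, tested on a trilinear form: the axiom
    compares them in the threefold tensor product, where the form lifts to a linear map. *)
Lemma comul_assoc W (f : C -> C -> C -> W) x : trilin f ->
  tlift (fun y z => tlift (fun y1 y2 => f y1 y2 z) (comul C y)) (comul C x) =
  tlift (fun y z => tlift (f y) (comul C z)) (comul C x).
Proof.
move=> fT; have [f1 f2 f3] := fT.
pose G : tens C (tens C C) -> W := tlift (fun v z => tlift (f v) z).
have Gb : bilin (fun v z => tlift (f v) z).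
  split=> [v|z]; first exact: tlift_linear.
  move=> k u v; rewrite -tlift_lin_fun; apply: eq_tlift => a b.
  by have [_ ->] := f2 a.
have Gl : linear G by apply: tlift_linear.
have /(congr1 G) := comulA x.
rewrite (tlift_comp _ _ Gl) [RHS](tlift_comp _ _ Gl) => E.
transitivity (tlift (fun v w => G (tlift (fun y1 y2 => y1 ⊗ (y2 ⊗ w)) (comul C v)))
  (comul C x)).
  apply: eq_tlift => y z; rewrite (tlift_comp _ _ Gl); apply: eq_tlift => u v.
  by rewrite /G tlift_gen // tlift_gen.
by rewrite E; apply: eq_tlift => y z; rewrite /G tlift_gen.
Qed.

Lemma comul_counitl W (g : C -> W) x : linear g ->
  tlift (fun y z => counit C y *: g z) (comul C x) = g x.
Proof.
move=> gl; rewrite -[in RHS](counitl x) (tlift_comp _ _ gl).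
by apply: eq_tlift => y z; rewrite (linZ gl).
Qed.

Lemma comul_counitr W (g : C -> W) x : linear g ->
  tlift (fun y z => counit C z *: g y) (comul C x) = g x.
Proof.
move=> gl; rewrite -[in RHS](counitr x) (tlift_comp _ _ gl).
by apply: eq_tlift => y z; rewrite (linZ gl).
Qed.

Hypothesis C_cocomm : cocommutative C.

Lemma comul_comm W (f : C -> C -> W) x : bilin f ->
  tlift f (comul C x) = tlift (fun y z => f z y) (comul C x).
Proof.
move=> fb; rewrite -[in LHS](C_cocomm x) (tlift_comp _ _ (tlift_linear fb)).
by apply: eq_tlift => y z; rewrite tlift_gen.
Qed.

(** Cocommutativity for the first two factors of the iterated coproduct; adjacent
    swaps of this kind are all that permuting Sweedler indices takes. *)
Lemma comul_swap12 W (f : C -> C -> C -> W) x : trilin f ->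
  tlift (fun y z => tlift (f y) (comul C z)) (comul C x) =
  tlift (fun y z => tlift (fun z1 z2 => f z1 y z2) (comul C z)) (comul C x).
Proof.
move=> fT; have [f1 f2 f3] := fT.
rewrite -comul_assoc // -(comul_assoc (f := fun y z => f z y)); last first.
  by split=> // u; have [] := f3 u.
by apply: eq_tlift => y z; rewrite comul_comm.
Qed.

End CoalgebraCalculus.

(** * Formal sums of words *)

Section FormalSums.
Variables (K : fieldType) (T : Type).
Implicit Types (W : lmodType K) (s : seq (K * seq T)) (k : K).

(** Signed sums of words are kept as lists, not as elements of a free module: they
    are only ever used through their values on functions. *)
Definition fsum : Type := seq (K * seq T).

Definition ev W (s : fsum) (F : seq T -> W) : W := \sum_(x <- s) x.1 *: F x.2.

Definition scl k (s : fsum) : fsum := [seq (k * x.1, x.2) | x <- s].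
Definition pre a (s : fsum) : fsum := [seq (x.1, a :: x.2) | x <- s].

Lemma ev_nil W (F : seq T -> W) : ev [::] F = 0.
Proof. exact: big_nil. Qed.
Lemma ev_one W k w (F : seq T -> W) : ev [:: (k, w)] F = k *: F w.
Proof. exact: big_seq1. Qed.
Lemma ev_cat W s1 s2 (F : seq T -> W) : ev (s1 ++ s2) F = ev s1 F + ev s2 F.
Proof. exact: big_cat. Qed.
Lemma ev_scl W k s (F : seq T -> W) : ev (scl k s) F = k *: ev s F.
Proof.
by rewrite /ev big_map scaler_sumr; apply: eq_bigr => x _; rewrite scalerA.
Qed.
Lemma ev_pre W a s (F : seq T -> W) : ev (pre a s) F = ev s (fun w => F (a :: w)).
Proof. by rewrite /ev big_map. Qed.

Lemma ev_lin_fun W s k (F G : seq T -> W) :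
  ev s (fun w => k *: F w + G w) = k *: ev s F + ev s G.
Proof.
rewrite /ev scaler_sumr -big_split; apply: eq_bigr => x _.
by rewrite scalerDr !scalerA mulrC.
Qed.

Lemma ev_comp W W' s (G : W -> W') (F : seq T -> W) : linear G ->
  G (ev s F) = ev s (fun w => G (F w)).
Proof. by move=> Gl; rewrite (lin_sum Gl); apply: eq_bigr => x _; rewrite (linZ Gl). Qed.

Lemma eq_ev W s (F G : seq T -> W) : (forall w, F w = G w) -> ev s F = ev s G.
Proof. by move=> FG; apply: eq_bigr => x _; rewrite FG. Qed.

Lemma evD W s (F G : seq T -> W) : ev s (fun w => F w + G w) = ev s F + ev s G.
Proof. by rewrite /ev -big_split; apply: eq_bigr => x _; rewrite scalerDr. Qed.

Lemma evZ W s k (F : seq T -> W) : ev s (fun w => k *: F w) = k *: ev s F.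
Proof.
by rewrite /ev scaler_sumr; apply: eq_bigr => x _; rewrite !scalerA mulrC.
Qed.

Lemma evN W s (F : seq T -> W) : ev s (fun w => - F w) = - ev s F.
Proof. by rewrite /ev -sumrN; apply: eq_bigr => x _; rewrite scalerN. Qed.

Lemma ev0 W s : ev s (fun => 0 : W) = 0.
Proof. by apply: big1 => x _; rewrite scaler0. Qed.

Lemma ev_sum W s (I : Type) (r : seq I) (F : I -> seq T -> W) :
  ev s (fun w => \sum_(i <- r) F i w) = \sum_(i <- r) ev s (F i).
Proof.
by rewrite /ev exchange_big; apply: eq_bigr => x _; rewrite scaler_sumr.
Qed.

Lemma exchange_ev W s t (F : seq T -> seq T -> W) :
  ev s (fun v => ev t (fun w => F v w)) = ev t (fun w => ev s (fun v => F v w)).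
Proof.
rewrite {2 3}/ev ev_sum; apply: eq_bigr => x _.
by rewrite -evZ.
Qed.

Lemma ev_tlift (U V : lmodType K) W s (F : U -> V -> seq T -> W) z :
  ev s (fun w => tlift (fun y z => F y z w) z) = tlift (fun y z => ev s (F y z)) z.
Proof.
elim: s => [|[k w] s IH]; first by under eq_tlift do rewrite ev_nil; rewrite ev_nil tlift0.
rewrite -cat1s ev_cat IH ev_one -tlift_lin_fun; apply: eq_tlift => y u.
by rewrite ev_cat ev_one.
Qed.

(** Formal sums of words of length n; the sign rules for shuffles and rotations
    depend on this length. *)
Definition homog n s := all (fun x => size x.2 == n) s.

Lemma homog_cat n s t : homog n s -> homog n t -> homog n (s ++ t).
Proof. by rewrite /homog all_cat => -> ->. Qed.
Lemma homog_scl n k s : homog n s -> homog n (scl k s).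
Proof. by rewrite /homog all_map. Qed.
Lemma homog_pre n a s : homog n s -> homog n.+1 (pre a s).
Proof. by rewrite /homog all_map. Qed.

Lemma eq_ev_homog W n s (F G : seq T -> W) : homog n s ->
  (forall w, size w = n -> F w = G w) -> ev s F = ev s G.
Proof.
elim: s => [|[k w] s IH] /=; first by rewrite !ev_nil.
move=> /andP[/eqP wn sn] FG.
by rewrite -[_ :: s]cat1s !ev_cat !ev_one (FG _ wn) (IH sn FG).
Qed.

End FormalSums.

Lemma ev_lin_param (K : fieldType) (T : Type) (W W' : lmodType K) (s : fsum K T)
    (G : W' -> seq T -> W) :
  (forall w, linear (fun t => G t w)) -> linear (fun t => ev s (G t)).
Proof. by move=> Gl k t t'; rewrite -ev_lin_fun; apply: eq_ev => w; rewrite Gl. Qed.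

Lemma eq_signr (R : pzRingType) m n : odd m = odd n -> (-1) ^+ m = (-1) ^+ n :> R.
Proof. by move=> h; rewrite -signr_odd h signr_odd. Qed.

Ltac parity := apply: eq_signr; rewrite /= ?(oddD, oddM, oddB) /=;
  repeat match goal with |- context [odd ?n] => case: (odd n) => //= end.

(** * Shuffles of words *)

Section Shuffles.
Variables (K : fieldType) (T : Type).
Implicit Types (W : lmodType K) (u v w : seq T).

(** The signed sum of the shuffles of u and v, by the origin of the first letter;
    moving a letter of v to the front costs the sign of passing all of u. *)
Fixpoint shuf (u : seq T) : seq T -> fsum K T :=
  match u with
  | [::] => fun v => [:: (1, v)]
  | a :: u' => fix shuf_r v := match v with
    | [::] => [:: (1, u)]
    | b :: v' => pre a (shuf u' v) ++ scl ((-1) ^+ size u) (pre b (shuf_r v'))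
    end
  end.

Arguments shuf : simpl never.

Lemma ev_shuf0l W v (F : seq T -> W) : ev (shuf [::] v) F = F v.
Proof. by rewrite ev_one scale1r. Qed.

Lemma ev_shuf0r W u (F : seq T -> W) : ev (shuf u [::]) F = F u.
Proof. by case: u => [|a u]; rewrite ev_one scale1r. Qed.

Lemma ev_shuf_cons W a u b v (F : seq T -> W) :
  ev (shuf (a :: u) (b :: v)) F = ev (shuf u (b :: v)) (fun w => F (a :: w)) +
    (-1) ^+ (size u).+1 *: ev (shuf (a :: u) v) (fun w => F (b :: w)).
Proof. by rewrite ev_cat ev_scl !ev_pre. Qed.

Lemma homog_shuf u v : homog (size u + size v)%N (shuf u v).
Proof.
elim: u v => [|a u IHu] v; first by rewrite /homog /= add0n eqxx.
elim: v => [|b v IHv]; first by rewrite /homog /= addn0 eqxx.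
apply: homog_cat; first by apply: homog_pre; apply: IHu.
by apply: homog_scl; rewrite addnS; apply: homog_pre.
Qed.

(** The mirror image of the defining recursion. The last face of the Hochschild
    differential sees the last letter of a shuffle. *)
Lemma ev_shuf_rcons W u a v b (F : seq T -> W) :
  ev (shuf (rcons u a) (rcons v b)) F =
    (-1) ^+ (size v).+1 *: ev (shuf u (rcons v b)) (fun w => F (rcons w a)) +
    ev (shuf (rcons u a) v) (fun w => F (rcons w b)).
Proof.
elim: u v F => [|c u IHu] v F; elim: v F => [|d v IHv] F /=.
- by rewrite ev_shuf_cons !(ev_shuf0l, ev_shuf0r) /=; lmod K W.
- rewrite ev_shuf_cons IHv ev_shuf_cons !ev_shuf0l /=.
  by lmod K W.
- rewrite ev_shuf_cons (IHu [::]) /= (ev_shuf_cons _ _ _ [::]) !ev_shuf0r size_rcons /=.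
  by lmod K W.
- rewrite ev_shuf_cons -rcons_cons (IHu (_ :: _)) -rcons_cons IHv /=.
  rewrite !ev_shuf_cons /= ?size_rcons.
  by lmod K W.
Qed.

End Shuffles.

Arguments shuf : simpl never.

(** * The Hochschild differential on words and the shuffle product *)

Section Boundaries.
Variables (K : fieldType) (A : comPzAlgType K).
Implicit Types (W : lmodType K) (u v w : seq A).

Definition merge_head (a : A) w : fsum K A :=
  if w is b :: w' then [:: (1, a * b :: w')] else [::].

(** The differential of the bar complex, b without its last face:
    the alternating sum of the words with two neighbours merged. *)
Fixpoint bar w : fsum K A :=
  if w is a :: w' then merge_head a w' ++ scl (-1) (pre a (bar w')) else [::].

(** The last face of b, the one that is not a merge of neighbours. *)
Definition wrap w : fsum K A :=
  if w is c :: b :: w' then [:: (1, last b w' * c :: belast b w')] else [::].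

Definition hochw w : fsum K A := bar w ++ scl ((-1) ^+ (size w).-1) (wrap w).

(** The shuffle product of chains; the first letters are multiplied and not shuffled. *)
Definition sprod u v : fsum K A :=
  match u, v with
  | a :: u', b :: v' => pre (a * b) (shuf K u' v')
  | _, _ => [::]
  end.

Lemma homog_bar w : homog (size w).-1 (bar w).
Proof.
elim: w => // a [|b w] IH //; apply: homog_cat; first by rewrite /homog /= eqxx.
by apply/homog_scl/homog_pre.
Qed.

Lemma homog_wrap w : homog (size w).-1 (wrap w).
Proof. by case: w => [|c [|b w]]; rewrite /homog //= size_belast eqxx. Qed.

Lemma homog_hochw w : homog (size w).-1 (hochw w).
Proof.
by apply: homog_cat; [apply: homog_bar | apply/homog_scl/homog_wrap].
Qed.

Lemma homog_sprod u v : homog (size u + size v).-1 (sprod u v).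
Proof.
by case: u v => [|a u] [|b v] //=; rewrite addnS; apply/homog_pre/homog_shuf.
Qed.

Arguments bar : simpl never.
Arguments merge_head : simpl never.
Arguments wrap : simpl never.
Arguments sprod : simpl never.

Lemma ev_bar_cons W a w (F : seq A -> W) :
  ev (bar (a :: w)) F = ev (merge_head a w) F - ev (bar w) (fun w' => F (a :: w')).
Proof. by rewrite ev_cat ev_scl ev_pre scaleN1r. Qed.

Lemma ev_merge_head W a b w (F : seq A -> W) :
  ev (merge_head a (b :: w)) F = F (a * b :: w).
Proof. by rewrite ev_one scale1r. Qed.

Lemma ev_shuf_merge_head W c u v (F : seq A -> W) :
  ev (shuf K u v) (fun w => ev (merge_head c w) F) =
    (if u is a :: u' then ev (shuf K u' v) (fun w => F (c * a :: w)) else 0) +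
    (-1) ^+ size u *:
      (if v is b :: v' then ev (shuf K u v') (fun w => F (c * b :: w)) else 0).
Proof.
case: u v => [|a u] [|b v].
- by rewrite !ev_shuf0l /= ev_nil; lmod K W.
- by rewrite !ev_shuf0l /= expr0; lmod K W.
- rewrite ev_shuf0r ev_merge_head ev_shuf0r. by lmod K W.
- rewrite ev_shuf_cons; congr (_ + _ *: _); apply: eq_ev => w; exact: ev_merge_head.
Qed.

Lemma ev_bar_shufl W a u b v (F : seq A -> W) :
  ev (bar u) (fun u' => ev (shuf K (a :: u') (b :: v)) F) =
    ev (bar u) (fun u' => ev (shuf K u' (b :: v)) (fun w => F (a :: w))) +
    (-1) ^+ size u *:
      ev (bar u) (fun u' => ev (shuf K (a :: u') v) (fun w => F (b :: w))).
Proof.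
rewrite -evZ -evD; case: u => [|c u]; first by rewrite !ev_nil.
apply: eq_ev_homog (homog_bar _) _ => w wE.
by rewrite ev_shuf_cons wE.
Qed.

Lemma ev_bar_shufr W a u b v (F : seq A -> W) :
  ev (bar v) (fun v' => ev (shuf K (a :: u) (b :: v')) F) =
    ev (bar v) (fun v' => ev (shuf K u (b :: v')) (fun w => F (a :: w))) +
    (-1) ^+ (size u).+1 *:
      ev (bar v) (fun v' => ev (shuf K (a :: u) v') (fun w => F (b :: w))).
Proof. by rewrite -evZ -evD; apply: eq_ev => w; rewrite ev_shuf_cons. Qed.

(** The bar complex of a commutative algebra is a differential graded algebra for
    the shuffle product. By induction on first letters a of u and b of v: the terms
    that merge a with b come from the shuffles beginning with ab and with ba, with
    opposite signs, and cancel since A is commutative. *)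
Lemma bar_shuf W u v (F : seq A -> W) :
  ev (shuf K u v) (fun w => ev (bar w) F) =
    ev (bar u) (fun u' => ev (shuf K u' v) F) +
    (-1) ^+ size u *: ev (bar v) (fun v' => ev (shuf K u v') F).
Proof.
elim: u v F => [|a u IHu] v F.
  rewrite ev_shuf0l [ev (bar [::]) _]ev_nil expr0 scale1r add0r.
  by apply: eq_ev => w; rewrite ev_shuf0l.
elim: v F => [|b v IHv] F.
  rewrite ev_shuf0r [X in _ *: X]ev_nil scaler0 addr0.
  by apply: eq_ev => w; rewrite ev_shuf0r.
rewrite ev_shuf_cons.
under eq_ev do rewrite ev_bar_cons.
under [X in _ + _ *: X]eq_ev do rewrite ev_bar_cons.
rewrite !evD !evN IHu IHv !ev_shuf_merge_head !ev_bar_cons.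
have ba : b * a = a * b := mulrC b a.
rewrite ev_bar_shufl ev_bar_shufr ba.
have mE c w (G : seq A -> W) :
    ev (merge_head c w) G = if w is d :: w' then G (c * d :: w') else 0.
  by case: w => [|d w]; rewrite ?ev_nil ?ev_merge_head.
rewrite !mE /=.
case: u {IHu IHv} => [|a2 u]; case: v => [|b2 v]; rewrite ?ev_shuf_cons /=; lmod K W.
Qed.

Lemma ev_wrap_rcons W c w z (F : seq A -> W) :
  ev (wrap (c :: rcons w z)) F = F (z * c :: w).
Proof.
case: w => [|b w]; rewrite /wrap /= ev_one scale1r //.
by rewrite last_rcons belast_rcons.
Qed.

Lemma wrap_shuf W c u v (F : seq A -> W) :
  ev (shuf K u v) (fun w => ev (wrap (c :: w)) F) =
    (-1) ^+ size v *:
      ev (wrap (c :: u)) (fun x => ev (shuf K (behead x) v) (fun w => F (head 0 x :: w))) +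
    ev (wrap (c :: v)) (fun y => ev (shuf K u (behead y)) (fun w => F (head 0 y :: w))).
Proof.
have nilE (G : seq A -> W) : ev (wrap [:: c]) G = 0 by rewrite ev_nil.
case/lastP: u v => [|u a] v; case/lastP: v => [|v b].
- by rewrite ev_shuf0l !nilE; lmod K W.
- by rewrite ev_shuf0l nilE !ev_wrap_rcons /= ev_shuf0l; lmod K W.
- by rewrite ev_shuf0r nilE !ev_wrap_rcons /= ev_shuf0r expr0; lmod K W.
- rewrite ev_shuf_rcons !ev_wrap_rcons size_rcons /=.
  by congr (_ *: _ + _); apply: eq_ev => w; rewrite ev_wrap_rcons.
Qed.

Lemma ev_sprod W a u b v (F : seq A -> W) :
  ev (sprod (a :: u) (b :: v)) F = ev (shuf K u v) (fun w => F (a * b :: w)).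
Proof. exact: ev_pre. Qed.

Lemma ev_hochw_cons W c w (F : seq A -> W) :
  ev (hochw (c :: w)) F =
    ev (merge_head c w) F - ev (bar w) (fun w' => F (c :: w')) +
    (-1) ^+ size w *: ev (wrap (c :: w)) F.
Proof. by rewrite ev_cat ev_scl ev_bar_cons. Qed.

(** The three parts of b on a word, namely merging into the first letter, merging
    inside, and the last face, satisfy the rule separately. *)
Lemma hochw_sprod W x y (F : seq A -> W) : (0 < size x)%N -> (0 < size y)%N ->
  ev (sprod x y) (fun w => ev (hochw w) F) =
    ev (hochw x) (fun x' => ev (sprod x' y) F) +
    (-1) ^+ (size x).-1 *: ev (hochw y) (fun y' => ev (sprod x y') F).
Proof.
case: x y => [//|a u] [//|b v] _ _; rewrite ev_sprod !ev_hochw_cons.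
under eq_ev do rewrite ev_hochw_cons.
rewrite evD evD evN bar_shuf ev_shuf_merge_head.
rewrite (eq_ev_homog (G := fun w =>
    (-1) ^+ (size u + size v) *: ev (wrap (a * b :: w)) F) (homog_shuf _ _ _)); last first.
  by move=> w ->.
rewrite evZ wrap_shuf.
have mE c w (G : seq A -> W) :
    ev (merge_head c w) G = if w is d :: w' then G (c * d :: w') else 0.
  by case: w => [|d w]; rewrite ?ev_nil ?ev_merge_head.
rewrite !mE /=.
have wE1 : ev (wrap (a * b :: u))
    (fun x => ev (shuf K (behead x) v) (fun w => F (head 0 x :: w))) =
    ev (wrap (a :: u)) (fun x' => ev (sprod x' (b :: v)) F).
  case/lastP: u => [|u z]; first by rewrite !ev_nil.
  by rewrite !ev_wrap_rcons ev_sprod mulrA.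
have wE2 : ev (wrap (a * b :: v))
    (fun y => ev (shuf K u (behead y)) (fun w => F (head 0 y :: w))) =
    ev (wrap (b :: v)) (fun y' => ev (sprod (a :: u) y') F).
  case/lastP: v {wE1} => [|v z]; first by rewrite !ev_nil.
  by rewrite !ev_wrap_rcons ev_sprod mulrCA.
rewrite wE1 wE2 exprD.
have sprodE1 : ev (bar u) (fun w' => ev (sprod (a :: w') (b :: v)) F) =
    ev (bar u) (fun w' => ev (shuf K w' v) (fun w => F (a * b :: w))).
  by apply: eq_ev => w; rewrite ev_sprod.
have sprodE2 : ev (bar v) (fun w' => ev (sprod (a :: u) (b :: w')) F) =
    ev (bar v) (fun w' => ev (shuf K u w') (fun w => F (a * b :: w))).
  by apply: eq_ev => w; rewrite ev_sprod.
rewrite sprodE1 sprodE2.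
have sE w : (-1) ^+ size w * (-1) ^+ size w = 1 :> K.
  by rewrite -exprD -(expr0 (-1)); parity.
have su := sE u; have sv := sE v.
have mA a2 : a * b * a2 = a * a2 * b := mulrAC a b a2.
have mA' b2 : a * b * b2 = a * (b * b2) := esym (mulrA a b b2).
case: u v {wE1 wE2 sprodE1 sprodE2} su sv => [|a2 u] [|b2 v] /= su sv;
  rewrite ?ev_sprod.
- by lmod K W.
- by rewrite mA' /=; lmod K W; rewrite exprS in sv; ring: sv.
- by rewrite mA /=; lmod K W.
- by rewrite mA mA' /=; lmod K W; rewrite exprS in sv; ring: sv.
Qed.

End Boundaries.
Arguments bar : simpl never.
Arguments merge_head : simpl never.
Arguments wrap : simpl never.
Arguments hochw : simpl never.
Arguments sprod : simpl never.

(** * Rotations and the Connes operator *)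

Lemma sum_periodic (V : zmodType) n (g : nat -> V) k :
  (forall j, g (j + n)%N = g j) -> \sum_(j < n) g (j + k)%N = \sum_(j < n) g j.
Proof.
move=> gn; elim: k => [|k IH]; first by apply: eq_bigr => j _; rewrite addn0.
rewrite -{}IH; case: n gn => [|n] gn; first by rewrite !big_ord0.
rewrite big_ord_recr [RHS]big_ord_recl [RHS]addrC /= addnS -addSn -(gn (0 + k)%N).
congr (_ + g _); last by rewrite add0n addnC.
by apply: eq_bigr => j _; rewrite /bump leq0n add1n addnS.
Qed.

Section Rotations.
Variables (K : fieldType) (T : Type).
Implicit Types (W : lmodType K) (u v w : seq T).

(** Iterated rotation is periodic in i, unlike [rot], which is the identity beyond
    the length of the word. *)
Definition turn i w := iter i (rot 1) w.

Lemma turnD i j w : turn (i + j) w = turn i (turn j w).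
Proof. exact: iterD. Qed.

Lemma size_turn i w : size (turn i w) = size w.
Proof. by elim: i => //= i IH; rewrite size_rot. Qed.

Lemma turnE i w : (i <= size w)%N -> turn i w = rot i w.
Proof.
elim: i => [|i IH] iw; first by rewrite rot0.
by rewrite rotS // -IH // ltnW.
Qed.

Lemma turn_size w : turn (size w) w = w.
Proof. by rewrite turnE // rot_size. Qed.

Lemma turn_cat u v : turn (size u) (u ++ v) = v ++ u.
Proof. by rewrite turnE ?rot_size_cat // size_cat leq_addr. Qed.

(** The norm operator N: the sum of the powers of the signed cyclic rotation. *)
Definition rots w : fsum K T :=
  [seq ((-1) ^+ ((size w).-1 * i), turn i w) | i <- iota 0 (size w)].

Lemma ev_rots W w (F : seq T -> W) :
  ev (rots w) F = \sum_(i < size w) (-1) ^+ ((size w).-1 * i) *: F (turn i w).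
Proof.
rewrite -(big_mkord xpredT (fun i => (-1) ^+ ((size w).-1 * i) *: F (turn i w))).
by rewrite /ev big_map /index_iota subn0.
Qed.

Lemma homog_rots w : homog (size w) (rots w).
Proof. by rewrite /homog all_map; apply/allP => i _ /=; rewrite size_turn. Qed.

Lemma sign_period n j : (-1) ^+ (n.-1 * (j + n)) = (-1) ^+ (n.-1 * j) :> K.
Proof. by case: n => // n; rewrite mulnDr; parity. Qed.

(** N absorbs rotations up to their sign, since the signs are those of a cyclic
    group: (-1)^((n-1)n) = 1. *)
Lemma rots_turn W w k (F : seq T -> W) :
  ev (rots w) (fun x => F (turn k x)) = (-1) ^+ ((size w).-1 * k) *: ev (rots w) F.
Proof.
rewrite !ev_rots -(sum_periodic k (n := size w)
  (g := fun i => (-1) ^+ ((size w).-1 * i) *: F (turn i w))); last first.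
  by move=> j; rewrite sign_period turnD turn_size.
rewrite scaler_sumr; apply: eq_bigr => i _; rewrite -turnD scalerA [(k + i)%N]addnC.
by congr (_ *: _); rewrite mulnDr -exprD; parity.
Qed.

Lemma turn_rots W w k (F : seq T -> W) :
  ev (rots (turn k w)) F = (-1) ^+ ((size w).-1 * k) *: ev (rots w) F.
Proof.
rewrite -rots_turn !ev_rots size_turn; apply: eq_bigr => i _.
by rewrite -!turnD addnC.
Qed.

Lemma rots_rev W w (F : seq T -> W) :
  ev (rots w) F =
    \sum_(i < size w) (-1) ^+ ((size w).-1 * i) *: F (turn (size w - i) w).
Proof.
rewrite ev_rots -(sum_periodic 1 (n := size w)
  (g := fun i => (-1) ^+ ((size w).-1 * i) *: F (turn i w))); last first.
  by move=> j; rewrite sign_period turnD turn_size.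
rewrite (reindex_inj rev_ord_inj) /=; apply: eq_bigr => i _.
have iw := ltn_ord i; have -> : (size w - i.+1 + 1 = size w - i)%N by lia.
congr (_ *: _); apply: eq_signr; rewrite !oddM oddB; last exact: ltnW.
move: (nat_of_ord i) iw => j; case: (size w) => //= n _.
by case: (odd n); case: (odd j).
Qed.

End Rotations.

Section CyclicWords.
Variables (K : fieldType) (A : comPzAlgType K).
Implicit Types (W : lmodType K) (u v w : seq A).

(** The first face d_0; short words are kept so that it is linear in every letter
    of words of any length. *)
Definition merge0 w := if w is a :: b :: w' then a * b :: w' else w.

Lemma size_merge0 w : (1 < size w)%N -> size (merge0 w) = (size w).-1.
Proof. by case: w => [|a [|b w]]. Qed.

Lemma ev_bar_take W w (F : seq A -> W) :
  ev (bar w) F =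
    \sum_(i < (size w).-1) (-1) ^+ i *: F (take i w ++ merge0 (drop i w)).
Proof.
elim: w F => [|a [|b w] IH] F; first by rewrite ev_nil big_ord0.
  by rewrite ev_bar_cons !ev_nil big_ord0 subr0.
rewrite ev_bar_cons ev_merge_head IH /= big_ord_recl /= expr0 scale1r; congr (_ + _).
rewrite -sumrN; apply: eq_bigr => i _.
by rewrite /bump leq0n add1n exprS mulN1r scaleNr.
Qed.

(** Each face is the first face conjugated by a rotation. *)
Lemma ev_bar W w (F : seq A -> W) :
  ev (bar w) F =
    \sum_(i < (size w).-1) (-1) ^+ i *: F (turn ((size w).-1 - i) (merge0 (turn i w))).
Proof.
rewrite ev_bar_take.
apply: eq_bigr => i _; have iw := ltn_ord i.
have iw1 : (i < size w)%N by lia.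
rewrite (turnE (ltnW iw1)) /rot; congr (_ *: F _).
have : (1 < size (drop i w))%N by rewrite size_drop; lia.
have szE : (i + size (drop i w) = size w)%N by rewrite size_drop; lia.
case: (drop i w) szE => [//|a [//|b v]] /= szE _.
have -> : ((size w).-1 - i)%N = size (a * b :: v) by rewrite /=; lia.
by rewrite -cat_cons turn_cat.
Qed.

Lemma ev_wrap W w (F : seq A -> W) : (1 < size w)%N ->
  ev (wrap w) F = F (merge0 (turn (size w).-1 w)).
Proof.
case: w => [//|c w]; case/lastP: w => [//|w z] _; rewrite ev_wrap_rcons; congr F.
rewrite /= size_rcons -rcons_cons -cats1 -[(size w).+1]/(size (c :: w)) turn_cat //.
Qed.

Lemma ev_hochw W w (F : seq A -> W) : (1 < size w)%N ->
  ev (hochw w) F =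
    \sum_(i < size w) (-1) ^+ i *: F (turn ((size w).-1 - i) (merge0 (turn i w))).
Proof.
move=> w1; rewrite ev_cat ev_scl ev_bar ev_wrap //.
by case: (size w) w1 => // n _; rewrite big_ord_recr /= subnn.
Qed.

(** Both sides are N d_0 N, because N absorbs the rotations by which the faces are
    conjugate to d_0; b has one more face than the bar differential, just as words
    before a merge have one more rotation than words after it. *)
Lemma hochw_rots W w (F : seq A -> W) :
  ev (hochw w) (fun x => ev (rots K x) F) = ev (rots K w) (fun x => ev (bar x) F).
Proof.
have [w1|w1] := ltnP 1 (size w); last first.
  case: w w1 => [|a [|b w]] // _; first by rewrite !ev_nil.
  by rewrite ev_cat ev_scl ev_rots /= big_ord1 !ev_nil /=; lmod K W.
rewrite ev_hochw //.
transitivity (ev (rots K w) (fun x => ev (rots K (merge0 x)) F)).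
  rewrite [RHS]ev_rots; apply: eq_bigr => i _; have iw := ltn_ord i.
  rewrite turn_rots size_merge0 size_turn // scalerA -exprD; congr (_ *: _).
  move: (nat_of_ord i) iw => j jw.
  apply: eq_signr; rewrite oddD !oddM oddB; last by lia.
  case: (size w) w1 => [//|[//|n]] _ /=.
  by case: (odd n); case: (odd j).
rewrite (eq_ev_homog (homog_rots _ w)
  (G := fun x => \sum_(i < (size w).-1)
    (-1) ^+ (((size w).-1).-1 * i) *: F (turn ((size w).-1 - i) (merge0 x)))); last first.
  by move=> x xw; rewrite rots_rev size_merge0 xw.
rewrite [RHS](eq_ev_homog (homog_rots _ w)
  (G := fun x => \sum_(i < (size w).-1)
    (-1) ^+ i *: F (turn ((size w).-1 - i) (merge0 (turn i x))))); last first.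
  by move=> x xw; rewrite ev_bar xw.
rewrite !ev_sum; apply: eq_bigr => i _.
rewrite !evZ (rots_turn w i (fun x => F (turn ((size w).-1 - i) (merge0 x)))).
rewrite scalerA -exprD; congr (_ *: _); move: (nat_of_ord i) => j.
apply: eq_signr; rewrite oddD !oddM.
case: (size w) w1 => [//|[//|n]] _ /=.
by case: (odd n); case: (odd j).
Qed.

Definition connesw w : fsum K A := pre 1 (rots K w).

Lemma homog_connesw w : homog (size w).+1 (connesw w).
Proof. exact/homog_pre/homog_rots. Qed.

Lemma ev_connesw W w (F : seq A -> W) :
  ev (connesw w) F = ev (rots K w) (fun x => F (1 :: x)).
Proof. exact: ev_pre. Qed.

(** On a word beginning with 1, b(1,w) = w - (1,b'w) - t w, where b' is the bar
    differential and t the signed rotation. Summed over the rotations of w, the first and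
    last terms cancel, and the remaining one is given by [hochw_rots]. *)
Lemma hochw_connesw W w (F : seq A -> W) :
  ev (connesw w) (fun x => ev (hochw x) F) =
    - ev (hochw w) (fun x => ev (connesw x) F).
Proof.
rewrite ev_connesw; under [in RHS]eq_ev do rewrite ev_connesw.
rewrite hochw_rots -evN.
have [w0|w0] := posnP (size w); first by rewrite (size0nil w0) !ev_nil.
rewrite (eq_ev_homog (homog_rots _ w)
  (G := fun x => (F x + (-1) ^+ size w *: F (turn (size w).-1 x)) -
                 ev (bar x) (fun y => F (1 :: y)))); last first.
  move=> x xw; rewrite ev_hochw_cons xw.
  have -> : ev (merge_head 1 x) F = F x.
    by case: x xw => [|a x] xw; rewrite -?xw in w0 *; rewrite // ev_merge_head mul1r.
  rewrite ev_wrap /=; last by rewrite ltnS xw.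
  rewrite addrAC xw; congr (_ + _ *: F _ - _).
  case/lastP: x xw => [|x z] xw; first by rewrite -xw in w0.
  rewrite -xw size_rcons -[in turn _ (1 :: _)]rcons_cons -!cats1.
  by rewrite -[(size x).+1]/(size (1 :: x)) !turn_cat /= mulr1.
rewrite evD -[RHS]add0r; congr (_ + _).
rewrite evD evZ (rots_turn w (size w).-1 F) scalerA -exprD.
have -> : (-1) ^+ (size w + (size w).-1 * (size w).-1) = -1 :> K.
  rewrite -[RHS]expr1; apply: eq_signr; case: (size w) w0 => //= n _.
  by rewrite oddD oddM /=; case: (odd n).
by rewrite scaleN1r subrr.
Qed.

End CyclicWords.

(** * Cyclic shuffles *)

Section Splittings.
Variables (K : fieldType) (T : Type).
Implicit Types (W : lmodType K) (u v w : seq T).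

Definition spl W w (G : seq T -> seq T -> W) : W :=
  \sum_(k < (size w).+1) G (take k w) (drop k w).

Lemma spl_nil W (G : seq T -> seq T -> W) : spl [::] G = G [::] [::].
Proof. by rewrite /spl big_ord1. Qed.

Lemma spl_cons W a w (G : seq T -> seq T -> W) :
  spl (a :: w) G = G [::] (a :: w) + spl w (fun x y => G (a :: x) y).
Proof. by rewrite /spl big_ord_recl. Qed.

Lemma eq_spl W w (G H : seq T -> seq T -> W) :
  (forall x y, (size x + size y)%N = size w -> G x y = H x y) -> spl w G = spl w H.
Proof. by move=> GH; apply: eq_bigr => k _; rewrite GH // -size_cat cat_take_drop. Qed.

Lemma splD W w (G H : seq T -> seq T -> W) :
  spl w (fun x y => G x y + H x y) = spl w G + spl w H.
Proof. exact: big_split. Qed.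

Lemma splZ W w k (G : seq T -> seq T -> W) :
  spl w (fun x y => k *: G x y) = k *: spl w G.
Proof. by rewrite /spl scaler_sumr. Qed.

Lemma exchange_spl W v w (G : seq T -> seq T -> seq T -> seq T -> W) :
  spl v (fun x y => spl w (G x y)) = spl w (fun x' y' => spl v (fun x y => G x y x' y')).
Proof. exact: exchange_big. Qed.

(** Cutting a shuffle of u and v in two amounts to cutting u and v and shuffling
    the parts: deconcatenation is multiplicative for the shuffle product. The sign
    comes from moving the first part of v past the second part of u. *)
Lemma spl_shuf W u v (G : seq T -> seq T -> W) :
  ev (shuf K u v) (fun w => spl w G) =
    spl u (fun u1 u2 => spl v (fun v1 v2 => (-1) ^+ (size u2 * size v1) *:
      ev (shuf K u1 v1) (fun x => ev (shuf K u2 v2) (G x)))).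
Proof.
elim: u v G => [|a u IHu] v G.
  rewrite ev_shuf0l spl_nil; apply: eq_spl => x y _.
  by rewrite ev_shuf0l ev_shuf0l mul0n expr0 scale1r.
elim: v G => [|b v IHv] G.
  rewrite ev_shuf0r; apply: eq_spl => x y _.
  by rewrite spl_nil ev_shuf0r ev_shuf0r muln0 expr0 scale1r.
rewrite ev_shuf_cons; under eq_ev do rewrite spl_cons.
under [X in _ + _ *: X]eq_ev do rewrite spl_cons.
rewrite !evD IHu IHv.
(* The parts before the cut that begin with a (X1, X2: without and with letters of v)
   and those that begin with b (X3, X4: with and without letters of u). *)
pose X1 x u2 : W := ev (shuf K x [::]) (fun w => ev (shuf K u2 (b :: v)) (G (a :: w))).
pose X2 x u2 y v2 : W := (-1) ^+ (size u2 * (size y).+1) *: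
  ev (shuf K x (b :: y)) (fun w => ev (shuf K u2 v2) (G (a :: w))).
pose X3 x u2 y v2 : W := (-1) ^+ (size u2 * size y) *:
  ev (shuf K (a :: x) y) (fun w => ev (shuf K u2 v2) (G (b :: w))).
pose X4 y v2 : W := (-1) ^+ (size (a :: u) * size y) *:
  ev (shuf K [::] y) (fun w => ev (shuf K (a :: u) v2) (G (b :: w))).
rewrite (@eq_spl _ u _ (fun x u2 => X1 x u2 + spl v (X2 x u2))); last first.
  by move=> x u2 _; rewrite spl_cons /= muln0 expr0 scale1r.
rewrite [X in _ + _ *: (_ + X)]spl_cons -/X4 [RHS]spl_cons.
rewrite [X in _ = X + _]spl_cons /= muln0 expr0 scale1r !ev_shuf0l ev_shuf_cons.
rewrite [X in _ = _ + X + _](@eq_spl _ v _ (fun y v2 =>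
  (-1) ^+ (size u).+1 *: X4 y v2)); last first.
  move=> y v2 _; rewrite /X4 scalerA !ev_shuf0l -exprD; congr (_ *: _).
  by rewrite mulnS.
rewrite [X in _ = _ + X](@eq_spl _ u _ (fun x u2 => X1 x u2 +
   (spl v (X2 x u2) + (-1) ^+ (size u).+1 *: spl v (X3 x u2)))); last first.
  move=> x u2 szu; rewrite spl_cons /= muln0 expr0 scale1r; congr (_ + _).
    by rewrite /X1 !ev_shuf0r.
  rewrite -splZ -splD; apply: eq_spl => y v2 _.
  rewrite ev_shuf_cons scalerDr /X2 /X3 !scalerA -!exprD; congr (_ + _ *: _).
  by rewrite -szu mulnS; parity.
rewrite !splD !splZ -[X in _ + _ *: (_ + (_ + X))]/(spl u (fun x u2 => spl v (X3 x u2))).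
by lmod K W.
Qed.

(** A shuffle of u with a word containing a marked letter b is cut open at b. *)
Lemma shuf_cat_cons W u v2 b v1 (F : seq T -> W) :
  ev (shuf K u (v2 ++ b :: v1)) F =
    spl u (fun u1 u2 => (-1) ^+ (size u2 * (size v2).+1) *:
      ev (shuf K u1 v2) (fun x => ev (shuf K u2 v1) (fun y => F (x ++ b :: y)))).
Proof.
elim: u v2 F => [|a u IHu] v2 F.
  by rewrite ev_shuf0l spl_nil mul0n expr0 scale1r !ev_shuf0l.
elim: v2 F => [|b2 v2 IHv] F /=.
  rewrite ev_shuf_cons spl_cons ev_shuf0l muln1 addrC; congr (_ + _).
  rewrite -[b :: v1]cat0s IHu; apply: eq_spl => x y _.
  by rewrite !ev_shuf0r.
rewrite ev_shuf_cons -cat_cons IHu IHv !spl_cons scalerDr addrCA ev_shuf0l.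
congr (_ + _).
  rewrite ev_shuf0l scalerA -exprD /=; congr (_ *: _).
  by rewrite !mulnS; parity.
rewrite -splZ -splD; apply: eq_spl => x y szu.
rewrite ev_shuf_cons scalerDr !scalerA -!exprD; congr (_ + _ *: _).
by rewrite -szu !mulnS; parity.
Qed.

Lemma rots_cons W b w (F : seq T -> W) :
  ev (rots K (b :: w)) F =
    spl w (fun x y => (-1) ^+ (size w * (size x).+1) *: F (y ++ b :: x)).
Proof.
rewrite ev_rots -(sum_periodic 1 (n := size (b :: w))
  (g := fun i => (-1) ^+ ((size (b :: w)).-1 * i) *: F (turn i (b :: w)))); last first.
  by move=> j; rewrite sign_period turnD turn_size.
apply: eq_bigr => i _; have iw := ltn_ord i; rewrite ltnS in iw.
by rewrite addn1 turnE // /rot /= size_take_min (minn_idPl iw).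
Qed.

(** The two parts of a cut cyclic word can be exchanged, at the cost of the sign of
    the rotation that exchanges them. *)
Lemma rots_spl W u (H : seq T -> seq T -> W) :
  ev (rots K u) (fun w => spl w H) =
  ev (rots K u) (fun w => spl w (fun x y => (-1) ^+ (size x * size y) *: H y x)).
Proof.
rewrite (eq_ev_homog (homog_rots _ u)
  (G := fun w => \sum_(k < (size u).+1) H (take k w) (drop k w))); last first.
  by move=> w wu; rewrite /spl wu.
rewrite [RHS](eq_ev_homog (homog_rots _ u)
  (G := fun w => \sum_(k < (size u).+1)
    (-1) ^+ (k * (size u - k)) *: H (drop k w) (take k w))); last first.
  move=> w wu; rewrite /spl wu; apply: eq_bigr => k _.
  have := ltn_ord k; rewrite ltnS => ku.
  by rewrite size_take_min size_drop wu (minn_idPl ku).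
rewrite !ev_sum [RHS](reindex_inj rev_ord_inj) /=; apply: eq_bigr => k _.
have := ltn_ord k; rewrite ltnS subSS => ku.
(* Cutting after k' letters and exchanging the parts is cutting the rotation by k'
   after k letters. *)
set k' := (size u - k)%N; have k'u : (k' <= size u)%N by lia.
rewrite [RHS](eq_ev_homog (homog_rots _ u) (G := fun w => (-1) ^+ (k' * (size u - k')) *:
  H (take k (turn k' w)) (drop k (turn k' w)))); last first.
  move=> w wu; rewrite turnE ?wu // /rot.
  have szk : size (drop k' w) = k by rewrite size_drop wu; lia.
  by rewrite take_size_cat // drop_size_cat.
rewrite evZ (rots_turn u k' (fun w => H (take k w) (drop k w))) scalerA -exprD.
rewrite (_ : (-1) ^+ _ = 1) ?scale1r // -(expr0 (-1)).
apply: eq_signr; rewrite oddD !oddM oddB //.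
case: (size u) k'u => [|n] /=; first by rewrite leqn0 => /eqP->.
by case: (odd n); case: (odd k').
Qed.

(** Both sides are sums over cuts u1, u2 of the rotations of u and v1, v2 of v, of
    words (shuffle of u2, v2) b (shuffle of u1, v1). On the left the rotations cut at b
    a shuffle that starts with b; on the right b and v are rotated before shuffling.
    The cuts of u come in opposite order, whence [rots_spl]. *)
Lemma rots_shuf W u b v (F : seq T -> W) :
  ev (rots K u) (fun u' => ev (shuf K u' v) (fun w => ev (rots K (b :: w)) F)) =
  (-1) ^+ size u *:
    ev (rots K u) (fun u' => ev (rots K (b :: v)) (fun v' => ev (shuf K u' v') F)).
Proof.
rewrite (eq_ev_homog (homog_rots _ u) (G := fun u' => spl u' (fun u1 u2 =>
  spl v (fun v1 v2 =>
    (-1) ^+ (size u2 * size v1 + (size u + size v) * (size u1 + size v1).+1) *: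
    ev (shuf K u2 v2) (fun y => ev (shuf K u1 v1) (fun x => F (y ++ b :: x))))))); last first.
  move=> u' u'u.
  rewrite (eq_ev_homog (homog_shuf _ _ _) (G := fun w => spl w (fun x y =>
    (-1) ^+ ((size u + size v) * (size x).+1) *: F (y ++ b :: x)))); last first.
    by move=> w wu; rewrite rots_cons wu u'u.
  rewrite spl_shuf; apply: eq_spl => u1 u2 _; apply: eq_spl => v1 v2 _.
  rewrite exprD -scalerA; congr (_ *: _).
  rewrite exchange_ev -evZ; apply: eq_ev => y.
  rewrite -evZ; apply: (eq_ev_homog (homog_shuf _ _ _)) => x -> //.
rewrite [in RHS](eq_ev_homog (homog_rots _ u) (G := fun u' => spl u' (fun u1 u2 =>
  spl v (fun v1 v2 =>
    (-1) ^+ (size v * (size v1).+1 + size u2 * (size v2).+1) *: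
    ev (shuf K u1 v2) (fun y => ev (shuf K u2 v1) (fun x => F (y ++ b :: x))))))); last first.
  move=> u' u'u; rewrite exchange_spl rots_cons; apply: eq_spl => v1 v2 _.
  rewrite shuf_cat_cons -splZ; apply: eq_spl => u1 u2 _.
  by rewrite scalerA -exprD.
rewrite [in RHS]rots_spl -evZ; apply: (eq_ev_homog (homog_rots _ u)) => u' u'u.
rewrite -splZ; apply: eq_spl => u1 u2 szu; rewrite -splZ -splZ; apply: eq_spl => v1 v2 szv.
rewrite !scalerA -!exprD -u'u -szu -szv; congr (_ *: _).
by rewrite !mulnS; parity.
Qed.

End Splittings.

(** * Shuffle permutations *)

(** Permutations are parametrized by the position that they send to 0, and by their
    restriction to the other positions. *)
Lemma lift_perm_bij n :
  bijective (fun x : 'I_n.+1 * 'S_n => lift_perm x.1 ord0 x.2).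
Proof.
apply: inj_card_bij; last first.
  by rewrite card_prod card_ord !card_Sn factS.
move=> [i s] [j t] /= st.
have ij : i = j by apply: (@perm_inj _ (lift_perm i ord0 s)); rewrite {2}st !lift_perm_id.
rewrite {}ij in st *; congr (_, _); apply/permP=> k.
by apply: (@lift_inj _ ord0); rewrite -!(lift_perm_lift j) st.
Qed.

Lemma sum_lift_perm (V : zmodType) n (P : pred 'S_n.+1) (f : 'S_n.+1 -> V) :
  \sum_(sigma | P sigma) f sigma =
  \sum_(i < n.+1) \sum_(s | P (lift_perm i ord0 s)) f (lift_perm i ord0 s).
Proof.
rewrite pair_big_dep (reindex _ (onW_bij _ (@lift_perm_bij n))) /=.
exact: eq_bigl.
Qed.

Lemma is_shuffleP p n (sigma : 'S_n) :
  reflect (forall i j : 'I_n, (i < j)%N -> (j < p)%N || (p <= i)%N -> (sigma i < sigma j)%N)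
          (is_shuffle p sigma).
Proof.
apply: (iffP forallP) => [H i j ij ijp|H i].
  by have /forallP/(_ j)/implyP := H i; rewrite ij => ->.
by apply/forallP=> j; apply/implyP=> /andP[]; apply: H.
Qed.

(** Only the first letter of one of the two words can come first in a shuffle. *)
Lemma is_shuffle_lift n p (i : 'I_n.+1) (s : 'S_n) :
  is_shuffle p (lift_perm i ord0 s) =
    ((i == 0 :> nat) && (0 < p)%N && is_shuffle p.-1 s) ||
    ((i == p :> nat) && is_shuffle p s).
Proof.
have liftE (j : 'I_n.+1) (k : 'I_n) :
    nat_of_ord (fintype.lift j k) = if (k < j)%N then nat_of_ord k else k.+1.
  by rewrite /= /bump leqNgt; case: (k < j)%N.
have lift_lt (j : 'I_n.+1) (k l : 'I_n) :
    (fintype.lift j k < fintype.lift j l)%N = (k < l)%N.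
  by rewrite !liftE; do !case: ifP; lia.
have restrict q : (forall k l : 'I_n, (k < l)%N -> (l < q)%N || (q <= k)%N ->
      (fintype.lift i l < p)%N || (p <= fintype.lift i k)%N) ->
    is_shuffle p (lift_perm i ord0 s) -> is_shuffle q s.
  move=> cond /is_shuffleP H; apply/is_shuffleP=> k l kl klq.
  by rewrite -(lift_lt ord0) -!(lift_perm_lift i); apply: H; rewrite ?lift_lt ?cond.
have extend q : (forall k l : 'I_n, (k < l)%N ->
      (fintype.lift i l < p)%N || (p <= fintype.lift i k)%N -> (l < q)%N || (q <= k)%N) ->
    (forall k : 'I_n, (fintype.lift i k < i)%N -> ~~ ((i < p)%N || (p <= fintype.lift i k)%N)) ->
    is_shuffle q s -> is_shuffle p (lift_perm i ord0 s).
  move=> cond cond0 /is_shuffleP H; apply/is_shuffleP=> k l.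
  case: (unliftP i k) => [k'|] ->; case: (unliftP i l) => [l'|] -> kl klp.
  - by rewrite !lift_perm_lift lift_lt; rewrite lift_lt in kl; apply: H => //; apply: cond.
  - by rewrite (negPf (cond0 _ kl)) in klp.
  - by rewrite lift_perm_id lift_perm_lift.
  - by rewrite ltnn in kl.
apply/idP/orP => [H|[/andP[/andP[/eqP i0 p0]]|/andP[/eqP ip]]]; last 2 first.
- by apply: extend => [k l|k]; rewrite !liftE i0 ?ltn0 //; lia.
- by apply: extend => [k l|k]; rewrite !liftE ip; do !case: ifP; lia.
case: (ltngtP i p) => [ip|ip|ip]; last first.
- by right; apply: restrict H => k l; rewrite !liftE ip; do !case: ifP; lia.
- have p_n : (p < n.+1)%N by apply: ltn_trans (ltn_ord i).
  have /is_shuffleP/(_ (Ordinal p_n) i ip) := H.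
  by rewrite leqnn orbT lift_perm_id ltn0 => /(_ isT).
- left; have i0 : i = 0 :> nat.
    apply/eqP; rewrite -leqn0 leqNgt; apply/negP=> i0.
    have /is_shuffleP/(_ ord0 i i0) := H.
    by rewrite ip lift_perm_id ltn0 => /(_ isT).
  rewrite i0 eqxx (leq_ltn_trans _ ip) //=; apply: restrict H => k l.
  by rewrite !liftE i0 !ltn0; lia.
Qed.

Section ShufflePermutations.
Variables (K : fieldType) (T : Type) (x0 : T) (W : lmodType K).

Definition perm_word n (l : seq T) (sigma : 'S_n) : seq T :=
  [seq nth x0 l ((sigma^-1)%g i) | i <- enum 'I_n].

Lemma perm_word_lift n (l : seq T) (i : 'I_n.+1) (s : 'S_n) : size l = n.+1 ->
  perm_word l (lift_perm i ord0 s) =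
  nth x0 l i :: perm_word (take i l ++ drop i.+1 l) s.
Proof.
move=> ln; rewrite /perm_word enum_ordSl /= lift_permV lift_perm_id -map_comp.
congr (_ :: _); apply: eq_map => k /=; rewrite lift_perm_lift nth_cat.
have il : (i < size l)%N by rewrite ln.
rewrite size_take_min (minn_idPl (ltnW il)) /= /bump.
case: ltnP => h; first by rewrite add0n nth_take.
by rewrite nth_drop; congr nth; lia.
Qed.

(** The sum over shuffle permutations obeys the recursion by which shuffles of words
    are defined: the permutations are sorted by the position that they send to 0. *)
Lemma sum_shuffle n (l : seq T) p (F : seq T -> W) : size l = n -> (p <= n)%N ->
  \sum_(sigma : 'S_n | is_shuffle p sigma) (-1) ^+ sigma *: F (perm_word l sigma) =
  ev (shuf K (take p l) (drop p l)) F.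
Proof.
elim: n l p F => [|n IH] l p F ln.
  rewrite leqn0 => /eqP->; rewrite (size0nil ln) ev_shuf0l.
  rewrite (bigD1 (1%g : 'S_0)) /=; last by apply/forallP=> -[].
  rewrite odd_perm1 expr0 scale1r big1 ?addr0 => [|s]; last first.
    by rewrite andbC; case/andP=> /eqP[]; apply/permP=> -[].
  by rewrite /perm_word enum_ord0.
move=> pn; rewrite sum_lift_perm.
pose first_letter (i : 'I_n.+1) q :=
  (-1) ^+ i *: ev (shuf K (take q (take i l ++ drop i.+1 l)) (drop q (take i l ++ drop i.+1 l)))
    (fun w => F (nth x0 l i :: w)).
have termE (i : 'I_n.+1) q : (q <= n)%N ->
   (forall s, is_shuffle p (lift_perm i ord0 s) = is_shuffle q s) ->
   \sum_(s | is_shuffle p (lift_perm i ord0 s))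
     (-1) ^+ lift_perm i ord0 s *: F (perm_word l (lift_perm i ord0 s)) = first_letter i q.
  move=> qn sq; have szl : size (take i l ++ drop i.+1 l) = n.
    by have := ltn_ord i; rewrite size_cat size_take_min size_drop ln; lia.
  rewrite /first_letter -(IH _ q _ szl qn) scaler_sumr.
  apply: eq_big => // s _; rewrite perm_word_lift // odd_lift_perm /= addbF scalerA.
  by rewrite signr_addb signr_odd.
have term0 (i : 'I_n.+1) : (i != 0 :> nat) -> (i != p :> nat) ->
   \sum_(s | is_shuffle p (lift_perm i ord0 s))
     (-1) ^+ lift_perm i ord0 s *: F (perm_word l (lift_perm i ord0 s)) = 0.
  move=> i0 ip; apply: big_pred0 => s.
  by rewrite is_shuffle_lift (negPf i0) (negPf ip).
case: l ln @first_letter termE term0 => [//|a l] [ln] first_letter termE term0.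
case: p pn termE term0 => [|p] pn termE term0.
  rewrite (bigD1 ord0) //= (termE ord0 0%N) // => [|s].
    rewrite big1 ?addr0 => [|i]; last by rewrite -val_eqE => i0; apply: term0.
    by rewrite /first_letter /= expr0 scale1r !take0 !drop0 !ev_shuf0l.
  by rewrite is_shuffle_lift.
rewrite (bigD1 ord0) //= (termE ord0 p) // => [|s]; last first.
  by rewrite is_shuffle_lift orbF.
rewrite {1}/first_letter /= expr0 scale1r drop0.
have [pn1|pn1] := eqVneq p.+1 n.+1.
  rewrite big1 ?addr0 => [|i]; last first.
    rewrite -val_eqE => i0; apply: term0 => //.
    by have := ltn_ord i; lia.
  by rewrite !drop_oversize ?take_oversize ?ln ?ev_shuf0r //; lia.
have pn2 : (p.+1 < n.+1)%N by lia.
rewrite (bigD1 (Ordinal pn2)) //= (termE (Ordinal pn2) p.+1) // => [|s]; last first.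
  by rewrite is_shuffle_lift eqxx.
rewrite big1 ?addr0 => [|i]; last first.
  by rewrite -!val_eqE => /andP[i0 ip]; apply: term0.
have pl : (p < size l)%N by lia.
rewrite /first_letter /= -/(drop 1 l) (drop_nth x0 pl) ev_shuf_cons.
have tk : size (take p l) = p by rewrite size_take_min; lia.
rewrite tk; congr (_ + _ *: ev (shuf _ (_ :: _) _) _).
  by rewrite take_cat tk ltnn subnn take0 cats0.
by rewrite drop_cat tk ltnn subnn drop0.
Qed.

End ShufflePermutations.

(** * Multilinear forms on words *)

Section MarkedLetter.
Variables (K : fieldType) (T : Type).
Implicit Types (W : lmodType K) (u v : seq T).

(** A combination of values of F at words containing the letter a once. The shape of
    a shuffle does not depend on its letters, so a letter of one factor can be followed
    through all terms; linearity in that letter, and vanishing when it is 1, result. *)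
Definition marked W (L : seq (K * (seq T * seq T))) a (F : seq T -> W) : W :=
  \sum_(x <- L) x.1 *: F (x.2.1 ++ a :: x.2.2).

Lemma marked_cons W (L : seq (K * (seq T * seq T))) a c (F : seq T -> W) :
  marked L a (fun w => F (c :: w)) =
  marked [seq (x.1, (c :: x.2.1, x.2.2)) | x <- L] a F.
Proof. by rewrite /marked big_map. Qed.

Lemma marked_scale W (L : seq (K * (seq T * seq T))) a k (F : seq T -> W) :
  k *: marked L a F = marked [seq (k * x.1, x.2) | x <- L] a F.
Proof.
by rewrite /marked big_map scaler_sumr; apply: eq_bigr => x _; rewrite scalerA.
Qed.

Lemma marked_cat W L1 L2 a (F : seq T -> W) :
  marked L1 a F + marked L2 a F = marked (L1 ++ L2) a F.
Proof. by rewrite /marked big_cat. Qed.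

Lemma marked_ev W s a (F : seq T -> W) :
  ev s (fun w => F (a :: w)) = marked [seq (x.1, ([::], x.2)) | x <- s] a F.
Proof. by rewrite /marked big_map. Qed.

Lemma shuf_markedl u1 u2 v : exists L, forall W a (F : seq T -> W),
  ev (shuf K (u1 ++ a :: u2) v) F = marked L a F.
Proof.
elim: u1 v => [|c u1 IHu] v; elim: v => [|b v [L2 IHv]].
- exists [:: (1, ([::], u2))] => W a F.
  by rewrite ev_shuf0r /marked big_seq1 scale1r.
- exists ([seq (x.1, ([::], x.2)) | x <- shuf K u2 (b :: v)] ++
    [seq ((-1) ^+ (size u2).+1 * x.1, x.2) |
       x <- [seq (x.1, (b :: x.2.1, x.2.2)) | x <- L2]]) => W a F.
  by rewrite ev_shuf_cons -[X in _ + _ *: X]/(ev (shuf K ([::] ++ a :: u2) v) _) IHv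
    -marked_cat -marked_scale -marked_cons -marked_ev.
- exists [:: (1, (c :: u1, u2))] => W a F.
  by rewrite ev_shuf0r /marked big_seq1 scale1r.
- have [L1 IH1] := IHu (b :: v).
  exists ([seq (x.1, (c :: x.2.1, x.2.2)) | x <- L1] ++
    [seq ((-1) ^+ (size u1 + size u2).+2 * x.1, x.2) |
       x <- [seq (x.1, (b :: x.2.1, x.2.2)) | x <- L2]]) => W a F.
  rewrite ev_shuf_cons size_cat /= addnS -cat_cons IHv IH1.
  by rewrite -marked_cat -marked_scale -!marked_cons.
Qed.

Lemma shuf_markedr u v1 v2 : exists L, forall W a (F : seq T -> W),
  ev (shuf K u (v1 ++ a :: v2)) F = marked L a F.
Proof.
elim: u v1 v2 => [|c u IHu] v1 v2.
  exists [:: (1, (v1, v2))] => W a F.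
  by rewrite ev_shuf0l /marked big_seq1 scale1r.
elim: v1 => [|b v1 [L2 IHv]].
- have [L1 IH1] := IHu [::] v2.
  exists ([seq (x.1, (c :: x.2.1, x.2.2)) | x <- L1] ++
    [seq ((-1) ^+ (size u).+1 * x.1, x.2) |
       x <- [seq (x.1, ([::], x.2)) | x <- shuf K (c :: u) v2]]) => W a F.
  rewrite ev_shuf_cons -[a :: v2]cat0s IH1.
  by rewrite -marked_cat -marked_scale -marked_cons -marked_ev.
- have [L1 IH1] := IHu (b :: v1) v2.
  exists ([seq (x.1, (c :: x.2.1, x.2.2)) | x <- L1] ++
    [seq ((-1) ^+ (size u).+1 * x.1, x.2) |
       x <- [seq (x.1, (b :: x.2.1, x.2.2)) | x <- L2]]) => W a F.
  rewrite ev_shuf_cons -cat_cons IHv IH1.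
  by rewrite -marked_cat -marked_scale -!marked_cons.
Qed.

End MarkedLetter.

Section Multilinear.
Variables (K : fieldType) (A : comPzAlgType K).
Implicit Types (W : lmodType K).

(** Multilinear in the letters of words of each length. *)
Definition multilinear W (F : seq A -> W) : Prop :=
  forall u v, linear (fun a => F (u ++ a :: v)).

Lemma multilinear_cons W (F : seq A -> W) a :
  multilinear F -> multilinear (fun w => F (a :: w)).
Proof. by move=> Fm u v; apply: (Fm (a :: u)). Qed.

Lemma multilinear_turn W (F : seq A -> W) k :
  multilinear F -> multilinear (fun w => F (turn k w)).
Proof.
elim: k F => [//|k IH] F Fm.
suff Fm1 : multilinear (fun w => F (rot 1 w)) by exact: (IH _ Fm1).
case=> [|c u] v k1 a a'; rewrite !rot1_cons -!cats1; first exact: (Fm v [::]).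
by rewrite -!catA; exact: (Fm u (v ++ [:: c])).
Qed.

Lemma multilinear_merge0 W (F : seq A -> W) :
  multilinear F -> multilinear (fun w => F (merge0 w)).
Proof.
move=> Fm; case=> [|c [|d u]] v k a a' /=; last exact: (Fm (c * d :: u)).
- case: v => [|b v]; first exact: (Fm [::] [::]).
  by rewrite mulrDl -pz_scalerAl (Fm [::] v).
- by rewrite mulrDr -pz_scalerAr (Fm [::] v).
Qed.

Lemma marked_linear W (L : seq (K * (seq A * seq A))) (F : seq A -> W) :
  multilinear F -> linear (fun a => marked L a F).
Proof.
move=> Fm k a a'; rewrite /marked scaler_sumr -big_split; apply: eq_bigr => x _ /=.
by rewrite Fm scalerDr !scalerA mulrC.
Qed.

Lemma multilinear_shufl W v (F : seq A -> W) :
  multilinear F -> multilinear (fun u => ev (shuf K u v) F).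
Proof.
move=> Fm u1 u2 k a a'; have [L LE] := shuf_markedl K u1 u2 v.
by rewrite !LE marked_linear.
Qed.

Lemma multilinear_shufr W u (F : seq A -> W) :
  multilinear F -> multilinear (fun v => ev (shuf K u v) F).
Proof.
move=> Fm v1 v2 k a a'; have [L LE] := shuf_markedr K u v1 v2.
by rewrite !LE marked_linear.
Qed.

Lemma multilinear_sprodl W v (F : seq A -> W) :
  multilinear F -> multilinear (fun u => ev (sprod u v) F).
Proof.
move=> Fm; case: v => [|b v] u1 u2 k a a'.
  have sprod0 u : ev (sprod u [::]) F = 0 by case: u => [|? ?]; rewrite ev_nil.
  by rewrite !sprod0 scaler0 addr0.
case: u1 => [|c u1] /=; rewrite !ev_sprod; last first.
  exact/multilinear_shufl/multilinear_cons.
by rewrite -ev_lin_fun; apply: eq_ev => w; rewrite mulrDl -pz_scalerAl (Fm [::]).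
Qed.

Lemma multilinear_sprodr W u (F : seq A -> W) :
  multilinear F -> multilinear (fun v => ev (sprod u v) F).
Proof.
move=> Fm; case: u => [|b u] v1 v2 k a a'; first by rewrite !ev_nil scaler0 addr0.
case: v1 => [|c v1] /=; rewrite !ev_sprod; last first.
  exact/multilinear_shufr/multilinear_cons.
by rewrite -ev_lin_fun; apply: eq_ev => w; rewrite mulrDr -pz_scalerAr (Fm [::]).
Qed.

Lemma shuf_vanishl W u1 u2 v a (F : seq A -> W) :
  (forall w1 w2, F (w1 ++ a :: w2) = 0) -> ev (shuf K (u1 ++ a :: u2) v) F = 0.
Proof.
move=> F0; have [L ->] := shuf_markedl K u1 u2 v.
by apply: big1 => x _; rewrite F0 scaler0.
Qed.

Lemma shuf_vanishr W u v1 v2 a (F : seq A -> W) :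
  (forall w1 w2, F (w1 ++ a :: w2) = 0) -> ev (shuf K u (v1 ++ a :: v2)) F = 0.
Proof.
move=> F0; have [L ->] := shuf_markedr K u v1 v2.
by apply: big1 => x _; rewrite F0 scaler0.
Qed.

End Multilinear.

(** * Measurings on words *)

Section Measuring.
Variables (K : fieldType) (C : coalgebra K) (A A' : comPzAlgType K).
Variable Phi : C -> A -> A'.
Implicit Types (W : lmodType K) (x : C).

(** The value at F of (x_(1)(a_0), ..., x_(n+1)(a_n)). The empty word is given the
    value of the counit, which makes the recursion on letters and the rule for
    concatenations [wmap_cat] uniform. *)
Fixpoint wmap W (w : seq A) x (F : seq A' -> W) : W :=
  if w is a :: w' then
    tlift (fun y z => wmap w' z (fun w1 => F (Phi y a :: w1))) (comul C x)
  else counit C x *: F [::].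

Lemma wmap_lin_fun W w x k (F G : seq A' -> W) :
  wmap w x (fun w1 => k *: F w1 + G w1) = k *: wmap w x F + wmap w x G.
Proof.
elim: w x F G => [|a w IH] x F G /=; first by rewrite scalerDr !scalerA mulrC.
by rewrite -tlift_lin_fun; apply: eq_tlift => y z; rewrite IH.
Qed.

Lemma wmap_lin_param W W' w x (G : W' -> seq A' -> W) :
  (forall w1, linear (fun t => G t w1)) -> linear (fun t => wmap w x (G t)).
Proof.
by move=> Gl k t t'; rewrite -wmap_lin_fun; congr wmap; apply/funext=> w1; rewrite Gl.
Qed.

Lemma wmap_comp W W' (G : W -> W') w x (F : seq A' -> W) : linear G ->
  G (wmap w x F) = wmap w x (fun w1 => G (F w1)).
Proof.
move=> Gl; elim: w x F => [|a w IH] x F /=; first exact: linZ.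
by rewrite (tlift_comp _ _ Gl); apply: eq_tlift => y z; rewrite IH.
Qed.

Lemma eq_wmap W w x (F G : seq A' -> W) :
  (forall w1, size w1 = size w -> F w1 = G w1) -> wmap w x F = wmap w x G.
Proof.
elim: w x F G => [|a w IH] x F G FG /=; first by rewrite FG.
by apply: eq_tlift => y z; apply: IH => w1 w1E; apply: FG; rewrite /= w1E.
Qed.

Lemma wmapD W w x (F G : seq A' -> W) :
  wmap w x (fun w1 => F w1 + G w1) = wmap w x F + wmap w x G.
Proof.
rewrite -[wmap w x F]scale1r -wmap_lin_fun; apply: eq_wmap => w1 _.
by rewrite scale1r.
Qed.

Lemma wmap0 W w x : wmap w x (fun => 0 : W) = 0.
Proof.
have := wmap_lin_fun w x (-1) (fun => 0 : W) (fun => 0).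
by rewrite scaler0 addr0 scaleN1r addNr.
Qed.

Lemma wmapZ W w x k (F : seq A' -> W) :
  wmap w x (fun w1 => k *: F w1) = k *: wmap w x F.
Proof. by rewrite (wmap_comp _ _ _ (linZ_fun k)). Qed.

Lemma wmap_tlift (U V : lmodType K) W w x (F : U -> V -> seq A' -> W) t :
  wmap w x (fun w1 => tlift (fun y z => F y z w1) t) =
  tlift (fun y z => wmap w x (F y z)) t.
Proof.
elim: w x F => [|a w IH] x F /=; first exact: (tlift_comp _ _ (linZ_fun _)).
rewrite exchange_tlift; apply: eq_tlift => y z; exact: IH.
Qed.

Lemma exchange_wmap W u v x y (F : seq A' -> seq A' -> W) :
  wmap u x (fun u1 => wmap v y (F u1)) = wmap v y (fun v1 => wmap u x (fun u1 => F u1 v1)).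
Proof.
elim: u x F => [|a u IH] x F /=; first by rewrite wmapZ.
by rewrite wmap_tlift; apply: eq_tlift => z t; rewrite IH.
Qed.

Hypothesis Phi_meas : measuring Phi.

Let Phi_lin x : linear (Phi x). Proof. by have [[]] := Phi_meas. Qed.
Let Phi_linl a : linear (Phi^~ a). Proof. by have [[]] := Phi_meas. Qed.
Let PhiM x a b :
  Phi x (a * b) = tlift (fun y z => Phi y a * Phi z b) (comul C x).
Proof. by have [[]] := Phi_meas. Qed.
Let Phi1 x : Phi x 1 = counit C x *: (1 : A').
Proof. by have [] := Phi_meas. Qed.

Lemma linear_head W (F : seq A' -> W) a w1 : multilinear F ->
  linear (fun y => F (Phi y a :: w1)).
Proof. by move=> Fm k y y'; rewrite Phi_linl (Fm [::]). Qed.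

Lemma wmap_linear W w (F : seq A' -> W) : multilinear F -> linear (fun x => wmap w x F).
Proof.
elim: w F => [|a w IH] F Fm /=; first by move=> k x y; rewrite linearP scalerDl -scalerA.
move=> k x y; rewrite linearP; apply: tlift_linear; split=> [z|z].
  by apply/IH/multilinear_cons.
by apply: wmap_lin_param => w1; apply: linear_head.
Qed.

Lemma multilinear_wmap W w x (F : seq A' -> seq A' -> W) :
  (forall w1, multilinear (fun w => F w w1)) -> multilinear (fun w2 => wmap w x (F w2)).
Proof. by move=> Fm u v; apply: wmap_lin_param => w1; apply: Fm. Qed.

(** By coassociativity, the letters of u use x_(1) and those of v use x_(2). *)
Lemma wmap_cat W u v x (F : seq A' -> W) : multilinear F ->
  wmap (u ++ v) x F =
  tlift (fun y z => wmap u y (fun u1 => wmap v z (fun v1 => F (u1 ++ v1)))) (comul C x).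
Proof.
elim: u x F => [|a u IH] x F Fm /=.
  by rewrite -[LHS](comul_counitl x (wmap_linear v Fm)).
rewrite (@comul_assoc _ _ _ (fun y1 y2 z =>
  wmap u y2 (fun u1 => wmap v z (fun v1 => F (Phi y1 a :: u1 ++ v1))))).
  by apply: eq_tlift => y z; rewrite (IH _ _ (multilinear_cons _ Fm)).
apply: trilinP => [y2 z|y1 z|y1 y2].
- by do 2! apply: wmap_lin_param => ?; apply: linear_head.
- apply: wmap_linear; apply: multilinear_wmap => v1 s t k b b'; rewrite -!catA.
  exact: (Fm (_ :: s)).
- apply: wmap_lin_param => u1; apply: wmap_linear => s t k b b'.
  by rewrite !catA; exact: (Fm (_ :: _ ++ _)).
Qed.

Lemma wmap_vanish1 W (F : seq A' -> W) : multilinear F ->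
  (forall u v, F (u ++ 1 :: v) = 0) -> forall u v x, wmap (u ++ 1 :: v) x F = 0.
Proof.
move=> Fm F1 u v x; elim: u x F Fm F1 => [|a u IH] x F Fm F1 /=.
  rewrite -[RHS](tlift0 _ (comul C x)); apply: eq_tlift => y z.
  rewrite -[RHS](wmap0 W v z); apply: eq_wmap => w1 _.
  have F0 := F1 [::]; rewrite /= in F0.
  by rewrite Phi1 (linZ (Fm [::] w1)) F0 scaler0.
rewrite -[RHS](tlift0 _ (comul C x)); apply: eq_tlift => y z.
by apply: IH => [|u' v']; [apply: multilinear_cons | apply: (F1 (_ :: _))].
Qed.

Lemma wmap_cons1 W w x (F : seq A' -> W) : multilinear F ->
  wmap (1 :: w) x F = wmap w x (fun w1 => F (1 :: w1)).
Proof.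
move=> Fm; rewrite -[RHS](comul_counitl x (wmap_linear w (multilinear_cons 1 Fm))) /=.
apply: eq_tlift => y z; rewrite -wmapZ; apply: eq_wmap => w1 _.
by rewrite Phi1 (linZ (Fm [::] w1)).
Qed.

(** The two letters a, b use the two halves of the coproduct of the factor that
    their product uses. *)
Lemma wmap_merge0 W a b w x (F : seq A' -> W) : multilinear F ->
  wmap (a * b :: w) x F = wmap (a :: b :: w) x (fun w1 => F (merge0 w1)).
Proof.
move=> Fm /=; rewrite -(@comul_assoc _ _ _ (fun y1 y2 z =>
  wmap w z (fun w1 => F (Phi y1 a * Phi y2 b :: w1)))); last first.
  apply: trilinP => [y2 z|y1 z|y1 y2].
  - apply: wmap_lin_param => w1 k y y'.
    by rewrite Phi_linl mulrDl -pz_scalerAl (Fm [::]).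
  - apply: wmap_lin_param => w1 k y y'.
    by rewrite Phi_linl mulrDr -pz_scalerAr (Fm [::]).
  - exact/wmap_linear/multilinear_cons.
apply: eq_tlift => y z; rewrite PhiM.
by rewrite (@tlift_comp _ _ _ _ _ (fun r => wmap w z (fun w1 => F (r :: w1)))) //;
  apply: wmap_lin_param => w1; apply: (Fm [::]).
Qed.

Hypothesis C_cocomm : cocommutative C.

(** Cocommutativity lets u and v trade the factors x_(1) and x_(2). *)
Lemma wmap_catC W u v x (F : seq A' -> W) : multilinear F ->
  wmap (u ++ v) x F = wmap (v ++ u) x (fun w => F (turn (size v) w)).
Proof.
move=> Fm; rewrite !wmap_cat //; last exact: multilinear_turn.
rewrite comul_comm //; last first.
  split=> [y|z].
    apply: wmap_lin_param => u1; apply: wmap_linear => s t k b b'.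
    by rewrite !catA; exact: (Fm (_ ++ _)).
  by apply: wmap_linear; apply: multilinear_wmap => v1 s t k b b'; rewrite -!catA; exact: Fm.
apply: eq_tlift => y z; rewrite exchange_wmap.
by apply: eq_wmap => v1 v1E; apply: eq_wmap => u1 _; rewrite -v1E turn_cat.
Qed.

Lemma wmap_turn W k w x (F : seq A' -> W) : multilinear F ->
  wmap (turn k w) x F = wmap w x (fun w1 => F (turn k w1)).
Proof.
elim: k w F => [//|k IH] w F Fm.
rewrite -add1n turnD.
transitivity (wmap (turn k w) x (fun w1 => F (turn 1 w1))).
  case: (turn k w) => [//|c t]; rewrite [turn 1 _]rot1_cons -cats1.
  by rewrite wmap_catC.
rewrite IH; last exact: multilinear_turn.
by apply: eq_wmap => w1 _; rewrite -turnD.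
Qed.

Lemma wmap_sum W (I : Type) (r : seq I) w x (F : I -> seq A' -> W) :
  wmap w x (fun w1 => \sum_(i <- r) F i w1) = \sum_(i <- r) wmap w x (F i).
Proof.
elim: r => [|i r IH].
  by rewrite big_nil -[RHS](wmap0 W w x); apply: eq_wmap => w1 _; rewrite big_nil.
by rewrite big_cons -IH -wmapD; apply: eq_wmap => w1 _; rewrite big_cons.
Qed.

Lemma wmap_rots W w x (F : seq A' -> W) : multilinear F ->
  ev (rots K w) (fun w1 => wmap w1 x F) = wmap w x (fun w1 => ev (rots K w1) F).
Proof.
move=> Fm; transitivity (wmap w x (fun w1 =>
  \sum_(i < size w) (-1) ^+ ((size w).-1 * i) *: F (turn i w1))).
  rewrite wmap_sum ev_rots; apply: eq_bigr => i _.
  by rewrite wmapZ wmap_turn.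
by apply: eq_wmap => w1 w1E; rewrite ev_rots w1E.
Qed.

Lemma wmap_connesw W w x (F : seq A' -> W) : multilinear F ->
  ev (connesw w) (fun w1 => wmap w1 x F) = wmap w x (fun w1 => ev (connesw w1) F).
Proof.
move=> Fm; rewrite ev_connesw; under eq_ev do rewrite wmap_cons1 //.
rewrite wmap_rots; last exact: multilinear_cons.
by apply: eq_wmap => w1 _; rewrite ev_connesw.
Qed.

(** All faces are composed of rotations and of the first face. *)
Lemma wmap_hochw W w x (F : seq A' -> W) : multilinear F ->
  ev (hochw w) (fun w1 => wmap w1 x F) = wmap w x (fun w1 => ev (hochw w1) F).
Proof.
move=> Fm; have [w1|w1] := ltnP 1 (size w); last first.
  have hochw0 (B : comPzAlgType K) (G : seq B -> W) v : (size v <= 1)%N -> ev (hochw v) G = 0.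
    by case: v => [|a [|b v]] //= _; rewrite ev_nil.
  rewrite hochw0 // -[LHS](wmap0 W w x); apply: eq_wmap => v vE.
  by rewrite hochw0 // vE.
transitivity (wmap w x (fun v => \sum_(i < size w) (-1) ^+ i *:
    F (turn ((size w).-1 - i) (merge0 (turn i v))))); last first.
  by apply: eq_wmap => v vE; rewrite ev_hochw vE.
rewrite wmap_sum ev_hochw //; apply: eq_bigr => i _.
rewrite wmapZ wmap_turn //; congr (_ *: _).
have Fm1 : multilinear (fun v => F (turn ((size w).-1 - i) v)) by apply: multilinear_turn.
rewrite -(wmap_turn i w x (multilinear_merge0 Fm1)).
have : (1 < size (turn i w))%N by rewrite size_turn.
case: (turn i w) => [//|a [//|b v]] _; exact: wmap_merge0.
Qed.

(** By induction on words: the first letter of a shuffle uses x_(1). If it comes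
    from u, this agrees with the right-hand side up to coassociativity; if it comes from
    v, it has to pass the factor used by u, which is where cocommutativity enters. *)
Lemma wmap_shuf W u v x (F : seq A' -> W) : multilinear F ->
  ev (shuf K u v) (fun w => wmap w x F) =
  tlift (fun y z => wmap u y (fun u1 => wmap v z (fun v1 => ev (shuf K u1 v1) F)))
    (comul C x).
Proof.
elim: u v x F => [|a u IHu] v x F Fm.
  rewrite ev_shuf0l -[LHS](comul_counitl x (wmap_linear v Fm)).
  apply: eq_tlift => y z /=; congr (_ *: _).
  by apply: eq_wmap => v1 _; rewrite ev_shuf0l.
elim: v x F Fm => [|b v IHv] x F Fm.
  rewrite ev_shuf0r -[LHS](comul_counitr x (wmap_linear _ Fm)).
  apply: eq_tlift => y z; rewrite -wmapZ.
  by apply: eq_wmap => u1 _; rewrite /= ev_shuf0r.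
(* The shuffles beginning with the first letter of u1, resp. of v1; stated with
   [head] and [behead] so as to be defined on all words. *)
pose G1 u1 v1 := ev (shuf K (behead u1) v1) (fun w => F (head 0 u1 :: w)).
pose G2 u1 v1 := ev (shuf K u1 (behead v1)) (fun w => F (head 0 v1 :: w)).
transitivity (tlift (fun y z => wmap (a :: u) y (fun u1 => wmap (b :: v) z (G1 u1)))
    (comul C x) + (-1) ^+ (size u).+1 *:
  tlift (fun y z => wmap (a :: u) y (fun u1 => wmap (b :: v) z (G2 u1))) (comul C x));
  last first.
  rewrite addrC -tlift_lin_fun; apply: eq_tlift => y z.
  rewrite -wmap_lin_fun; apply: eq_wmap => u1 u1E.
  rewrite -wmap_lin_fun; apply: eq_wmap => v1 v1E.
  by case: u1 v1 u1E v1E => [//|a1 u1] [//|b1 v1] [u1E] _; rewrite ev_shuf_cons u1E addrC.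
rewrite ev_shuf_cons; congr (_ + _ *: _).
  pose f y1 y2 z := wmap u y2 (fun u1 => wmap (b :: v) z (fun v1 =>
    ev (shuf K u1 v1) (fun w => F (Phi y1 a :: w)))).
  transitivity (tlift (fun y z => tlift (fun y1 y2 => f y1 y2 z) (comul C y)) (comul C x));
    last by [].
  rewrite comul_assoc; last first.
    apply: trilinP => [y2 z|y1 z|y1 y2].
    - do 2! [apply: wmap_lin_param => ?]; apply: ev_lin_param => w.
      exact: linear_head.
    - apply/wmap_linear/multilinear_wmap => v1.
      exact/multilinear_shufl/multilinear_cons.
    - apply: wmap_lin_param => u1; apply: (wmap_linear (b :: v)).
      exact/multilinear_shufr/multilinear_cons.
  rewrite [in LHS]/= ev_tlift; apply: eq_tlift => y z.
  by rewrite (IHu _ _ _ (multilinear_cons _ Fm)).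
transitivity (tlift (fun y z => tlift (fun z1 z2 => wmap (a :: u) z1 (fun u1 => wmap v z2
  (fun v1 => ev (shuf K u1 v1) (fun w => F (Phi y b :: w))))) (comul C z)) (comul C x)).
  rewrite [in LHS]/= ev_tlift; apply: eq_tlift => y z.
  by rewrite (IHv _ _ (multilinear_cons _ Fm)).
rewrite comul_swap12 //; last first.
  apply: trilinP => [y2 z|y1 z|y1 y2].
  - do 2! [apply: wmap_lin_param => ?]; apply: ev_lin_param => w.
    exact: linear_head.
  - apply: (wmap_linear (a :: u)); apply: multilinear_wmap => v1.
    exact/multilinear_shufl/multilinear_cons.
  - apply: (@wmap_lin_param _ _ (a :: u)) => u1; apply: wmap_linear.
    exact/multilinear_shufr/multilinear_cons.
apply: eq_tlift => y z; rewrite -wmap_tlift; apply: eq_wmap => u1 _.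
by [].
Qed.

(** The product of the two first letters a, b splits one factor in two, so that the
    left-hand side uses the factors in the order a, b, u, v and the right-hand side in
    the order a, u, b, v. *)
Lemma wmap_sprod W a u b v x (F : seq A' -> W) : multilinear F ->
  ev (sprod (a :: u) (b :: v)) (fun w => wmap w x F) =
  tlift (fun y z => wmap (a :: u) y (fun u1 => wmap (b :: v) z (fun v1 =>
    ev (sprod u1 v1) F))) (comul C x).
Proof.
move=> Fm.
pose f y1 y2 z1 z2 := wmap u z1 (fun u1 => wmap v z2 (fun v1 =>
  ev (shuf K u1 v1) (fun w => F (Phi y1 a * Phi y2 b :: w)))).
pose g y1 y2 z := wmap u y2 (fun u1 => wmap (b :: v) z (fun v1 =>
  ev (sprod (Phi y1 a :: u1) v1) F)).
have gE y1 y2 z : g y1 y2 z = tlift (fun z1 z2 => f y1 z1 y2 z2) (comul C z).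
  rewrite /f /g -wmap_tlift; apply: eq_wmap => u1 _; apply: eq_tlift => z1 z2.
  by apply: eq_wmap => v1 _; rewrite ev_sprod.
have f_trilin y : trilin (fun z1 y2 z2 => f y y2 z1 z2).
  apply: trilinP => [y2 z|y1 z|y1 y2].
  - apply/wmap_linear/multilinear_wmap => v1.
    exact/multilinear_shufl/multilinear_cons.
  - do 2! [apply: wmap_lin_param => ?]; apply: ev_lin_param => w k t t'.
    by rewrite Phi_linl mulrDr -pz_scalerAr (Fm [::]).
  - apply: wmap_lin_param => u1; apply: wmap_linear.
    exact/multilinear_shufr/multilinear_cons.
transitivity (tlift (fun y z => tlift (fun y2 z2 => tlift (f y y2) (comul C z2)) (comul C z))
  (comul C x)).
  rewrite ev_sprod; under eq_ev do rewrite wmap_merge0 //.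
  rewrite [in LHS]/= ev_tlift; apply: eq_tlift => y z.
  rewrite ev_tlift; apply: eq_tlift => y2 z2.
  by rewrite (wmap_shuf _ _ _ (multilinear_cons _ Fm)).
transitivity (tlift (fun y z => tlift (fun y1 y2 => g y1 y2 z) (comul C y)) (comul C x));
  last by [].
rewrite comul_assoc; last first.
  apply: trilinP => [y2 z|y1 z|y1 y2].
  - do 2! [apply: wmap_lin_param => ?]; move=> k t t'.
    by rewrite Phi_linl (multilinear_sprodl _ Fm [::]).
  - apply/wmap_linear/multilinear_wmap => v1.
    exact: (multilinear_cons _ (multilinear_sprodl v1 Fm)).
  - apply: wmap_lin_param => u1; apply: (wmap_linear (b :: v)).
    exact: multilinear_sprodr.
apply: eq_tlift => y z; rewrite [RHS](eq_tlift _ (gE y)).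
exact: (esym (comul_swap12 C_cocomm z (f_trilin y))).
Qed.

(** The last letter needs no coproduct; here the counit axiom is used. *)
Lemma wmap_sweedler W a w x (F : seq A' -> W) : multilinear F ->
  wmap (a :: w) x F =
  sweedler (size w) (fun c => F [seq Phi p.1 p.2 | p <- zip c (a :: w)]) x.
Proof.
elim: w a x F => [|b w IH] a x F Fm.
  exact: (comul_counitr x (linear_head a [::] Fm)).
rewrite [LHS]/=; apply: eq_tlift => y z.
exact: (IH b z _ (multilinear_cons (Phi y a) Fm)).
Qed.

End Measuring.

(** * Normalized chains as classes of words *)

Section ChainWords.
Variables (K : fieldType) (A : comPzAlgType K).
Implicit Types (W : lmodType K) (u v w : seq A).

(** The forms on words that factor through A tensored with powers of A/K. *)
Definition normalized W (F : seq A -> W) : Prop :=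
  multilinear F /\ forall c u v, F (c :: u ++ 1 :: v) = 0.

(** The chain of a word; words of the wrong length are sent to 0, which makes [chw n]
    multilinear without a condition on lengths. *)
Definition chw n w : chain A n := if size w == n.+1 then ch n (nth 0 w) else 0.

Lemma chwE n w : size w = n.+1 -> chw n w = ch n (nth 0 w).
Proof. by rewrite /chw => ->; rewrite eqxx. Qed.

Lemma chw_mkseq n (s : nat -> A) : chw n (mkseq s n.+1) = ch n s.
Proof.
rewrite chwE ?size_mkseq //; apply: (nform_ext (ch_nform A n)) => j jn.
by rewrite nth_mkseq.
Qed.

Lemma nth_cat_mid u (a : A) v j : nth 0 (u ++ a :: v) j = supd (nth 0 (u ++ 0 :: v)) (size u) a j.
Proof.
rewrite /supd !nth_cat; case: eqP => [->|/eqP ju]; first by rewrite ltnn subnn.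
case: ltnP => // uj; case: (_ - _)%N (subn_gt0 (size u) j) => //.
by move=> /esym/negbT; rewrite -leqNgt => h; case/negP: ju; rewrite eqn_leq h uj.
Qed.

Lemma chw_normalized n : normalized (chw n).
Proof.
have [ce cl c1] := ch_nform A n; split=> [u v k a a'|c u v].
  rewrite /chw !size_cat /=; case: eqP => [szE|]; last by rewrite scaler0 addr0.
  have E b : ch n (nth 0 (u ++ b :: v)) = ch n (supd (nth 0 (u ++ 0 :: v)) (size u) b).
    by apply: ce => j _; rewrite nth_cat_mid.
  by rewrite !E cl // -ltnS -szE addnS ltnS leq_addr.
rewrite /chw /= size_cat /=; case: eqP => // szE; apply: (c1 (size u).+1).
  by case: szE => <-; rewrite addnS /= ltnS leq_addr.
by rewrite /= nth_cat ltnn subnn.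
Qed.

Lemma chw_mlin n : multilinear (chw n). Proof. by case: (chw_normalized n). Qed.

Lemma normalized_nform W n (F : seq A -> W) :
  normalized F -> normalized_form n (fun s => F (mkseq s n.+1)).
Proof.
move=> [Fm F1].
have mkE (s : nat -> A) i : (i <= n)%N ->
    mkseq s n.+1 = mkseq s i ++ s i :: mkseq (fun j => s (i.+1 + j)%N) (n - i).
  move=> i_n; rewrite /mkseq -{1}(subnKC (leqW i_n)) iotaD map_cat subSn //=.
  by rewrite -[in LHS](addn0 i.+1) iotaDl -map_comp.
have mk_ext m s t : (forall j, (j < m)%N -> s j = t j :> A) -> mkseq s m = mkseq t m.
  move=> st; apply/eq_in_map=> j; rewrite mem_iota; exact: st.
split=> [s t st|i s k a a' i_n|i s /andP[i0 i_n] si].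
- by rewrite (mk_ext _ s t) // => j jn; apply: st.
- have supdE b : mkseq (supd s i b) n.+1 =
      mkseq s i ++ b :: mkseq (fun j => s (i.+1 + j)%N) (n - i).
    rewrite (mkE _ i i_n) {2}/supd eqxx; congr (_ ++ _ :: _); apply: mk_ext => j ji.
      by rewrite /supd ltn_eqF.
    by rewrite /supd gtn_eqF //; lia.
  by rewrite !supdE Fm.
- by rewrite (mkE _ i i_n) si; case: i i0 {i_n si} => [//|i] _; rewrite /mkseq /= F1.
Qed.

Definition wlift W n (F : seq A -> W) (z : chain A n) : W :=
  clift (fun s => F (mkseq s n.+1)) z.

Lemma wlift_linear W n (F : seq A -> W) : normalized F -> linear (wlift F : chain A n -> W).
Proof. by move=> Fn; apply/clift_linear/normalized_nform. Qed.

Lemma wlift_chw W n (F : seq A -> W) w : normalized F -> size w = n.+1 ->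
  wlift F (chw n w) = F w.
Proof.
move=> Fn wn; rewrite chwE // /wlift cliftE; last exact: normalized_nform.
by rewrite -wn mkseq_nth.
Qed.

Lemma wlift_lin_fun W n (F G : seq A -> W) k (z : chain A n) :
  wlift (fun w => k *: F w + G w) z = k *: wlift F z + wlift G z.
Proof. exact: plift_lin_fun. Qed.

Lemma wlift_lin_param W W' n (z : chain A n) (G : W' -> seq A -> W) :
  (forall w, linear (fun t => G t w)) -> linear (fun t => wlift (G t) z).
Proof.
by move=> Gl k t t'; rewrite -wlift_lin_fun; congr wlift; apply/funext=> w; rewrite Gl.
Qed.

Lemma wlift0 W n (z : chain A n) : wlift (fun => 0 : W) z = 0.
Proof.
have := wlift_lin_fun (fun => 0 : W) (fun => 0) (-1) z.
by rewrite scaler0 addr0 scaleN1r addNr.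
Qed.

Lemma eq_chain_linear W n (f g : chain A n -> W) : linear f -> linear g ->
  (forall w, size w = n.+1 -> f (chw n w) = g (chw n w)) -> f =1 g.
Proof.
move=> fl gl fg; apply: eq_pres_linear => // -[a u].
suff -> : pgen (@chain_rel K A n) (a, u) = ch n (crep (a, u)).
  by rewrite -chw_mkseq fg // size_mkseq.
rewrite /ch /=; congr (pgen _ (_, _)); apply/ffunP=> i; rewrite ffunE insubT //= => i_n.
by rewrite projK; congr (u _); apply: val_inj.
Qed.

Lemma hoch_chw n w : hoch (chw n.+1 w) = ev (hochw w) (chw n).
Proof.
have [wn|wn] := eqVneq (size w) n.+2; last first.
  rewrite /chw (negPf wn) linear0 -[LHS](ev0 (chain A n) (hochw w)).
  apply: (eq_ev_homog (homog_hochw w)) => w1 w1E; rewrite w1E.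
  by rewrite ifN //; apply: contraNneq wn; case: (size w) => //= m ->.
rewrite chwE // /hoch cliftE; last exact: hoch_nform.
rewrite ev_cat ev_scl ev_bar_take wn; congr (_ + _ *: _).
  apply: eq_bigr => i _; congr (_ *: _); have i_n := ltn_ord i.
  have szi : size (take i w) = i by rewrite size_take_min wn; lia.
  have := size_drop i w; rewrite wn.
  have nthD j : nth 0 (drop i w) j = nth 0 w (i + j) by rewrite nth_drop.
  case: (drop i w) nthD => [|a [|b v]] nthD szD; [by simpl in szD; lia..|].
  rewrite chwE; last by move: szD; rewrite size_cat szi /=; lia.
  apply: (nform_ext (ch_nform A n)) => j jn; rewrite /face nth_cat szi.
  case: ltnP => ji; first by rewrite nth_take.
  case: eqP => [->|/eqP j_i].
    by have := nthD 0%N; have := nthD 1%N; rewrite addn0 addn1 subnn /= => <- <-.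
  have -> : (j - i = (j - i).-1.+1)%N by lia.
  rewrite /= -[nth 0 v _]/(nth 0 [:: a, b & v] (j - i).-1.+2) nthD; congr nth; lia.
case: w wn => [//|c w]; case/lastP: w => [//|w z]; rewrite /= size_rcons => -[wn].
rewrite ev_wrap_rcons chwE /= ?wn //; apply: (nform_ext (ch_nform A n)) => -[|j] jn /=.
  by rewrite nth_rcons wn ltnn eqxx.
by rewrite nth_rcons wn jn.
Qed.

Lemma connes_chw n w : connes (chw n w) = ev (connesw w) (chw n.+1).
Proof.
have [wn|wn] := eqVneq (size w) n.+1; last first.
  rewrite /chw (negPf wn) linear0 -[LHS](ev0 (chain A n.+1) (connesw w)).
  by apply: (eq_ev_homog (homog_connesw w)) => w1 w1E; rewrite w1E eqSS (negPf wn).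
rewrite chwE // /connes cliftE; last exact: connes_nform.
rewrite ev_connesw ev_rots wn; apply: eq_bigr => i _; congr (_ *: _).
have i_n := ltn_ord i.
rewrite chwE /= ?size_turn ?wn //; apply: (nform_ext (ch_nform A n.+1)) => -[|j] //= jn.
rewrite turnE ?wn 1?ltnW // /rot nth_cat size_drop wn nth_drop.
case: ltnP => h; first by rewrite modn_small //; lia.
rewrite nth_take; last by lia.
by congr nth; rewrite -(subnK (_ : n.+1 <= i + j)%N) ?modnDr ?modn_small; lia.
Qed.

End ChainWords.

(** * Identities between b, B and the shuffle product on chains *)

Section ShuffleOfChains.
Variables (K : fieldType) (A : comPzAlgType K).
Implicit Types (W : lmodType K).

Lemma sum_is_shuffle p q (s t : nat -> A) :
  \sum_(sigma : 'S_(q + p) | is_shuffle p sigma)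
    (-1) ^+ (odd_perm sigma) *: ch (q + p) (shuffled p sigma s t) =
  ev (sprod (mkseq s p.+1) (mkseq t q.+1)) (@chw K A (q + p)).
Proof.
have mkE (r : nat -> A) n : mkseq r n.+1 = r 0%N :: mkseq (r \o succn) n.
  by rewrite /mkseq /= (iotaDl 1 0) -map_comp.
rewrite !mkE ev_sprod; set u := mkseq _ p; set v := mkseq _ q.
have szu : size u = p by rewrite size_mkseq.
have szuv : size (u ++ v) = (q + p)%N by rewrite size_cat !size_mkseq addnC.
transitivity (ev (shuf K (take p (u ++ v)) (drop p (u ++ v)))
    (fun w => @chw K A (q + p) (s 0%N * t 0%N :: w))); last first.
  by rewrite take_size_cat // drop_size_cat.
rewrite -(@sum_shuffle K A 0 (chain A (q + p)) _ (u ++ v) p _ szuv (leq_addl _ _)).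
apply: eq_bigr => sigma _; congr (_ *: _).
rewrite chwE; last by rewrite /= size_map size_enum_ord.
apply: (nform_ext (ch_nform A (q + p))) => -[|k] //= kn.
rewrite insubT /= (nth_map (Ordinal kn)) ?size_enum_ord //.
have -> : nth (Ordinal kn) (enum 'I_(q + p)) k = Ordinal kn.
  by apply: val_inj; rewrite /= nth_enum_ord.
move: ((sigma^-1)%g (Ordinal kn)) => i; rewrite /juxtaposed nth_cat szu.
case: ltnP => ip; first by rewrite nth_mkseq.
by rewrite nth_mkseq //; have := ltn_ord i; lia.
Qed.

Lemma shuffleE p q (x : chain A p) (y : chain A q) :
  shuffle x y =
  wlift (fun u => wlift (fun v => ev (sprod u v) (@chw K A (q + p))) y) x.
Proof.
congr clift; apply/funext=> s; congr clift; apply/funext=> t.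
exact: sum_is_shuffle.
Qed.

Lemma sprod_normalizedr W u (F : seq A -> W) :
  normalized F -> normalized (fun v => ev (sprod u v) F).
Proof.
move=> [Fm F1]; split=> [|c v1 v2]; first exact: multilinear_sprodr.
by case: u => [|a u]; rewrite ?ev_nil // ev_sprod shuf_vanishr.
Qed.

Lemma sprod_normalizedl W v (F : seq A -> W) :
  normalized F -> normalized (fun u => ev (sprod u v) F).
Proof.
move=> [Fm F1]; split=> [|c u1 u2]; first exact: multilinear_sprodl.
by case: v => [|b v]; rewrite ?ev_nil // ev_sprod shuf_vanishl.
Qed.

Lemma wlift_normalized W n (y : chain A n) (F : seq A -> seq A -> W) :
  (forall v, normalized (fun u => F u v)) -> normalized (fun u => wlift (F u) y).
Proof.
move=> Fn; split=> [u v|c u v]; first by apply: wlift_lin_param => w; case: (Fn w) => + _.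
rewrite -[RHS](wlift0 W y); congr wlift; apply/funext=> w.
by case: (Fn w) => _ ->.
Qed.

Let shuffle_normalized p q (y : chain A q) :
  normalized (fun u => wlift (fun v => ev (sprod u v) (@chw K A (q + p))) y).
Proof. by apply: wlift_normalized => v; apply/sprod_normalizedl/chw_normalized. Qed.

Lemma shuffle_linearr p q (x : chain A p) : linear (fun y : chain A q => shuffle x y).
Proof.
move=> k y y'; rewrite !shuffleE -wlift_lin_fun; congr wlift; apply/funext=> u.
by rewrite wlift_linear //; apply/sprod_normalizedr/chw_normalized.
Qed.

Lemma shuffle_linearl p q (y : chain A q) : linear (fun x : chain A p => shuffle x y).
Proof. by move=> k x x'; rewrite !shuffleE wlift_linear. Qed.

Lemma shuffle_chw p q u v : size u = p.+1 -> size v = q.+1 ->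
  shuffle (@chw K A p u) (chw q v) = ev (sprod u v) (@chw K A (q + p)).
Proof.
move=> up vq; rewrite shuffleE wlift_chw //.
by rewrite wlift_chw //; apply/sprod_normalizedr/chw_normalized.
Qed.

Lemma shuffle_bilin p q : bilin (@shuffle K A p q).
Proof. by split=> [x|y]; [apply: shuffle_linearr | apply: shuffle_linearl]. Qed.

Lemma eq_chain_bilinear W p q (f g : chain A p -> chain A q -> W) :
  bilin f -> bilin g ->
  (forall u v, size u = p.+1 -> size v = q.+1 -> f (chw p u) (chw q v) = g (chw p u) (chw q v)) ->
  forall x y, f x y = g x y.
Proof.
move=> [fr fl] [gr gl] fg x y; apply: (eq_chain_linear (fl y) (gl y)) => u up.
by apply: eq_chain_linear => // v vq; apply: fg.
Qed.

Let idlin (V : lmodType K) : linear (fun v : V => v). Proof. by []. Qed.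

Lemma linear_hoch n : linear (@hoch K A n). Proof. exact: linearP. Qed.
Lemma linear_connes n : linear (@connes K A n). Proof. exact: linearP. Qed.

Lemma hoch_connes n (z : chain A n.+1) : hoch (connes z) = - connes (hoch z).
Proof.
apply: (eq_chain_linear (f := fun z => hoch (connes z)) (g := fun z => - connes (hoch z))).
- exact: linear_comp (@linear_hoch _) (@linear_connes _).
- apply: (linear_comp (g := fun v => - v) (@linear_opp _ _)).
  exact: linear_comp (@linear_connes _) (@linear_hoch _).
move=> w _; rewrite connes_chw hoch_chw.
rewrite (ev_comp _ _ (@linear_hoch _)) (ev_comp _ _ (@linear_connes _)).
under eq_ev do rewrite hoch_chw.
under [in RHS]eq_ev do rewrite connes_chw.
exact: hochw_connesw.
Qed.

Lemma hoch_connes0 (z : chain A 0) : hoch (connes z) = 0.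
Proof.
apply: (eq_chain_linear (f := fun z : chain A 0 => hoch (connes z)) (g := fun _ => 0)).
- exact: linear_comp (@linear_hoch _) (@linear_connes _).
- by move=> k u v; rewrite scaler0 addr0.
move=> w w1; rewrite connes_chw (ev_comp _ _ (@linear_hoch _)).
under eq_ev do rewrite hoch_chw.
rewrite hochw_connesw (eq_ev_homog (n := 0) (G := fun => 0)); last 2 first.
- by have := homog_hochw w; rewrite w1.
- by move=> v /size0nil->; rewrite ev_nil.
by rewrite ev0 oppr0.
Qed.

(** A rotation of a word beginning with 1 has, after a further 1 is put in front, an
    inner letter 1, and is degenerate. *)
Lemma connes_connes n (z : chain A n) : connes (connes z) = 0.
Proof.
apply: (eq_chain_linear (f := fun z => connes (connes z)) (g := fun _ => 0)).
- exact: linear_comp (@linear_connes _) (@linear_connes _).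
- by move=> k u v; rewrite scaler0 addr0.
move=> w w1; rewrite connes_chw (ev_comp _ _ (@linear_connes _)).
rewrite ev_connesw -[RHS](ev0 _ (rots K w)); apply: eq_ev => v.
rewrite connes_chw ev_connesw ev_rots big1 // => i _; have iv := ltn_ord i.
have [_ c1] := @chw_normalized K A n.+2.
rewrite turnE ?(ltnW iv) // /rot; case: (nat_of_ord i) iv => [|j] jv.
  by rewrite drop0 cats0 (c1 1 [::]) scaler0.
by rewrite /= c1 scaler0.
Qed.

(** B x is a sum of words beginning with 1 over the rotations of x, so the product
    with y only shuffles these rotations into y, and [rots_shuf] applies. *)
Lemma connes_shuffle p q (x : chain A p) (y : chain A q) :
  connes (shuffle (connes x) y) = (-1) ^+ p.+1 *: shuffle (connes x) (connes y).
Proof.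
have sl m n t : linear (fun s : chain A m => shuffle s t : chain A (n + m)).
  exact: shuffle_linearl.
have sr m n s : linear (fun t : chain A n => shuffle s t : chain A (n + m)).
  exact: shuffle_linearr.
move: x y; apply: (eq_chain_bilinear (f := fun x y => connes (shuffle (connes x) y))
  (g := fun x y => (-1) ^+ p.+1 *: (shuffle (connes x) (connes y) : chain A (q.+1 + p.+1)))).
- apply: (bilin_comp (G := @connes K A _) (@linear_connes _)).
  exact: (bilin_precomp (shuffle_bilin p.+1 q) (@linear_connes p) (@idlin _)).
- apply: (bilin_comp (G := fun v => _ *: v) (linZ_fun _)).
  exact: (bilin_precomp (shuffle_bilin p.+1 q.+1) (@linear_connes p) (@linear_connes q)).
move=> u [//|b v] up [vq].
rewrite !connes_chw !ev_connesw.
rewrite !(ev_comp _ _ (sl _ _ _)) (ev_comp _ _ (@linear_connes _)).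
transitivity (ev (rots K u) (fun u' => ev (shuf K u' v) (fun w => ev (rots K (b :: w))
    (fun w' => @chw K A (q + p.+1).+1 (1 :: w'))))).
  apply: (eq_ev_homog (homog_rots _ _)) => u' u'E.
  rewrite shuffle_chw /= ?u'E ?up ?vq // ev_sprod (ev_comp _ _ (@linear_connes _)).
  by apply: eq_ev => w; rewrite mul1r connes_chw ev_connesw.
rewrite rots_shuf up; congr (_ *: _).
apply: (eq_ev_homog (homog_rots _ _)) => u' u'E.
rewrite (ev_comp _ _ (sr _ _ _)).
apply: (eq_ev_homog (homog_rots _ _)) => v' v'E.
rewrite shuffle_chw /= ?u'E ?up ?v'E /= ?vq // ev_sprod.
by apply: eq_ev => w; rewrite mul1r.
Qed.

(** The component of degree N of a homogeneous chain. It replaces transport along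
    equalities of degrees such as q + p.+2 = (q + p.+1).+1, as it is linear and defined
    for all n and N. *)
Definition cto n N (z : chain A n) : chain A N := wlift (@chw K A N) z.

Lemma linear_cto n N : linear (@cto n N).
Proof. exact/wlift_linear/chw_normalized. Qed.

Lemma cto_chw n N w : size w = n.+1 -> cto N (chw n w) = chw N w.
Proof. by move=> wn; rewrite /cto wlift_chw //; apply: chw_normalized. Qed.

Lemma cto_id n (z : chain A n) : cto n z = z.
Proof.
apply: (eq_chain_linear (f := @cto n n) (g := id)) => //; first exact: linear_cto.
by move=> w wn; rewrite cto_chw.
Qed.

Lemma cto_neq n N (z : chain A n) : n != N -> cto N z = 0.
Proof.
move=> nN; apply: (eq_chain_linear (f := @cto n N) (g := fun=> 0)).
- exact: linear_cto.
- by move=> k u v; rewrite scaler0 addr0.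
by move=> w wn; rewrite cto_chw // /chw wn eqSS (negPf nN).
Qed.

Lemma cto_ev n N s : homog n.+1 s ->
  cto N (ev s (@chw K A n)) = ev s (chw N).
Proof.
move=> sn; rewrite (ev_comp _ _ (@linear_cto _ _)).
by apply: (eq_ev_homog sn) => w wn; rewrite cto_chw.
Qed.

(** The differential in all degrees, 0 in degree 0, so that cycles are its kernel. *)
Definition hochz n : chain A n -> chain A n.-1 :=
  match n return chain A n -> chain A n.-1 with
  | 0 => fun _ => 0
  | m.+1 => fun z => hoch z
  end.

Lemma linear_hochz n : linear (@hochz n).
Proof. by case: n => [|n] k u v; rewrite /= ?linearP ?scaler0 ?addr0. Qed.

Lemma cto_hochz_chw n N w : size w = n.+1 ->
  cto N (hochz (chw n w)) = ev (hochw w) (chw N).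
Proof.
case: n => [|n] wn /=.
  rewrite (lin0 (@linear_cto _ _)); case: w wn => [//|a [|//]] _.
  by rewrite ev_nil.
by rewrite hoch_chw cto_ev //; have := homog_hochw w; rewrite wn.
Qed.

(** The terms live in chain groups whose degrees agree only propositionally, so the
    rule is stated after projection to an arbitrary degree N. *)
Lemma hochz_shuffle N p q (x : chain A p) (y : chain A q) :
  cto N (hochz (shuffle x y)) =
  cto N (shuffle (hochz x) y) + (-1) ^+ p *: cto N (shuffle x (hochz y)).
Proof.
have sl m n t : linear (fun s : chain A m => shuffle s t : chain A (n + m)).
  exact: shuffle_linearl.
have sr m n s : linear (fun t : chain A n => shuffle s t : chain A (n + m)).
  exact: shuffle_linearr.
move: x y.
apply: (eq_chain_bilinear (f := fun x y => cto N (hochz (shuffle x y : chain A (q + p))))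
  (g := fun x y => cto N (shuffle (hochz x) y : chain A (q + p.-1)) +
    (-1) ^+ p *: cto N (shuffle x (hochz y) : chain A (q.-1 + p)))).
- apply: (bilin_comp (G := @cto _ N) (@linear_cto _ _)).
  exact: (bilin_comp (G := @hochz _) (@linear_hochz _) (shuffle_bilin p q)).
- apply: bilinD.
    apply: (bilin_comp (G := @cto _ N) (@linear_cto _ _)).
    exact: (bilin_precomp (shuffle_bilin p.-1 q) (@linear_hochz p) (@idlin _)).
  apply: (bilin_comp (G := fun v => _ *: v) (linZ_fun _)).
  apply: (bilin_comp (G := @cto _ N) (@linear_cto _ _)).
  exact: (bilin_precomp (shuffle_bilin p q.-1) (@idlin _) (@linear_hochz q)).
move=> u v up vq.
have -> : cto N (hochz (shuffle (chw p u) (chw q v) : chain A (q + p))) =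
    ev (sprod u v) (fun w => ev (hochw w) (chw N)).
  rewrite shuffle_chw // (ev_comp _ _ (@linear_hochz _)) (ev_comp _ _ (@linear_cto _ _)).
  apply: (eq_ev_homog (homog_sprod u v)) => w wE.
  by rewrite cto_hochz_chw // wE up vq /= addnS addnC.
rewrite hochw_sprod ?up ?vq //=; congr (_ + _ *: _).
  case: p up => [|p] up /=.
    rewrite (lin0 (sl _ _ _)) (lin0 (@linear_cto _ _)).
    by case: u up => [//|a [|//]] _; rewrite !ev_nil.
  rewrite hoch_chw (ev_comp _ _ (sl _ _ _)) (ev_comp _ _ (@linear_cto _ _)).
  apply: (eq_ev_homog (homog_hochw u)) => u' u'E; rewrite up /= in u'E.
  rewrite shuffle_chw // cto_ev //.
  by have := homog_sprod u' v; rewrite u'E vq /= addnS addnC.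
case: q vq => [|q] vq /=.
  rewrite (lin0 (sr _ _ _)) (lin0 (@linear_cto _ _)).
  by case: v vq => [//|a [|//]] _; rewrite !ev_nil.
rewrite hoch_chw (ev_comp _ _ (sr _ _ _)) (ev_comp _ _ (@linear_cto _ _)).
apply: (eq_ev_homog (homog_hochw v)) => v' v'E; rewrite vq /= in v'E.
rewrite shuffle_chw // cto_ev //.
by have := homog_sprod u v'; rewrite v'E up /= addnS addnC.
Qed.

End ShuffleOfChains.

(** * The maps induced by a measuring on chains *)

Lemma nat_ind2 (P : nat -> Prop) :
  P 0%N -> P 1%N -> (forall n, P n -> P n.+2) -> forall n, P n.
Proof.
move=> P0 P1 P2 n; suff [] : P n /\ P n.+1 by [].
by elim: n => // n [IH1 IH2]; split; [|apply: P2].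
Qed.

Section ChainMap.
Variables (K : fieldType) (C : coalgebra K) (A A' : comPzAlgType K).
Variable Phi : C -> A -> A'.
Hypothesis Phi_meas : measuring Phi.
Implicit Types (W : lmodType K) (x : C).

Lemma wmap_normalized W x (F : seq A' -> W) :
  normalized F -> normalized (fun w => wmap Phi w x F).
Proof.
move=> [Fm F1]; split=> [u v|c u v] /=.
  elim: u x F Fm {F1} => [|c u IH] x F Fm /= k a a'.
    rewrite -tlift_lin_fun; apply: eq_tlift => y z.
    rewrite -wmap_lin_fun; apply: eq_wmap => w1 _.
    by have [[Phi_lin _ _] _] := Phi_meas; rewrite Phi_lin (Fm [::]).
  rewrite -tlift_lin_fun; apply: eq_tlift => y z.
  exact/IH/multilinear_cons.
rewrite -[RHS](tlift0 _ (comul C x)); apply: eq_tlift => y z.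
by rewrite (wmap_vanish1 Phi_meas) //; apply: multilinear_cons.
Qed.

Lemma eq_sweedler W n (f g : seq C -> W) x :
  (forall c, size c = n.+1 -> f c = g c) -> sweedler n f x = sweedler n g x.
Proof.
elim: n f g x => [|n IH] f g x fg /=; first exact: fg.
by apply: eq_tlift => y z; apply: IH => c cn; apply: fg; rewrite /= cn.
Qed.

Lemma chain_mapE n x (z : chain A n) :
  chain_map Phi x z = wlift (fun w => wmap Phi w x (@chw K A' n)) z.
Proof.
congr clift; apply/funext=> a; rewrite [mkseq a n.+1]/=.
rewrite (wmap_sweedler Phi_meas) ?size_map ?size_iota; last exact: chw_mlin.
apply: eq_sweedler => c cn; rewrite -[_ :: _]/(mkseq a n.+1).
rewrite chwE; last by rewrite size_map size_zip size_mkseq cn minnn.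
apply: (nform_ext (ch_nform A' n)) => j jn.
rewrite (nth_map (0, 0)) ?size_zip ?size_mkseq ?cn ?minnn //.
by rewrite nth_zip ?size_mkseq // nth_mkseq.
Qed.

Let wmap_chw_normalized n x :=
  @wmap_normalized (chain A' n) x (@chw K A' n) (@chw_normalized K A' n).

Lemma chain_map_linear n x : linear (chain_map Phi x : chain A n -> chain A' n).
Proof. by move=> k u v; rewrite !chain_mapE wlift_linear. Qed.

Lemma chain_map_linearl n (z : chain A n) : linear (fun x => chain_map Phi x z).
Proof.
move=> k x y; rewrite !chain_mapE -wlift_lin_fun; congr wlift; apply/funext=> w.
by rewrite (wmap_linear Phi_meas) //; apply: chw_mlin.
Qed.

Lemma chain_map_chw n x w :
  chain_map Phi x (chw n w) = wmap Phi w x (@chw K A' n).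
Proof.
have [wn1|wn1] := eqVneq (size w) n.+1; first by rewrite chain_mapE wlift_chw.
rewrite {1}/chw (negPf wn1) (lin0 (@chain_map_linear n x)).
rewrite -[LHS](wmap0 Phi _ w x); apply: eq_wmap => w1 w1E.
by rewrite /chw w1E (negPf wn1).
Qed.

Hypothesis C_cocomm : cocommutative C.

Lemma chain_map_hoch n x (z : chain A n.+1) :
  chain_map Phi x (hoch z) = hoch (chain_map Phi x z).
Proof.
apply: (eq_chain_linear (f := fun z => chain_map Phi x (hoch z))
  (g := fun z => hoch (chain_map Phi x z))).
- exact: linear_comp (@chain_map_linear _ x) (@linear_hoch _ _ _).
- exact: linear_comp (@linear_hoch _ _ _) (@chain_map_linear _ x).
move=> w _; rewrite hoch_chw chain_map_chw.
rewrite (ev_comp _ _ (@chain_map_linear _ x)) (wmap_comp _ _ _ _ (@linear_hoch _ _ _)).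
under eq_ev do rewrite chain_map_chw.
rewrite (wmap_hochw Phi_meas C_cocomm); last exact: chw_mlin.
by apply: eq_wmap => w1 _; rewrite hoch_chw.
Qed.

Lemma chain_map_connes n x (z : chain A n) :
  chain_map Phi x (connes z) = connes (chain_map Phi x z).
Proof.
apply: (eq_chain_linear (f := fun z => chain_map Phi x (connes z))
  (g := fun z => connes (chain_map Phi x z))).
- exact: linear_comp (@chain_map_linear _ x) (@linear_connes _ _ _).
- exact: linear_comp (@linear_connes _ _ _) (@chain_map_linear _ x).
move=> w _; rewrite connes_chw chain_map_chw.
rewrite (ev_comp _ _ (@chain_map_linear _ x)) (wmap_comp _ _ _ _ (@linear_connes _ _ _)).
under eq_ev do rewrite chain_map_chw.
rewrite (wmap_connesw Phi_meas C_cocomm); last exact: chw_mlin.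
by apply: eq_wmap => w1 _; rewrite connes_chw.
Qed.

Lemma chain_map_shuffle p q x (u : chain A p) (v : chain A q) :
  chain_map Phi x (shuffle u v) =
  tlift (fun y z => shuffle (chain_map Phi y u) (chain_map Phi z v)) (comul C x).
Proof.
move: u v; apply: (eq_chain_bilinear (f := fun u v => chain_map Phi x (shuffle u v))
  (g := fun u v => tlift (fun y z => shuffle (chain_map Phi y u) (chain_map Phi z v)) (comul C x))).
- exact: (bilin_comp (G := chain_map Phi x) (@chain_map_linear _ x) (shuffle_bilin _ p q)).
- apply: bilin_tlift => y z; apply: bilin_precomp (shuffle_bilin _ p q) _ _;
    exact: chain_map_linear.
move=> u v up vq; rewrite shuffle_chw // (ev_comp _ _ (@chain_map_linear _ x)).
under eq_ev do rewrite chain_map_chw.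
case: u v up vq => [//|a u] [//|b v] up vq.
rewrite (wmap_sprod Phi_meas C_cocomm); last exact: chw_mlin.
apply: eq_tlift => y z; rewrite !chain_map_chw.
rewrite (wmap_comp _ _ _ _ (@shuffle_linearl _ _ p q _)).
apply: eq_wmap => u1 u1E; rewrite (wmap_comp _ _ _ _ (@shuffle_linearr _ _ p q _)).
by apply: eq_wmap => v1 v1E; rewrite shuffle_chw ?u1E ?v1E.
Qed.

Lemma tot_map_linear n x : linear (tot_map Phi x : tot A n -> tot A' n).
Proof.
elim/nat_ind2: n => [||n IH]; try exact: chain_map_linear.
move=> k [u1 u2] [v1 v2]; apply: (congr2 pair); last exact: IH.
exact: chain_map_linear.
Qed.

Lemma tot_map_linearl n (z : tot A n) : linear (fun x => tot_map Phi x z).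
Proof.
elim/nat_ind2: n z => [||n IH] z; try exact: chain_map_linearl.
move=> k x y; apply: (congr2 pair); last exact: IH.
exact: chain_map_linearl.
Qed.

Lemma tot_map_head n x (z : tot A n) :
  tot_head (tot_map Phi x z) = chain_map Phi x (tot_head z).
Proof. by case: n z => [|[|n]]. Qed.

Lemma tot_map_in n x (z : chain A n) :
  tot_map Phi x (tot_in z) = tot_in (chain_map Phi x z).
Proof.
by case: n z => [|[|n]] z //; apply: (congr2 pair) => //; apply: (lin0 (@tot_map_linear _ x)).
Qed.

Lemma tot_map_diff n x (z : tot A n.+1) :
  tot_map Phi x (tot_diff z) = tot_diff (tot_map Phi x z).
Proof.
elim/nat_ind2: n z => [||n IH] z /=; first exact: chain_map_hoch.
  by rewrite (linD (@chain_map_linear _ x)) chain_map_hoch chain_map_connes.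
rewrite (linD (@chain_map_linear _ x)) chain_map_hoch chain_map_connes IH.
congr (_ + connes _, _).
by rewrite -(@tot_map_head n.+1 x z.2).
Qed.

Lemma tot_in_linear n : linear (@tot_in K A' n).
Proof.
case: n => [|[|n]] // k t t'; apply: (congr2 pair) => //.
have E : k *: (0 : tot A' n) + 0 = 0 by rewrite scaler0 addr0.
exact: esym E.
Qed.

Lemma tot_shuffle_linearr p q (u : chain A' p) :
  linear (fun v : tot A' q => tot_shuffle u v).
Proof.
elim/nat_ind2: q => [||q IH].
- exact: linear_comp (@tot_in_linear _) (@shuffle_linearr _ _ _ 0 u).
- exact: linear_comp (@tot_in_linear _) (@shuffle_linearr _ _ _ 1 u).
move=> k v v'; apply: (congr2 pair); last exact: (IH k v.2 v'.2).
exact: (shuffle_linearr u k v.1 v'.1).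
Qed.

Lemma tot_shuffle_linearl p q (v : tot A' q) :
  linear (fun u : chain A' p => tot_shuffle u v).
Proof.
elim/nat_ind2: q v => [||q IH] v.
- exact: linear_comp (@tot_in_linear _) (@shuffle_linearl _ _ _ 0 v).
- exact: linear_comp (@tot_in_linear _) (@shuffle_linearl _ _ _ 1 v).
move=> k u u'; apply: (congr2 pair); last exact: (IH v.2 k u u').
exact: (shuffle_linearl v.1 k u u').
Qed.

Lemma tot_map_shuffle p q x (u : chain A p) (v : tot A q) :
  tot_map Phi x (tot_shuffle u v) =
  tlift (fun y z => tot_shuffle (chain_map Phi y u) (tot_map Phi z v)) (comul C x).
Proof.
elim/nat_ind2: q v => [||q IH] v.
- rewrite [tot_shuffle u v]/(tot_in (shuffle u (v : chain A 0))) tot_map_in chain_map_shuffle.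
  exact: tlift_comp (@tot_in_linear _).
- rewrite [tot_shuffle u v]/(tot_in (shuffle u (v : chain A 1))) tot_map_in chain_map_shuffle.
  exact: tlift_comp (@tot_in_linear _).
case: v => v1 v2.
transitivity (((chain_map Phi x (shuffle u v1) : chain A' (q + p).+2),
  tot_map Phi x (tot_shuffle u v2)) : tot A' (q + p).+2); first by [].
rewrite IH (chain_map_shuffle x u v1) -[LHS]tlift_pair.
by [].
Qed.

End ChainMap.

(** * The total complex and its components *)

Section Totalization.
Variables (K : fieldType) (A : comPzAlgType K).

(** The component of degree N of an element of the total complex; as with [cto], this
    allows comparing elements of total complexes in different degrees. *)
Fixpoint tcomp (n N : nat) : tot A n -> chain A N :=
  match n return tot A n -> chain A N with
  | 0 => fun z => cto N (z : chain A 0)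
  | 1 => fun z => cto N (z : chain A 1)
  | m.+2 => fun z => cto N z.1 + @tcomp m N z.2
  end.

Lemma tcomp_linear n N : linear (@tcomp n N).
Proof.
elim/nat_ind2: n => [||n IH]; try exact: linear_cto.
move=> k [u1 u2] [v1 v2].
have E : cto N (k *: u1 + v1) + tcomp N (k *: u2 + v2) =
    k *: (cto N u1 + tcomp N u2) + (cto N v1 + tcomp N v2).
  by rewrite linear_cto IH; lmod K (chain A N).
exact: E.
Qed.

Lemma tcomp_gt n N (z : tot A n) : (n < N)%N -> tcomp N z = 0.
Proof.
elim/nat_ind2: n z => [||n IH] z nN; try by apply: cto_neq; rewrite ltn_eqF.
by rewrite /= cto_neq ?ltn_eqF // IH ?addr0 //; apply: ltn_trans nN.
Qed.

Lemma tcomp_head n (z : tot A n) : tcomp n z = tot_head z.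
Proof.
case: n z => [|[|n]] z; try exact: cto_id.
by rewrite /= cto_id tcomp_gt ?addr0.
Qed.

Lemma tcomp_pred n (z : tot A n.+1) : tcomp n z = 0.
Proof.
case: n z => [|n] z; first exact: cto_neq.
by rewrite /= cto_neq ?tcomp_gt ?addr0 // gtn_eqF.
Qed.

Lemma tcomp_inj n (z : tot A n) : (forall N, (N <= n)%N -> tcomp N z = 0) -> z = 0.
Proof.
elim/nat_ind2: n z => [||n IH] z z0.
- by have := z0 0%N isT; rewrite tcomp_head.
- by have := z0 1%N isT; rewrite tcomp_head.
case: z z0 => z1 z2 z0; have z10 : z1 = 0 by have := z0 n.+2 (leqnn _); rewrite tcomp_head.
congr (_, _) => //; apply: IH => N Nn; have := z0 N (leqW (leqW Nn)).
by rewrite /= z10 (lin0 (@linear_cto _ _ _ _)) add0r.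
Qed.

Lemma tcomp_in n N (z : chain A n) : tcomp N (tot_in z) = cto N z.
Proof.
case: n z => [|[|n]] z //=.
by rewrite (lin0 (@tcomp_linear _ _)) addr0.
Qed.

Definition tdiff n : tot A n -> tot A n.-1 :=
  match n return tot A n -> tot A n.-1 with
  | 0 => fun _ => 0
  | m.+1 => fun z => tot_diff z
  end.

(** The contribution of B to the component of degree N of a boundary. *)
Definition tcomp_low n N : tot A n -> chain A N :=
  match N return tot A n -> chain A N with
  | 0 => fun _ => 0
  | M.+1 => fun z => connes (tcomp M z)
  end.

Lemma tcomp_tdiff n N (z : tot A n) : (N < n)%N ->
  tcomp N (tdiff z) = hoch (tcomp N.+1 z) + tcomp_low N z.
Proof.
case: n z => // n z; elim/nat_ind2: n z => [||n IH] z Nn.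
- by case: N Nn => // _; rewrite /= !cto_id addr0.
- have {Nn} : (N == 0%N) || (N == 1%N) by case: N Nn => [|[|]].
  case/orP => /eqP->; rewrite /=.
    by rewrite !cto_neq // !addr0 linear0.
  by rewrite !cto_id (cto_neq z.2) // addr0 (cto_neq z.1) // add0r.
have [z1 [z2 zE]] : exists (z1 : chain A n.+3) (z2 : tot A n.+1), z = (z1, z2).
  by case: z => z1 z2; exists z1, z2.
subst z; have := Nn; rewrite ltnS leq_eqVlt => /orP[/eqP NE|].
  subst N; have lowE : tcomp_low n.+2 ((z1, z2) : tot A n.+3) = connes (tot_head z2).
    rewrite -[LHS]/(connes (cto n.+1 z1 + tcomp n.+1 z2)) tcomp_head.
    by rewrite (cto_neq z1) ?add0r // gtn_eqF.
  by rewrite lowE tcomp_head (tcomp_head (n := n.+2)).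
rewrite ltnS leq_eqVlt => /orP[/eqP NE|NLn].
  subst N; have lowE : tcomp_low n.+1 ((z1, z2) : tot A n.+3) = 0.
    rewrite -[LHS]/(connes (cto n z1 + tcomp n z2)) tcomp_pred addr0.
    by rewrite cto_neq ?linear0 // gtn_eqF // !ltnS ltnW.
  by rewrite lowE (tcomp_pred (n := n.+2)) linear0 addr0 (tcomp_pred (n := n.+1)).
rewrite ltnS in NLn.
have lowE : tcomp_low N ((z1, z2) : tot A n.+3) = tcomp_low N z2.
  case: N NLn {Nn IH} => // N Nn.
  rewrite -[LHS]/(connes (cto N z1 + tcomp N z2)) cto_neq ?add0r //.
  by rewrite gtn_eqF // !ltnS ltnW // ltnW // ltnW.
rewrite lowE -[tcomp N.+1 _]/(cto N.+1 z1 + tcomp N.+1 z2).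
transitivity (cto N (hoch z1 + connes (@tot_head K A n.+1 z2)) + tcomp N (tdiff z2)).
  by [].
rewrite IH // cto_neq; last by rewrite gtn_eqF // !ltnS ltnW.
by rewrite (cto_neq z1) ?add0r // gtn_eqF // !ltnS ltnW.
Qed.

Lemma cto_shuffle p q k (x : chain A p) (y : chain A q) :
  cto (k + p) (shuffle x y : chain A (q + p)) = shuffle x (cto k y).
Proof.
case: (eqVneq q k) y => [->|qk] y; first by rewrite !cto_id.
by rewrite !cto_neq ?eqn_add2r // (lin0 (@shuffle_linearr _ _ _ _ _)).
Qed.

Lemma tcomp_shuffle p q k (x : chain A p) (y : tot A q) :
  tcomp (k + p) (tot_shuffle x y) = shuffle x (tcomp k y).
Proof.
elim/nat_ind2: q y => [||q IH] y.
- exact: etrans (tcomp_in _ (shuffle x (y : chain A 0))) (cto_shuffle _ _ _).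
- exact: etrans (tcomp_in _ (shuffle x (y : chain A 1))) (cto_shuffle _ _ _).
case: y => y1 y2.
transitivity (cto (k + p) (shuffle x y1 : chain A (q.+2 + p)) +
  tcomp (k + p) (tot_shuffle x y2)); first by [].
by rewrite IH cto_shuffle -(linD (@shuffle_linearr _ _ _ _ _)).
Qed.

Lemma tcomp_shuffle_lt p q N (x : chain A p) (y : tot A q) :
  (N < p)%N -> tcomp N (tot_shuffle x y) = 0.
Proof.
move=> Np; have cto0 m (z : chain A (m + p)) : cto N z = 0.
  by rewrite cto_neq // gtn_eqF // ltn_addl.
elim/nat_ind2: q y => [||q IH] y.
- exact: etrans (tcomp_in _ (shuffle x (y : chain A 0))) (cto0 0 _).
- exact: etrans (tcomp_in _ (shuffle x (y : chain A 1))) (cto0 1 _).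
case: y => y1 y2.
transitivity (cto N (shuffle x y1 : chain A (q.+2 + p)) +
  tcomp N (tot_shuffle x y2)); first by [].
by rewrite IH cto0 addr0.
Qed.

Lemma tcomp_shuffle_cto p q k N (x : chain A p) (y : tot A q) : N = (k + p)%N ->
  tcomp N (tot_shuffle x y) = cto N (shuffle x (tcomp k y) : chain A (k + p)).
Proof. by move->; rewrite tcomp_shuffle cto_id. Qed.

(** The Leibniz rule for b together with B(x * y) = (-1)^p x * B y, for x such as B z.
    For N < p only the lowest component of y can contribute, through its product with b x. *)
Lemma tdiff_shuffle p q N (x : chain A p) (y : tot A q) :
  (forall q (t : chain A q),
     connes (shuffle x t) = (-1) ^+ p *: (shuffle x (connes t) : chain A (q.+1 + p))) ->
  (N < q + p)%N ->
  tcomp N (tdiff (tot_shuffle x y)) =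
  tcomp N (tot_shuffle (hochz x) y) + (-1) ^+ p *: tcomp N (tot_shuffle x (tdiff y)).
Proof.
move=> connes_x Nqp; rewrite tcomp_tdiff //.
have [Np|pN] := ltnP N p.
  rewrite (tcomp_shuffle_lt _ _ Np) scaler0 addr0.
  have -> : tcomp_low N (tot_shuffle x y) = 0.
    by case: N Np {Nqp} => // N Np; rewrite /= tcomp_shuffle_lt ?linear0 // ltnW.
  rewrite addr0; have [pE|pN] := eqVneq p N.+1; last first.
    have Np1 : (N.+1 < p)%N by rewrite ltn_neqAle eq_sym pN.
    rewrite !tcomp_shuffle_lt ?linear0 //.
    by case: (p) Np1.
  subst p; rewrite (tcomp_shuffle 0) (tcomp_shuffle 0).
  have := hochz_shuffle N x (tcomp 0 y).
  rewrite /= (lin0 (@shuffle_linearr _ _ _ _ _)) (lin0 (@linear_cto _ _ _ _)).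
  by rewrite scaler0 addr0 !cto_id.
rewrite -(subnK pN) in Nqp *; set k := (N - p)%N in Nqp *.
have kq : (k < q)%N by rewrite ltn_add2r in Nqp.
rewrite (tcomp_shuffle k x (tdiff y)) tcomp_tdiff //.
rewrite (linD (@shuffle_linearr _ _ _ _ _)) scalerDr addrA; congr (_ + _); last first.
  case: (k) => [|k']; last first.
    rewrite /= -connes_x; congr connes; exact: tcomp_shuffle.
  rewrite /= (lin0 (@shuffle_linearr _ _ _ _ _)) scaler0.
  case: (p) x {connes_x pN Nqp k kq} => // p' x.
  by rewrite /= tcomp_shuffle_lt ?linear0.
have -> : tcomp (k + p).+1 (tot_shuffle x y) =
    (shuffle x (tcomp k.+1 y) : chain A (k.+1 + p)) by exact: (tcomp_shuffle k.+1).
have := hochz_shuffle (k + p) x (tcomp k.+1 y); rewrite /= !cto_id => ->.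
congr (_ + _); case: (p) x {connes_x pN Nqp} => [|p'] x.
  rewrite /= (lin0 (@shuffle_linearl _ _ _ _ _)) (lin0 (@linear_cto _ _ _ _)).
  by rewrite (lin0 (@tot_shuffle_linearl _ _ _ _ _)) (lin0 (@tcomp_linear _ _)).
by rewrite (tcomp_shuffle_cto (k := k.+1)) // addnS.
Qed.

End Totalization.

(** * Products on homology *)

Section HomologyClasses.
Variables (K : fieldType) (X : nat -> lmodType K).
Variable d : forall n, {linear X n.+1 -> X n}.
Lemma hrepr_cycle n (h : homology d n) : hrepr h \in is_cycle d (n := n).
Proof. exact: valP. Qed.

Lemma hclass_hrepr n (h : homology d n) : hclass d (hrepr h) = h.
Proof. by rewrite /hclass /hrepr valK projK. Qed.

Lemma hclass_sub n (c : cycles d n) : hclass d (val c) = proj (is_boundary (n := n)) c.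
Proof. by rewrite /hclass valK. Qed.

Lemma hclass_linear n k (u v : X n) :
  u \in is_cycle d (n := n) -> v \in is_cycle d (n := n) ->
  hclass d (k *: u + v) = k *: hclass d u + hclass d v.
Proof.
move=> uc vc; pose cu : cycles d n := Sub u uc; pose cv : cycles d n := Sub v vc.
have -> : u = val cu by [].
have -> : v = val cv by [].
by rewrite -(linearP val) !hclass_sub linearP.
Qed.

(** Taking classes is linear on cycles only, so the sum is first formed in the
    submodule of cycles. *)
Lemma hclass_tlift n (U V : lmodType K) (f : U -> V -> X n) t :
  (forall u v, f u v \in is_cycle d (n := n)) ->
  hclass d (tlift f t) = tlift (fun u v => hclass d (f u v)) t.
Proof.
move=> fc; pose f' u v : cycles d n := Sub (f u v) (fc u v).
have val_lin : linear (val : cycles d n -> X n) by move=> k u v; rewrite linearP.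
have -> : tlift f t = val (tlift f' t) by rewrite (tlift_comp _ _ val_lin).
rewrite hclass_sub (@tlift_comp _ _ _ _ _ (proj (is_boundary (n := n)))); last first.
  exact: proj_linear.
by apply: eq_tlift => u v; rewrite -hclass_sub.
Qed.

End HomologyClasses.

Section InducedLinear.
Variable K : fieldType.
Variables (X Y Z : nat -> lmodType K).
Variable dX : forall n, {linear X n.+1 -> X n}.
Variable dY : forall n, {linear Y n.+1 -> Y n}.
Variable dZ : forall n, {linear Z n.+1 -> Z n}.

Lemma hmap_classes m n (f : X m -> Y n) : linear f ->
  (forall z, z \in is_cycle dX (n := m) -> f z \in is_cycle dY (n := n)) ->
  (forall w, exists w', f (dX m w) = dY n w') ->
  (forall z, z \in is_cycle dX (n := m) -> hmap dY f (hclass dX z) = hclass dY (f z)) /\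
  linear (hmap (dX := dX) dY f).
Proof.
move=> fl fc fb.
have fE z : z \in is_cycle dX (n := m) -> hmap dY f (hclass dX z) = hclass dY (f z).
  exact: (@hmap_hclass _ _ _ dX dY m n (linear_of fl)).
split=> // k a b; rewrite -{1}(hclass_hrepr a) -{1}(hclass_hrepr b).
have ac := hrepr_cycle a; have bc := hrepr_cycle b.
rewrite -hclass_linear // fE; last by apply: rpredD => //; apply: rpredZ.
by rewrite fl hclass_linear ?fc.
Qed.

Lemma hmap2_classes m n p (f : X m -> Y n -> Z p) : bilin f ->
  (forall x y, x \in is_cycle dX (n := m) -> y \in is_cycle dY (n := n) ->
     f x y \in is_cycle dZ (n := p)) ->
  (forall w y, y \in is_cycle dY (n := n) -> exists w', f (dX m w) y = dZ p w') ->
  (forall x w, x \in is_cycle dX (n := m) -> exists w', f x (dY n w) = dZ p w') ->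
  (forall x y, x \in is_cycle dX (n := m) -> y \in is_cycle dY (n := n) ->
    hmap2 dZ f (hclass dX x) (hclass dY y) = hclass dZ (f x y)) /\
  bilin (hmap2 (dX := dX) (dY := dY) dZ f).
Proof.
move=> [fr fl] fc fX fY; have fE := hmap2_hclass fr fl fc fX fY.
split=> //; split=> [a|b] k c c'.
  rewrite -{1}(hclass_hrepr a) -{1}(hclass_hrepr c) -{1}(hclass_hrepr c').
  have ac := hrepr_cycle a; have cc := hrepr_cycle c; have c'c := hrepr_cycle c'.
  rewrite -hclass_linear // fE //; last by apply: rpredD => //; apply: rpredZ.
  by rewrite fr hclass_linear ?fc.
rewrite -{1}(hclass_hrepr b) -{1}(hclass_hrepr c) -{1}(hclass_hrepr c').
have bc := hrepr_cycle b; have cc := hrepr_cycle c; have c'c := hrepr_cycle c'.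
rewrite -hclass_linear // fE //; last by apply: rpredD => //; apply: rpredZ.
by rewrite fl hclass_linear ?fc.
Qed.

End InducedLinear.

Section Products.
Variables (K : fieldType) (A : comPzAlgType K).

Local Notation dT := (fun n => @tot_diff K A n).
Local Notation dH := (fun n => @hoch K A n).
Local Notation tot_cycle n := (is_cycle dT (n := n)).
Local Notation hoch_cycle n := (is_cycle dH (n := n)).

Lemma tot_cycleP n (z : tot A n) : reflect (tdiff z = 0) (z \in tot_cycle n).
Proof. by case: n z => [|n] z; [apply: ReflectT | apply: eqP]. Qed.

Lemma hoch_cycleP n (z : chain A n) : reflect (hochz z = 0) (z \in hoch_cycle n).
Proof. by case: n z => [|n] z; [apply: ReflectT | apply: eqP]. Qed.

(** If x is a cycle then b x_p = - B x_(p-2), so b B x_p = - B b x_p = B B x_(p-2) = 0. *)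
Lemma hoch_connes_cycle n (x : tot A n) : x \in tot_cycle n ->
  hoch (connes (tot_head x)) = 0.
Proof.
move/tot_cycleP; case: n x => [|[|[|n]]] x xc; first exact: hoch_connes0.
- by rewrite hoch_connes [hoch _]xc linear0 oppr0.
- have xc' : hoch x.1 + connes x.2 = 0 := xc.
  rewrite hoch_connes [hoch _](canRL (addrK _) xc') sub0r.
  by rewrite (linN (@linear_connes _ _ _)) connes_connes !oppr0.
- have xc' : hoch x.1 + connes (@tot_head K A n.+1 x.2) = 0 by case: xc.
  rewrite hoch_connes [hoch _](canRL (addrK _) xc') sub0r.
  by rewrite (linN (@linear_connes _ _ _)) connes_connes !oppr0.
Qed.

(** The leading component of D w is b w_(p+1) + B w_(p-1), and B kills the second term. *)
Lemma connes_head_diff n (w : tot A n.+1) :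
  connes (tot_head (tot_diff w)) = - hoch (connes (tot_head w)).
Proof.
rewrite hoch_connes opprK; case: n w => [|[|n]] w //.
- rewrite [tot_head _]/(hoch w.1 + connes w.2).
  by rewrite (linD (@linear_connes _ _ _)) connes_connes addr0.
- rewrite [tot_head _]/(hoch w.1 + connes (@tot_head K A n.+1 w.2)).
  by rewrite (linD (@linear_connes _ _ _)) connes_connes addr0.
Qed.

Lemma tdiff_connes_shuffle p q (x : chain A p) (y : tot A q) :
  tdiff (tot_shuffle (connes x) y) = 0 <->
  forall N, (N < q + p.+1)%N ->
    tcomp N (tot_shuffle (hoch (connes x)) y) +
      (-1) ^+ p.+1 *: tcomp N (tot_shuffle (connes x) (tdiff y)) = 0.
Proof.
have E N := tdiff_shuffle (N := N) y (fun q t => connes_shuffle x t).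
split=> [D0 N Nqp|H]; first by rewrite -E // D0 (lin0 (@tcomp_linear _ _ _ _)).
by apply: tcomp_inj => N Nqp; rewrite E ?H //; lia.
Qed.

Lemma eq_tcomp_tdiff m n N (z : tot A m) (t : tot A n) :
  (forall M, tcomp M z = tcomp M t) -> (N < m)%N -> (N < n)%N ->
  tcomp N (tdiff z) = tcomp N (tdiff t).
Proof.
move=> zt Nm Nn; rewrite !tcomp_tdiff // zt; congr (_ + _).
by case: N {Nm Nn} => // N; rewrite /= zt.
Qed.

Lemma eq_tcomp n (z t : tot A n) :
  (forall N, (N < n.+1)%N -> tcomp N z = tcomp N t) -> z = t.
Proof.
move=> zt; apply/eqP; rewrite -subr_eq0; apply/eqP/tcomp_inj => N Nn.
have tl := @tcomp_linear K A n N.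
by rewrite (linD tl) (linN tl) zt // subrr.
Qed.

Let tsr p q (x : chain A p) := @tot_shuffle_linearr K A p q x.
Let tsl p q (y : tot A q) := @tot_shuffle_linearl K A p q y.

Lemma connes_head_linear p : linear (fun x : tot A p => connes (tot_head x)).
Proof.
move=> k x y; transitivity (connes (k *: tot_head x + tot_head y)); last exact: linear_connes.
by congr connes; apply: tot_head_linear.
Qed.

Lemma HC_prod_cycle p q (x : tot A p) (y : tot A q) :
  x \in tot_cycle p -> y \in tot_cycle q ->
  tot_shuffle (connes (tot_head x)) y \in tot_cycle (q + p.+1).
Proof.
move=> xc /tot_cycleP yc; apply/tot_cycleP/tdiff_connes_shuffle => N _.
rewrite yc (hoch_connes_cycle xc) (lin0 (tsl y)) (lin0 (tsr _)).
by rewrite !(lin0 (@tcomp_linear _ _ _ _)) scaler0 addr0.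
Qed.

Lemma HC_act_cycle p q (x : tot A p) (y : chain A q) :
  x \in tot_cycle p -> y \in hoch_cycle q ->
  shuffle (connes (tot_head x)) y \in hoch_cycle (q + p.+1).
Proof.
move=> xc /hoch_cycleP yc; apply/hoch_cycleP.
rewrite -[LHS]cto_id hochz_shuffle yc [hochz _](hoch_connes_cycle xc).
rewrite (lin0 (shuffle_linearl y)) (lin0 (@shuffle_linearr _ _ _ _ _)).
by rewrite !(lin0 (@linear_cto _ _ _ _)) scaler0 addr0.
Qed.

Lemma HC_prod_classes p q :
  (forall x y, x \in tot_cycle p -> y \in tot_cycle q ->
     HC_mul (hclass dT x) (hclass dT y) =
     hclass dT (tot_shuffle (connes (tot_head x)) y)) /\
  bilin (@HC_mul K A p q).
Proof.
apply: hmap2_classes.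
- apply: (bilin_precomp (f := @tot_shuffle K A p.+1 q)
    (g := fun x => connes (tot_head x)) (h := id)) => //.
  exact: connes_head_linear.
- by move=> x y; apply: HC_prod_cycle.
- move=> w y /tot_cycleP yc; rewrite connes_head_diff.
  pose W := tot_shuffle (connes (tot_head w)) y.
  (* The degrees q + p.+2 and (q + p.+1).+1 of W and of its copy w' differ only in form. *)
  have [w' w'E] : exists w' : tot A (q + p.+1).+1, forall N, tcomp N w' = tcomp N W.
    by rewrite -addnS; exists W.
  exists (- w'); rewrite -[RHS]/(tot_diff (- w')) (linN (tsl y)).
  rewrite (linN (@tot_diff_linear _ _ _)); congr (- _).
  apply: eq_tcomp => N Nqp; rewrite -[tot_diff w']/(tdiff w').
  rewrite (eq_tcomp_tdiff w'E) //; last by rewrite addnS.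
  rewrite (tdiff_shuffle _ (fun q t => connes_shuffle (tot_head w) t)); last by rewrite addnS.
  by rewrite yc (lin0 (tsr _)) !(lin0 (@tcomp_linear _ _ _ _)) scaler0 addr0.
- move=> x w xc.
  exists ((-1) ^+ p.+1 *: (tot_shuffle (connes (tot_head x)) w : tot A (q.+1 + p.+1))).
  rewrite -[RHS]/(tot_diff (_ *: _)) (linZ (@tot_diff_linear _ _ _)); apply: eq_tcomp => N Nqp.
  rewrite (linZ (@tcomp_linear _ _ _ _)).
  transitivity ((-1) ^+ p.+1 *: tcomp N (tdiff (tot_shuffle (connes (tot_head x)) w)));
    last by [].
  rewrite (tdiff_shuffle _ (fun q t => connes_shuffle (tot_head x) t)) //.
  rewrite [hochz _](hoch_connes_cycle xc) (lin0 (tsl _)) (lin0 (@tcomp_linear _ _ _ _)).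
  rewrite add0r scalerA -exprD.
  by rewrite (_ : (-1) ^+ _ = 1) ?scale1r // -(expr0 (-1)); parity.
Qed.

Lemma HC_act_classes p q :
  (forall x y, x \in tot_cycle p -> y \in hoch_cycle q ->
     HC_act (hclass dT x) (hclass dH y) =
     hclass dH (shuffle (connes (tot_head x)) y)) /\
  bilin (@HC_act K A p q).
Proof.
have ssr q' (x : chain A p.+1) := @shuffle_linearr K A p.+1 q' x.
have ctol n N := @linear_cto K A n N.
apply: hmap2_classes.
- apply: (bilin_precomp (f := @shuffle K A p.+1 q)
    (g := fun x => connes (tot_head x)) (h := id)) => //; first exact: shuffle_bilin.
  exact: connes_head_linear.
- by move=> x y; apply: HC_act_cycle.
- move=> w y /hoch_cycleP yc; rewrite connes_head_diff.
  pose W := shuffle (connes (tot_head w)) y.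
  have eqn : (q + p.+2 = (q + p.+1).+1)%N by rewrite addnS.
  exists (- cto (q + p.+1).+1 W).
  rewrite -[RHS]/(hoch (- _)) (linN (shuffle_linearl y)) (linN (@linear_hoch _ _ _)); congr (- _).
  have hoch_cto n (z : chain A n) : n = (q + p.+1).+1 ->
      hoch (cto (q + p.+1).+1 z) = cto (q + p.+1) (hochz z).
    by move=> nE; subst n; rewrite /= !cto_id.
  rewrite hoch_cto // hochz_shuffle yc (lin0 (@shuffle_linearr _ _ _ _ _)) (lin0 (ctol _ _)).
  by rewrite scaler0 addr0 cto_id.
- move=> x w xc.
  exists ((-1) ^+ p.+1 *: (shuffle (connes (tot_head x)) w : chain A (q.+1 + p.+1))).
  rewrite -[RHS]/(hoch (_ *: _)) (linZ (@linear_hoch _ _ _)).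
  transitivity ((-1) ^+ p.+1 *: cto (q + p.+1)
      (hochz (shuffle (connes (tot_head x)) w : chain A (q.+1 + p.+1)))); last first.
    by rewrite cto_id.
  rewrite hochz_shuffle.
  rewrite [hochz (connes _)](hoch_connes_cycle xc) (lin0 (shuffle_linearl w)) (lin0 (ctol _ _)).
  rewrite add0r scalerA -exprD cto_id.
  by rewrite (_ : (-1) ^+ _ = 1) ?scale1r // -(expr0 (-1)); parity.
Qed.

End Products.

(** * Graded products and direct sums *)

Section DirectSums.
Variable K : fieldType.

Section OneSum.
Variable V : nat -> lmodType K.

Lemma dinj_linear n : linear (@dinj K V n).
Proof.
move=> k u v.
have relE r : dsum_rel r -> proj (@dsum_rel K V) r = 0.
  move=> h; rewrite -(linear0 (proj (@dsum_rel K V))); apply/proj_eqP.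
  by rewrite subr0; apply: spanS.
have := relE _ (dsum_rel_lin k u v); rewrite linearB linearP /=.
by move/eqP; rewrite subr_eq0 => /eqP.
Qed.

Lemma dlift_linear (W : lmodType K) (f : forall n, V n -> W) :
  (forall n, linear (f n)) -> linear (dlift f).
Proof. by move=> fl; apply/plift_linear/dlift_respects. Qed.

Lemma dlift_dinj (W : lmodType K) (f : forall n, V n -> W) n (v : V n) :
  (forall n, linear (f n)) -> dlift f (dinj v) = f n v.
Proof. by move=> fl; rewrite /dlift plift_gen //; apply: dlift_respects. Qed.

Lemma dlift_lin_param (W W' : lmodType K) (x : dsum V) (G : W' -> forall n, V n -> W) :
  (forall n v, linear (fun t => G t n v)) -> linear (fun t => dlift (G t) x).
Proof.
move=> Gl k t t'; rewrite /dlift -plift_lin_fun; congr plift; apply/funext=> -[n v].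
exact: Gl.
Qed.

Lemma eq_dsum_linear (W : lmodType K) (f g : dsum V -> W) : linear f -> linear g ->
  (forall n (v : V n), f (dinj v) = g (dinj v)) -> f =1 g.
Proof. by move=> fl gl fg; apply: eq_pres_linear => // -[n v]; apply: fg. Qed.

End OneSum.

Definition dmul (V1 V2 V3 : nat -> lmodType K)
    (mul : forall p q, V1 p -> V2 q -> V3 (q + p)%N) (x : dsum V1) (y : dsum V2) : dsum V3 :=
  dlift (fun p a => dlift (fun q b => dinj (mul p q a b)) y) x.

Definition dmap (C : lmodType K) (V W : nat -> lmodType K) (f : forall n, C -> V n -> W n)
    (x : C) : dsum V -> dsum W :=
  dlift (fun n a => dinj (f n x a)).

Section GradedProduct.
Variables V1 V2 V3 : nat -> lmodType K.
Variable mul : forall p q, V1 p -> V2 q -> V3 (q + p)%N.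
Hypothesis mul_bilin : forall p q, bilin (@mul p q).

Let inner_linear p (a : V1 p) q : linear (fun b : V2 q => dinj (mul a b)).
Proof. by have [mr _] := mul_bilin p q; move=> k b b'; rewrite mr dinj_linear. Qed.

Let outer_linear y p : linear (fun a : V1 p => dlift (fun q (b : V2 q) => dinj (mul a b)) y).
Proof.
apply: dlift_lin_param => q b k a a'.
by have [_ ml] := mul_bilin p q; rewrite ml dinj_linear.
Qed.

Lemma dmul_bilin : bilin (dmul mul).
Proof.
split=> [x|y]; last exact/dlift_linear/outer_linear.
move=> k y y'; rewrite /dmul -/(dlift _ x).
move: k y y'; apply: dlift_lin_param => p a.
exact/dlift_linear/inner_linear.
Qed.

Lemma dmul_dinj p q (a : V1 p) (b : V2 q) : dmul mul (dinj a) (dinj b) = dinj (mul a b).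
Proof. by rewrite /dmul !dlift_dinj. Qed.

End GradedProduct.

Section GradedMap.
Variables (C : lmodType K) (V W : nat -> lmodType K) (f : forall n, C -> V n -> W n).
Hypothesis f_bilin : forall n, bilin (@f n).

Lemma dmap_linear x : linear (dmap f x).
Proof.
apply: dlift_linear => n k a a'.
by have [fr _] := f_bilin n; rewrite fr dinj_linear.
Qed.

Lemma dmap_linearl h : linear (fun x => dmap f x h).
Proof.
apply: dlift_lin_param => n a k x x'.
by have [_ fl] := f_bilin n; rewrite fl dinj_linear.
Qed.

Lemma dmap_dinj n x (a : V n) : dmap f x (dinj a) = dinj (f x a).
Proof.
rewrite /dmap dlift_dinj // => m k u v.
by have [fr _] := f_bilin m; rewrite fr dinj_linear.
Qed.

End GradedMap.

(** Both sides are bilinear, so it is enough to compare them on homogeneous elements. *)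
Lemma dmap_dmul (C : coalgebra K) (V1 V2 V3 W1 W2 W3 : nat -> lmodType K)
    (mul : forall p q, V1 p -> V2 q -> V3 (q + p)%N)
    (mul' : forall p q, W1 p -> W2 q -> W3 (q + p)%N)
    (f1 : forall n, C -> V1 n -> W1 n) (f2 : forall n, C -> V2 n -> W2 n)
    (f3 : forall n, C -> V3 n -> W3 n) :
  (forall p q, bilin (@mul p q)) -> (forall p q, bilin (@mul' p q)) ->
  (forall n, bilin (@f1 n)) -> (forall n, bilin (@f2 n)) -> (forall n, bilin (@f3 n)) ->
  (forall p q x (a : V1 p) (b : V2 q), f3 _ x (mul _ _ a b) =
    tlift (fun y z => mul' _ _ (f1 _ y a) (f2 _ z b)) (comul C x)) ->
  forall x a b, dmap f3 x (dmul mul a b) =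
    tlift (fun y z => dmul mul' (dmap f1 y a) (dmap f2 z b)) (comul C x).
Proof.
move=> mul_b mul'_b f1_b f2_b f3_b f_mul x a b.
have [mr ml] := dmul_bilin mul_b.
have rb : bilin (fun a b => tlift (fun y z => dmul mul' (dmap f1 y a) (dmap f2 z b)) (comul C x)).
  apply: bilin_tlift => y z.
  exact: bilin_precomp (dmul_bilin mul'_b) (dmap_linear f1_b y) (dmap_linear f2_b z).
have lb := bilin_comp (dmap_linear f3_b x) (dmul_bilin mul_b).
apply: (eq_dsum_linear (lb.2 b) (rb.2 b)) => p a1.
apply: (eq_dsum_linear (lb.1 _) (rb.1 _)) => q b1.
rewrite dmul_dinj // dmap_dinj // f_mul (tlift_comp _ _ (@dinj_linear _ _)).
by apply: eq_tlift => y z; rewrite !dmap_dinj // dmul_dinj.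
Qed.

End DirectSums.

(** * The maps induced by a measuring on homology *)

Section Homologies.
Variables (K : fieldType) (C : coalgebra K) (A A' : comPzAlgType K).
Variable Phi : C -> A -> A'.
Hypothesis Phi_meas : measuring Phi.
Hypothesis C_cocomm : cocommutative C.

Local Notation dT B := (fun n => @tot_diff K B n).
Local Notation dH B := (fun n => @hoch K B n).

Lemma tot_map_cycle n x (z : tot A n) :
  z \in is_cycle (dT A) (n := n) -> tot_map Phi x z \in is_cycle (dT A') (n := n).
Proof.
move=> /tot_cycleP zc; apply/tot_cycleP; case: n z zc => // n z zc.
rewrite -[LHS]/(tot_diff (tot_map Phi x z)) -(tot_map_diff Phi_meas C_cocomm).
by rewrite [tot_diff z]zc (lin0 (@tot_map_linear _ _ _ _ _ Phi_meas _ x)).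
Qed.

Lemma chain_map_cycle n x (z : chain A n) :
  z \in is_cycle (dH A) (n := n) -> chain_map Phi x z \in is_cycle (dH A') (n := n).
Proof.
move=> /hoch_cycleP zc; apply/hoch_cycleP; case: n z zc => // n z zc.
rewrite -[LHS]/(hoch (chain_map Phi x z)) -(chain_map_hoch Phi_meas C_cocomm).
by rewrite [hoch z]zc (lin0 (@chain_map_linear _ _ _ _ _ Phi_meas _ x)).
Qed.

Lemma HC_map_classes n x :
  (forall z, z \in is_cycle (dT A) (n := n) ->
     HC_map Phi x (hclass (dT A) z) = hclass (dT A') (tot_map Phi x z)) /\
  linear (@HC_map K C A A' Phi n x).
Proof.
apply: hmap_classes; first exact: tot_map_linear.
- exact: tot_map_cycle.
- by move=> w; exists (tot_map Phi x w); apply: tot_map_diff.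
Qed.

Lemma HH_map_classes n x :
  (forall z, z \in is_cycle (dH A) (n := n) ->
     HH_map Phi x (hclass (dH A) z) = hclass (dH A') (chain_map Phi x z)) /\
  linear (@HH_map K C A A' Phi n x).
Proof.
apply: hmap_classes; first exact: chain_map_linear.
- exact: chain_map_cycle.
- by move=> w; exists (chain_map Phi x w); apply: chain_map_hoch.
Qed.

Lemma HC_map_bilin n : bilin (@HC_map K C A A' Phi n).
Proof.
split=> [x|h k x y]; first by have [] := HC_map_classes n x.
rewrite /HC_map /hmap (tot_map_linearl Phi_meas).
by apply: hclass_linear; apply/tot_map_cycle/hrepr_cycle.
Qed.

Lemma HH_map_bilin n : bilin (@HH_map K C A A' Phi n).
Proof.
split=> [x|h k x y]; first by have [] := HH_map_classes n x.
rewrite /HH_map /hmap (chain_map_linearl Phi_meas).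
by apply: hclass_linear; apply/chain_map_cycle/hrepr_cycle.
Qed.

Lemma HC_map_mul p q x (a : HC A p) (b : HC A q) :
  HC_map Phi x (HC_mul a b) =
  tlift (fun y z => HC_mul (HC_map Phi y a) (HC_map Phi z b)) (comul C x).
Proof.
rewrite -(hclass_hrepr a) -(hclass_hrepr b).
have uc := hrepr_cycle a; have vc := hrepr_cycle b; move: (hrepr a) (hrepr b) uc vc => u v uc vc.
have [mulE _] := HC_prod_classes A p q; have [mulE' _] := HC_prod_classes A' p q.
rewrite mulE //; have pc : tot_shuffle (connes (tot_head u)) v
    \in is_cycle (dT A) (n := q + p.+1) by exact: HC_prod_cycle.
rewrite (HC_map_classes _ x).1 // (tot_map_shuffle Phi_meas C_cocomm).
rewrite (hclass_tlift (d := dT A')); last first.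
  move=> y z; rewrite (chain_map_connes Phi_meas C_cocomm) -tot_map_head.
  by apply: HC_prod_cycle; apply: tot_map_cycle.
apply: eq_tlift => y z; rewrite (HC_map_classes _ y).1 // (HC_map_classes _ z).1 //.
rewrite mulE' ?tot_map_cycle // (chain_map_connes Phi_meas C_cocomm).
by rewrite tot_map_head.
Qed.

Lemma HH_map_act p q x (a : HC A p) (b : HH A q) :
  HH_map Phi x (HC_act a b) =
  tlift (fun y z => HC_act (HC_map Phi y a) (HH_map Phi z b)) (comul C x).
Proof.
rewrite -(hclass_hrepr a) -(hclass_hrepr b).
have uc := hrepr_cycle a; have vc := hrepr_cycle b; move: (hrepr a) (hrepr b) uc vc => u v uc vc.
have [mulE _] := HC_act_classes A p q; have [mulE' _] := HC_act_classes A' p q.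
rewrite mulE //; have pc : shuffle (connes (tot_head u)) v
    \in is_cycle (dH A) (n := q + p.+1) by exact: HC_act_cycle.
rewrite (HH_map_classes _ x).1 // (chain_map_shuffle Phi_meas C_cocomm).
rewrite (hclass_tlift (d := dH A')); last first.
  move=> y z; rewrite (chain_map_connes Phi_meas C_cocomm) -tot_map_head.
  by apply: HC_act_cycle; [apply: tot_map_cycle | apply: chain_map_cycle].
apply: eq_tlift => y z; rewrite (HC_map_classes _ y).1 // (HH_map_classes _ z).1 //.
rewrite mulE' ?tot_map_cycle ?chain_map_cycle // (chain_map_connes Phi_meas C_cocomm).
by rewrite tot_map_head.
Qed.

Let zero_bilin (U V W : lmodType K) : bilin (fun (_ : U) (_ : V) => 0 : W).
Proof. by split=> [u|v] k t t'; rewrite scaler0 addr0. Qed.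

Lemma HCs_map_bilin n : bilin (@HCs_map K C A A' Phi n).
Proof. by case: n => [|n]; [apply: zero_bilin | apply: HC_map_bilin]. Qed.

Lemma HCs_mul_bilin (B : comPzAlgType K) p q : bilin (@HCs_mul K B p q).
Proof.
case: p => [|p]; first exact: zero_bilin.
case: q => [|q]; first exact: zero_bilin.
by have [] := HC_prod_classes B p q.
Qed.

Lemma HCs_act_bilin (B : comPzAlgType K) p q : bilin (@HCs_act K B p q).
Proof.
case: p => [|p]; first exact: zero_bilin.
by have [] := HC_act_classes B p q.
Qed.

Lemma HCs_map_mul p q x (a : HCs A p) (b : HCs A q) :
  HCs_map Phi x (HCs_mul a b) =
  tlift (fun y z => HCs_mul (HCs_map Phi y a) (HCs_map Phi z b)) (comul C x).
Proof.
have map0 n : HCs_map Phi x (0 : HCs A n) = 0 by rewrite (lin0 ((HCs_map_bilin n).1 x)).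
case: p a => [|p] a; first by rewrite [HCs_mul a b]/(0 : HCs A _) map0 -[LHS](tlift0 _ (comul C x)).
case: q b => [|q] b; first by rewrite [HCs_mul a b]/(0 : HCs A _) map0 -[LHS](tlift0 _ (comul C x)).
exact: HC_map_mul.
Qed.

Lemma HCs_map_act p q x (a : HCs A p) (b : HH A q) :
  HH_map Phi x (HCs_act a b) =
  tlift (fun y z => HCs_act (HCs_map Phi y a) (HH_map Phi z b)) (comul C x).
Proof.
case: p a => [|p] a; last exact: HH_map_act.
rewrite [HCs_act a b]/(0 : HH A _) (lin0 ((HH_map_bilin _).1 x)).
by rewrite -[LHS](tlift0 _ (comul C x)).
Qed.

End Homologies.

Theorem theorem1p2 (K : fieldType) (K_char0 : [pchar K] =i pred0)
    (A A' : comPzAlgType K) (C : coalgebra K) (C_cocomm : cocommutative C)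
    (Phi : C -> A -> A') (Phi_meas : measuring Phi) :
  nonunital_measuring (@HCstot_mul K A) (@HCstot_mul K A') (HCstot_map Phi) /\
  comodule_measuring (D := regular_comodule C) (@HCstot_act K A) (@HCstot_act K A')
    (HCstot_map Phi) (HHtot_map Phi).
Proof.
have HCs_b := HCs_map_bilin Phi_meas C_cocomm; have HH_b := HH_map_bilin Phi_meas C_cocomm.
split; split.
- exact: (dmap_linear HCs_b).
- exact: (dmap_linearl HCs_b).
- exact: (dmap_dmul (HCs_mul_bilin A) (HCs_mul_bilin A') HCs_b HCs_b HCs_b
    (HCs_map_mul Phi_meas C_cocomm)).
- exact: (dmap_linear HH_b).
- exact: (dmap_linearl HH_b).
- exact: (dmap_dmul (HCs_act_bilin A) (HCs_act_bilin A') HCs_b HH_b HH_b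
    (HCs_map_act Phi_meas C_cocomm)).
Qed.
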